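(* Let $E$ be a real $N\times N$ matrix all of whose eigenvalues have real part strictly greater than $1$, let $\psi:\mathbb{R}^N\to[0,\infty)$ be a continuous, symmetric, $E'$-homogeneous function, and let $X=\{X(t),\,t\in\mathbb{R}^N\}$ be the associated real-valued centered operator-scaling Gaussian random field $$X(t)=\int_{\mathbb{R}^N}\bigl(e^{i\langle t,\xi\rangle}-1\bigr)\frac{\widetilde{\mathcal M}(d\xi)}{\psi(\xi)^{1+Q/2}},\qquad Q=\operatorname{trace}(E).$$ Then there exists a constant $C_5>0$ such that for all $n\ge 2$ and all $t^1,\dots,t^n\in\mathbb{R}^N$, $$\operatorname{Var}\bigl(X(t^n)\,\big|\,X(t^1),\dots,X(t^{n-1})\bigr)\;\ge\; C_5\min_{0\le k\le n-1}\tau_E^2(t^n-t^k),$$ where $t^0=0$.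
   Context: Notation. $\|\cdot\|$ and $\langle\cdot,\cdot\rangle$ are the Euclidean norm and inner product on $\mathbb{R}^N$; $E'$ is the transpose of $E$; for $c>0$, $c^E=\sum_{n\ge0}(\ln c)^nE^n/n!$. Polar coordinates. Since the eigenvalues of $E$ have positive real parts, there is a norm $\|\cdot\|_E$ on $\mathbb{R}^N$ (fixed once and for all) such that, with $S_E=\{x:\|x\|_E=1\}$, the map $(0,\infty)\times S_E\to\mathbb{R}^N\setminus\{0\}$, $(r,\theta)\mapsto r^E\theta$, is a homeomorphism. Thus each $x\ne0$ is uniquely $x=(\tau_E(x))^E l_E(x)$ with $\tau_E(x)>0$, $l_E(x)\in S_E$; set $\tau_E(0)=0$. The function $\tau_E$ is continuous on $\mathbb{R}^N$, $\tau_E(-x)=\tau_E(x)$ and $\tau_E(r^Ex)=r\tau_E(x)$ for $r>0$. $E'$-homogeneous: $\psi(x)>0$ and $\psi(r^{E'}x)=r\psi(x)$ for all $r>0$ and $x\in\mathbb{R}^N\setminus\{0\}$. Symmetric: $\psi(\xi)=\psi(-\xi)$ for all $\xi$. $\widetilde{\mathcal M}$ is a centered complex-valued Gaussian random measure on $\mathbb{R}^N$ with Lebesgue control measure $m_N$: for Borel sets $A,B$ of finite Lebesgue measure, $\mathbb{E}\bigl(\widetilde{\mathcal M}(A)\overline{\widetilde{\mathcal M}(B)}\bigr)=m_N(A\cap B)$ and $\widetilde{\mathcal M}(-A)=\overline{\widetilde{\mathcal M}(A)}$. Consequently $X$ is real-valued, centered Gaussian, $X(0)=0$, with covariance $\mathbb{E}[X(s)X(t)]=\int_{\mathbb{R}^N}(e^{i\langle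 s,\xi\rangle}-1)(e^{-i\langle t,\xi\rangle}-1)\psi(\xi)^{-2-Q}\,d\xi$. *)

(* Defs.v *)
From HB Require Import structures.
From mathcomp Require Import all_boot all_order all_algebra.
From mathcomp Require Import complex.
From mathcomp Require Import all_classical all_reals all_analysis.
Import Order.TTheory GRing.Theory Num.Theory.
Import numFieldNormedType.Exports.

Set Implicit Arguments.
Unset Strict Implicit.
Unset Printing Implicit Defensive.

Local Open Scope classical_set_scope.
Local Open Scope complex_scope.
Local Open Scope ring_scope.

(* The product sigma-algebra on matrices. For T = R it is the Borel
   sigma-algebra of the topology that 'M[R]_(m, n) carries in the library. *)
Definition matrix_display : measure_display -> measure_display.
Proof. exact. Qed.

Section measurable_matrix.
Context {d} {T : measurableType d} (m n : nat).

Definition matrix_measurable : set (set 'M[T]_(m, n)) :=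
  <<s \bigcup_ij
        preimage_set_system setT (fun A : 'M[T]_(m, n) => A ij.1 ij.2)
          (@measurable _ T) >>.

Let mx_set0 : matrix_measurable set0.
Proof. exact: sigma_algebra0. Qed.

Let mx_setC A : matrix_measurable A -> matrix_measurable (~` A).
Proof. exact: sigma_algebraC. Qed.

Let mx_bigcup (F : (set 'M[T]_(m, n))^nat) :
  (forall i, matrix_measurable (F i)) -> matrix_measurable (\bigcup_i (F i)).
Proof. exact: sigma_algebra_bigcup. Qed.

HB.instance Definition _ := @isMeasurable.Build (matrix_display d)
  'M[T]_(m, n) matrix_measurable mx_set0 mx_setC mx_bigcup.

End measurable_matrix.

Lemma measurable_coord d (T : measurableType d) m n (i : 'I_m) (j : 'I_n) :
  measurable_fun [set: 'M[T]_(m, n)] (fun A => A i j).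
Proof.
move=> _ B mB; apply: sub_sigma_algebra.
by exists (i, j) => //; exists B.
Qed.

Lemma measurable_fun_mxP d d' (T : measurableType d) (T' : measurableType d')
    m n (f : T' -> 'M[T]_(m, n)) :
  (forall i j, measurable_fun setT (fun x => f x i j)) ->
  measurable_fun setT f.
Proof.
move=> mf.
apply: (measurability (\bigcup_ij
        preimage_set_system setT (fun A : 'M[T]_(m, n) => A ij.1 ij.2)
          (@measurable _ T))) => //.
move=> _ [_ [[i j] _ [B mB <-]] <-]; rewrite !setTI.
by rewrite -[X in measurable X]setTI; exact: mf.
Qed.

Section lebesgue_measure_cV.
Context {R : realType}.

Definition cons_cV n (p : measurableTypeR R * 'cV[R]_n) : 'cV[R]_n.+1 :=
  col_mx ((p.1 : R)%:M : 'M[R]_1) p.2.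

Lemma cons_cVE n p (i : 'I_n.+1) j :
  @cons_cV n p i j = oapp (fun k => p.2 k 0) p.1 (unlift 0 i).
Proof.
rewrite ord1 /cons_cV; case: unliftP => [k|] ->{i} /=.
  have -> : lift 0 k = rshift 1 k :> 'I_(1 + n) by exact: val_inj.
  exact: col_mxEd.
have -> : 0 = lshift n (0 : 'I_1) :> 'I_(1 + n) by exact: val_inj.
by apply: (etrans (col_mxEu _ _ _ _)); rewrite mxE eqxx.
Qed.

Lemma measurable_cons_cV n : measurable_fun setT (@cons_cV n).
Proof.
apply: measurable_fun_mxP => i j.
under eq_fun do rewrite cons_cVE.
case: (unlift 0 i) => [k|] /=; last exact: measurable_fst.
by apply: (measurableT_comp (measurable_coord k 0)); exact: measurable_snd.
Qed.

Definition uncons_cV n (x : 'cV[R]_n.+1) : measurableTypeR R * 'cV[R]_n :=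
  (x 0 0, \col_i x (lift 0 i) 0).

Lemma measurable_uncons_cV n : measurable_fun setT (@uncons_cV n).
Proof.
apply/measurable_fun_pairP; split; first exact: measurable_coord.
apply: measurable_fun_mxP => i j.
rewrite (_ : (fun x => _) = (fun x : 'cV[R]_n.+1 => x (lift 0 i) 0)).
  exact: measurable_coord.
by apply/funext => x /=; rewrite mxE.
Qed.

Lemma cons_cVK n : cancel (@cons_cV n) (@uncons_cV n).
Proof.
move=> [a x]; rewrite /uncons_cV !cons_cVE unlift_none /=; congr pair.
by apply/colP => i; rewrite mxE cons_cVE liftK.
Qed.

Local Notation sfm n := {sigma_finite_measure set 'cV[R]_n -> \bar R}.

Section step.
Variables (n : nat) (m : sfm n).

Definition lebesgue_cV_step : set 'cV[R]_n.+1 -> \bar R :=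
  pushforward (@lebesgue_measure R \x m)%E (@cons_cV n).

Let pushforward_cons_cV : {measure set 'cV[R]_n.+1 -> \bar R} :=
  measure_function_pushforward__canonical__measure_function_Measure
    (@lebesgue_measure R \x m)%E (@measurable_cons_cV n).

HB.instance Definition _ := isMeasure.Build _ _ _ lebesgue_cV_step
  (measure0 pushforward_cons_cV) (measure_ge0 pushforward_cons_cV)
  (@measure_semi_sigma_additive _ _ _ pushforward_cons_cV).

Lemma sigma_finite_lebesgue_cV_step : sigma_finite setT lebesgue_cV_step.
Proof.
have /sigma_finiteP[G [TG ndG Goo]] := sigma_finiteT (@lebesgue_measure R).
have /sigma_finiteP[H [TH ndH Hoo]] := sigma_finiteT m.
pose F k : set (measurableTypeR R * 'cV[R]_n)%type := G k `*` H k.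
have UF : setT = \bigcup_k F k.
  rewrite -setXTT TG TH predeqE => -[x y]; split.
    move=> [/= [i _ Gix] [k _ Hky]]; exists (maxn i k) => //; split.
    - by move: x Gix; exact/subsetPset/ndG/leq_maxl.
    - by move: y Hky; exact/subsetPset/ndH/leq_maxr.
  by move=> [i _ []/= ? ?]; split; exists i.
have mF k : measurable (F k) /\ ((@lebesgue_measure R \x m) (F k) < +oo)%E.
  have [? ?] := Goo k; have [? ?] := Hoo k; split; first exact: measurableX.
  by rewrite product_measure1E// lte_mul_pinfty// ge0_fin_numE.
exists (fun k => @uncons_cV n @^-1` F k).
  by rewrite -preimage_bigcup -UF preimage_setT.
move=> k; have [mFk Fk] := mF k; split.
  by rewrite -[X in measurable X]setTI; exact: measurable_uncons_cV.
rewrite /lebesgue_cV_step /pushforward -comp_preimage.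
by rewrite (_ : _ \o _ = idfun) //; apply/funext => p /=; rewrite cons_cVK.
Qed.

HB.instance Definition _ :=
  Measure_isSigmaFinite.Build _ _ _ lebesgue_cV_step
    sigma_finite_lebesgue_cV_step.

End step.

(* Lebesgue measure on the column vectors, by iterating the product with the
   Lebesgue measure of R along x |-> (x_0, (x_1, ..., x_(n-1))). *)
Fixpoint lebesgue_cV n : sfm n :=
  match n with
  | 0 => (\d_(0 : 'cV[R]_0))
  | n'.+1 => lebesgue_cV_step (lebesgue_cV n')
  end.

Lemma lebesgue_cV_box n (B : 'I_n -> set R) :
  (forall i, measurable (B i)) ->
  lebesgue_cV n [set x | forall i, B i (x i 0)] =
  (\prod_(i < n) lebesgue_measure (B i))%E.
Proof.
elim: n B => [|n IHn] B mB /=.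
  by rewrite big_ord0 diracE mem_set//= => -[].
have mB' : measurable [set x : 'cV[R]_n | forall i, B (lift 0 i) (x i 0)].
  rewrite (_ : [set x | _] = \bigcap_(i in [set: 'I_n])
      ((fun x : 'cV[R]_n => x i 0) @^-1` B (lift 0 i))).
    apply: fin_bigcap_measurable => // i _.
    by rewrite -[X in measurable X]setTI; exact: measurable_coord.
  by apply/seteqP; split=> x /= xB i => [_|]; exact: xB.
rewrite /lebesgue_cV_step /pushforward big_ord_recl -IHn// -product_measure1E//; last exact: (mB ord0).
congr (_ _); apply/seteqP; split=> [[a x]|[a x] [/= Ba Bx] i] /=.
  move=> aB; split=> /= [|i].
    by have := aB 0; rewrite cons_cVE unlift_none.
  by have := aB (lift 0 i); rewrite cons_cVE liftK.
by rewrite cons_cVE; case: unliftP => [k ->|->] /=.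
Qed.

End lebesgue_measure_cV.

Definition homeomorphism_on (T U : topologicalType) (A : set T) (B : set U)
    (f : T -> U) : Prop :=
  exists g : U -> T,
    [/\ {homo f : x / A x >-> B x} /\ {homo g : y / B y >-> A y},
        (forall x, A x -> g (f x) = x) /\ (forall y, B y -> f (g y) = y),
        {within A, continuous f} &
        {within B, continuous g}].

Section operator_scaling.
Context {R : realType} (N : nat).
Implicit Types (E : 'M[R]_N) (x y : 'cV[R]_N).

Definition inner x y : R := (x^T *m y) 0 0.

Definition mxpow (c : R) E : 'M[R]_N :=
  limn (series (fun n => (ln c ^+ n / n`!%:R) *: E ^+ n)).

Definition eigenvalues_Re_gt1 E : Prop :=
  forall z : R[i], eigenvalue (map_mx (real_complex R) E) z -> 1 < complex.Re z.

Definition homogeneous E (psi : 'cV[R]_N -> R) : Prop :=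
  forall x, x != 0 ->
    0 < psi x /\ forall r, 0 < r -> psi (mxpow r E *m x) = r * psi x.

Definition is_norm (nE : 'cV[R]_N -> R) : Prop :=
  [/\ forall x, nE x = 0 -> x = 0,
      forall (a : R) x, nE (a *: x) = `|a| * nE x &
      forall x y, nE (x + y) <= nE x + nE y].

Definition polar_norm E (nE : 'cV[R]_N -> R) : Prop :=
  is_norm nE /\
  homeomorphism_on
    ([set r : R | 0 < r] `*` [set theta : 'cV[R]_N | nE theta = 1])
    [set x : 'cV[R]_N | x != 0]
    (fun p => mxpow p.1 E *m p.2).

(* The polar radius tau_E: for x != 0, the unique r > 0 such that
   x = r^E theta for some theta in the unit sphere of nE. *)
Definition tau E (nE : 'cV[R]_N -> R) x : R :=
  if x == 0 then 0 else
  xget 0 [set r : R | 0 < r /\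
                      exists2 theta, nE theta = 1 & x = mxpow r E *m theta].

(* The integrand; its value at xi = 0, a Lebesgue-null point, is irrelevant. *)
Definition spectral_kernel E (psi : 'cV[R]_N -> R) (t xi : 'cV[R]_N) : R[i] :=
  ((cos (inner t xi) +i* sin (inner t xi)) - 1)
    / (psi xi `^ (1 + \tr E / 2))%:C.

End operator_scaling.

Section gaussian_measure.
Context {d : measure_display} {T : measurableType d} {R : realType}.
Variable P : probability T R.

(* normal_prob m 0 is not the Dirac measure at m, hence the case distinction. *)
Definition centered_gaussian (Y : T -> R) : Prop :=
  measurable_fun setT Y /\
  exists s : R, forall B : set R, measurable B ->
    P (Y @^-1` B) = (if s == 0 then \d_(0 : R) B else normal_prob 0 s B).

Definition finite_borel (N : nat) (A : set 'cV[R]_N) : Prop :=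
  measurable A /\ (lebesgue_cV N A < +oo)%E.

(* Complex-valued centered Gaussian random measure with Lebesgue control
   measure; its (almost sure, L^2) additivity follows from the covariance. *)
Record gaussian_random_measure (N : nat) (M : set 'cV[R]_N -> T -> R[i])
    : Prop := {
  grm_gaussian : forall (k : nat) (A : 'I_k -> set 'cV[R]_N) (a b : 'I_k -> R),
    (forall i, finite_borel (A i)) ->
    centered_gaussian (fun w =>
      \sum_(i < k) (a i * complex.Re (M (A i) w) + b i * complex.Im (M (A i) w)));
  grm_covariance : forall A B, finite_borel A -> finite_borel B ->
    ('E_P[fun w => complex.Re (M A w * (M B w)^*)%R] = lebesgue_cV N (A `&` B))%E /\
    ('E_P[fun w => complex.Im (M A w * (M B w)^*)%R] = 0)%E;
  grm_hermitian : forall A, finite_borel A ->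
    {ae P, forall w, M (-%R @` A) w = (M A w)^*}
}.

Definition simple_fun (N : nat) (s : seq (R[i] * set 'cV[R]_N)) (xi : 'cV[R]_N)
    : R[i] := \sum_(p <- s) p.1 * (\1_p.2 xi)%:C.

Definition simple_integral (N : nat) (M : set 'cV[R]_N -> T -> R[i])
    (s : seq (R[i] * set 'cV[R]_N)) (w : T) : R[i] :=
  \sum_(p <- s) p.1 * M p.2 w.

(* Y is (a version of) the integral of f with respect to M: the L^2(P)-limit of
   the integrals of simple functions converging to f in L^2. *)
Definition is_stochastic_integral (N : nat) (M : set 'cV[R]_N -> T -> R[i])
    (f : 'cV[R]_N -> R[i]) (Y : T -> R[i]) : Prop :=
  exists s : nat -> seq (R[i] * set 'cV[R]_N),
    [/\ forall k p, p \in s k -> finite_borel p.2,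
        (\int[lebesgue_cV N]_xi
          (Normc.normc (simple_fun (s k) xi - f xi) ^+ 2)%R%:E
          @[k --> \oo] --> 0)%E &
        ('E_P[fun w => (Normc.normc (simple_integral M (s k) w - Y w) ^+ 2)%R]
          @[k --> \oo] --> 0)%E].

End gaussian_measure.

Section conditional_variance.
Context {d : measure_display} {T : measurableType d} {R : realType}.
Variable P : probability T R.

Definition is_cond_expectation (G : set (set T)) (Y Z : T -> R) : Prop :=
  [/\ forall B : set R, measurable B -> G (Z @^-1` B),
      P.-integrable setT (EFin \o Z) &
      forall A, G A ->
        (\int[P]_(w in A) (Z w)%:E = \int[P]_(w in A) (Y w)%:E)%E].

(* A chosen version of E[Y | G]: two versions agree P-almost surely. *)
Definition cond_expectation (G : set (set T)) (Y : T -> R) : T -> R :=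
  xget (cst 0) [set Z | is_cond_expectation G Y Z].

Definition cond_variance (G : set (set T)) (Y : T -> R) : T -> R :=
  cond_expectation G (fun w => (Y w - cond_expectation G Y w) ^+ 2).

End conditional_variance.

(* Main.v *)
(* The conditional variance of X(t^n) given X(t^1), ..., X(t^(n-1)) is the
   squared L^2 distance of X(t^n) to their span, because the residual of the
   orthogonal projection is independent of them: it is uncorrelated with them
   and all linear combinations are Gaussian.  Independence is read off the
   factorisation of E cos (u xi + V + c), a cosine transform determining the
   integrals over the events generated by the X(t^j).
   In the spectral domain that distance is, up to a constant factor, the
   integral of |1 - sum_(0 <= k < n) b_k exp (- i <t^n - t^k, x>)|^2 against
   psi^(-2-Q), the constant -1 of the kernel being the term of t^0 = 0.  The
   change of variables x -> r^(E') x multiplies it by a power of r and reduces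
   to the case where every tau_E (t^n - t^k) is large.  There, let g be a
   product of even powers of sin y / y, whose Fourier transform has compact
   support: all the integrals of g cos <t^n - t^k, x> vanish, and the
   Cauchy-Schwarz inequality bounds the square of the integral of g by the
   spectral integral times the integral of g^2 psi^(2+Q), which is finite since
   psi grows polynomially. *)

Require Import Defs.
From mathcomp Require Import all_boot all_order all_fingroup all_algebra.
From mathcomp Require Import complex ring lra.
From mathcomp Require Import all_classical all_reals all_analysis.
From mathcomp Require Import measurable_realfun.
Import Order.TTheory GRing.Theory Num.Theory.
Import numFieldNormedType.Exports.

Set Implicit Arguments.
Unset Strict Implicit.
Unset Printing Implicit Defensive.

Local Open Scope classical_set_scope.
Local Open Scope ring_scope.

(** * Linear changes of variables *)

(** The estimates on r^(E') for small r come from psi: comparing its minimum on the unit sphere with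
    its maximum on a ball shows that r^(E') contracts as r -> 0, whence psi 0 = 0, the polynomial
    growth of psi, the smallness of the entries of r^(E') and the positivity of Q. The exponent 2 of
    tau is what remains of the factors r^(-Q) of the determinant and r^(2+Q) of psi. The constant
    must depend neither on n nor on the points: the test function g is therefore fixed once, and
    only the size of the frequencies enters. Sine kernels serve twice: powers of sin y / y build g,
    and a product of two sines over x^2 has a trapezoid as cosine transform, from which indicators
    of intervals are recovered. Gaussian laws enter through s |-> E cos (s G) with G standard; its
    product rule makes it a multiplicative function of the variance. Independence takes the form of
    two statements: the residual xi, and xi^2 - E xi^2, have zero integral over every event
    generated by the X(t^j). *)

Section affine_change_of_variable.
Context {R : realType}.
Local Notation mu := (@lebesgue_measure R).
Variables (a b : R).
Hypothesis a0 : a != 0.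

Let phi : measurableTypeR R -> measurableTypeR R := fun x => a * x + b.

Lemma measurable_affine : measurable_fun setT phi.
Proof. by apply: measurable_funD => //; apply: measurable_funM. Qed.

Let pmu : {measure set _ -> \bar R} :=
  measure_function_pushforward__canonical__measure_function_Measure
    mu measurable_affine.

Let nu : {measure set _ -> \bar R} := mscale (NngNum (normr_ge0 a)) pmu.

(** Uniqueness of Lebesgue measure: it suffices that the rescaled image measure gives bounded
    left-open intervals their length. *)
Let lebesgue_measure_affine (A : set (measurableTypeR R)) :
  measurable A -> mu A = nu A.
Proof.
move=> mA; apply: (lebesgue_measure_unique (mu := nu)) => // _ [[l u]] _ <-.
rewrite /nu /= /mscale/= /pushforward/=.
case: (ltgtP a 0) => [an|ap|/eqP]; last by rewrite (negbTE a0).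
(* For a < 0 the map reverses the order, so the preimage is closed on the left and open on the
   right, with the same length. *)
- rewrite (_ : phi @^-1` _ = `[(u - b) / a, (l - b) / a[%classic); last first.
    apply/seteqP; split => x /=; rewrite !in_itv/= ler_ndivrMr ?ltr_ndivlMr// /phi;
    by rewrite lerBrDr ltrBlDr mulrC andbC.
  rewrite !lebesgue_measure_itv/= !lte_fin ltr_ndivlMr// divfK ?ltr0_neq0//.
  rewrite ltrD2r ltr0_norm//; case: ifP => _; last by rewrite mule0.
  by rewrite -!EFinB -EFinM; congr EFin; field; rewrite a0.
- rewrite (_ : phi @^-1` _ = `](l - b) / a, (u - b) / a]%classic); last first.
    apply/seteqP; split => x /=; rewrite !in_itv/= ler_pdivlMr ?ltr_pdivrMr// /phi;
    by rewrite lerBrDr ltrBlDr mulrC.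
  rewrite !lebesgue_measure_itv/= !lte_fin ltr_pdivlMr// divfK ?gt_eqF//.
  rewrite ltrD2r gtr0_norm//; case: ifP => _; last by rewrite mule0.
  by rewrite -!EFinB -EFinM; congr EFin; field; rewrite a0.
Qed.

Lemma ge0_integral_affine (f : R -> \bar R) :
  measurable_fun setT f -> (forall x, 0 <= f x)%E ->
  (`|a|%:E * \int[mu]_x f (a * x + b)%R = \int[mu]_x f x)%E.
Proof.
move=> mf f0.
transitivity (\int[nu]_x f x)%E; last first.
  by apply: eq_measure_integral => A mA _; exact/esym/lebesgue_measure_affine.
rewrite ge0_integral_mscale//=; congr (_ * _)%E.
rewrite (ge0_integral_pushforward (measurable_affine))//.
Qed.

End affine_change_of_variable.

(** * Tonelli and linear substitutions for Lebesgue measure on column vectors *)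

Section integral_cV.
Context {R : realType}.
Local Notation mu := (@lebesgue_measure R).
Local Notation leb := (@lebesgue_cV R).

Lemma measurable_fun_mulmx m n (A : 'M[R]_(m, n)) :
  measurable_fun setT (fun x : 'cV[R]_n => A *m x).
Proof.
apply: measurable_fun_mxP => i j.
under eq_fun do rewrite mxE.
by apply: measurable_sum => k; apply: measurable_funM => //; exact: measurable_coord.
Qed.

Lemma measurable_fun_translate n (v : 'cV[R]_n) :
  measurable_fun setT (fun x : 'cV[R]_n => x + v).
Proof.
apply: measurable_fun_mxP => i j.
under eq_fun do rewrite mxE.
by apply: measurable_funD => //; exact: measurable_coord.
Qed.

Lemma integral_cVSE n (f : 'cV[R]_n.+1 -> \bar R) :
  measurable_fun setT f -> (forall x, 0 <= f x)%E ->
  (\int[leb n.+1]_x f x = \int[mu \x leb n]_p f (cons_cV p))%E.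
Proof.
move=> mf f0.
by rewrite [LHS](ge0_integral_pushforward (@measurable_cons_cV R n)).
Qed.

Lemma integral_cVS n (f : 'cV[R]_n.+1 -> \bar R) :
  measurable_fun setT f -> (forall x, 0 <= f x)%E ->
  (\int[leb n.+1]_x f x = \int[mu]_a \int[leb n]_y f (cons_cV (a, y)))%E.
Proof.
move=> mf f0; rewrite integral_cVSE// fubini_tonelli1//.
by apply: measurableT_comp => //; exact: measurable_cons_cV.
Qed.

Lemma integral_cVS_swap n (f : 'cV[R]_n.+1 -> \bar R) :
  measurable_fun setT f -> (forall x, 0 <= f x)%E ->
  (\int[leb n.+1]_x f x = \int[leb n]_y \int[mu]_a f (cons_cV (a, y)))%E.
Proof.
move=> mf f0; rewrite integral_cVSE// fubini_tonelli2//.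
by apply: measurableT_comp => //; exact: measurable_cons_cV.
Qed.

Lemma measurable_integral_cons n (f : 'cV[R]_n.+1 -> \bar R) :
  measurable_fun setT f -> (forall x, 0 <= f x)%E ->
  measurable_fun setT (fun y => \int[mu]_a f (cons_cV (a, y)))%E.
Proof.
move=> mf f0.
apply: (@measurable_fun_fubini_tonelli_G _ _ _ _ _ mu (f \o @cons_cV R n)).
  by apply: measurableT_comp => //; exact: measurable_cons_cV.
by move=> p; exact: f0.
Qed.

Lemma measurable_cons_cVl n (y : 'cV[R]_n) :
  measurable_fun setT (fun a : measurableTypeR R => cons_cV (a, y)).
Proof. by apply: (measurableT_comp (@measurable_cons_cV R n)); exact: measurable_pair2. Qed.

Lemma measurable_cons_cVr n (a : measurableTypeR R) :
  measurable_fun setT (fun y : 'cV[R]_n => cons_cV (a, y)).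
Proof. by apply: (measurableT_comp (@measurable_cons_cV R n)); exact: measurable_pair1. Qed.

(** Induction on the dimension: with the first coordinate integrated innermost, the one-dimensional
    rule translates it, and the induction hypothesis moves the others. *)
Lemma integral_cV_translate n (v : 'cV[R]_n) (f : 'cV[R]_n -> \bar R) :
  measurable_fun setT f -> (forall x, 0 <= f x)%E ->
  (\int[leb n]_x f (x + v)%R = \int[leb n]_x f x)%E.
Proof.
elim: n v f => [|n IH] v f mf f0.
  by apply: eq_integral => x _; rewrite (flatmx0 (x + v)) (flatmx0 x).
have consD (a : R) y : cons_cV (a, y) + v =
    cons_cV (1 * a + v 0 0, y + \col_i v (lift 0 i) 0).
  apply/matrixP => i j; rewrite mxE !cons_cVE !ord1.
  by case: unliftP => [k ->|->] /=; rewrite ?mxE// mul1r.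
have mfv : measurable_fun setT (fun x : 'cV[R]_n.+1 => f (x + v)).
  by apply: measurableT_comp => //; exact: measurable_fun_translate.
rewrite (integral_cVS_swap mfv (fun x => f0 _)) (integral_cVS_swap mf f0).
pose g y := (\int[mu]_a f (cons_cV (a, y)))%E.
rewrite -[RHS](IH (\col_i v (lift 0 i) 0) g); last 2 first.
- exact: measurable_integral_cons.
- by move=> y; apply: integral_ge0.
apply: eq_integral => y _.
under eq_integral do rewrite consD.
rewrite /g -[RHS](@ge0_integral_affine _ 1 (v 0 0) (oner_neq0 _)
   (fun a => f (cons_cV (a, y + \col_i v (lift 0 i) 0)))) ?normr1 ?mul1e//.
by apply: measurableT_comp => //; exact: measurable_cons_cVl.
Qed.

(** The change of variables as a property of the matrix: being multiplicative, it can be proved on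
    triangular factors. Nonnegative functions let Tonelli apply without integrability. *)
Definition linear_cov n (M : 'M[R]_n) := forall f : 'cV[R]_n -> \bar R,
  measurable_fun setT f -> (forall x, 0 <= f x)%E ->
  (`|\det M|%:E * \int[leb n]_x f (M *m x) = \int[leb n]_x f x)%E.

Lemma linear_cov_mul n (A B : 'M[R]_n) :
  linear_cov A -> linear_cov B -> linear_cov (A *m B).
Proof.
move=> cA cB f mf f0.
rewrite -[RHS]cA// -(cB (fun x => f (A *m x)))//; last first.
  by apply: measurableT_comp => //; exact: measurable_fun_mulmx.
rewrite det_mulmx normrM EFinM muleA; congr (_ * _)%E.
by apply: eq_integral => x _; rewrite mulmxA.
Qed.

(** With the first coordinate integrated innermost, the other ones y are fixed and the map on it is
    the affine x |-> a x + b y. *)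
Lemma linear_cov_upper n (a : R) (b : 'rV[R]_n) (D : 'M[R]_n) :
  a != 0 -> linear_cov D ->
  linear_cov (block_mx (a%:M : 'M[R]_1) b 0 D : 'M[R]_(1 + n)).
Proof.
move=> a0 cD f mf f0.
have mfM : measurable_fun setT (fun x => f (block_mx (a%:M : 'M[R]_1) b 0 D *m x)).
  by apply: measurableT_comp => //; exact: measurable_fun_mulmx.
rewrite (integral_cVS_swap mfM (fun x => f0 _)) (integral_cVS_swap mf f0).
rewrite det_ublock det_scalar1 normrM EFinM.
rewrite -[RHS](cD (fun y => \int[mu]_a f (cons_cV (a, y)))%E); last 2 first.
- exact: measurable_integral_cons.
- by move=> y; apply: integral_ge0.
rewrite muleAC muleC; congr (_ * _)%E.
rewrite -ge0_integralZl//; last 2 first.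
- exact: (measurable_integral_cons mfM (fun x => f0 _)).
- by move=> y _; apply: integral_ge0.
apply: eq_integral => y _.
rewrite -[RHS](@ge0_integral_affine _ a ((b *m y) 0 0) a0
   (fun x => f (cons_cV (x, D *m y))))//; last first.
  by apply: measurableT_comp => //; exact: measurable_cons_cVl.
congr (_ * _)%E; apply: eq_integral => x _; congr f.
rewrite /cons_cV /= mul_block_col; congr col_mx.
  by apply/matrixP => i j; rewrite !ord1 -scalar_mxM !mxE eqxx !mulr1n.
by rewrite mul0mx add0r.
Qed.

(** A shear: with the first coordinate x outermost, the others undergo the translation by x c. *)
Lemma linear_cov_lower n (c : 'cV[R]_n) :
  linear_cov (block_mx (1%:M : 'M[R]_1) 0 c 1%:M : 'M[R]_(1 + n)).
Proof.
move=> f mf f0.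
have mfM : measurable_fun setT (fun x => f (block_mx (1%:M : 'M[R]_1) 0 c 1%:M *m x)).
  by apply: measurableT_comp => //; exact: measurable_fun_mulmx.
rewrite (integral_cVS mfM (fun x => f0 _)) (integral_cVS mf f0).
rewrite det_lblock !det1 mulr1 normr1 mul1e.
apply: eq_integral => x _.
rewrite -[RHS](integral_cV_translate (x *: c))//; last first.
  by apply: measurableT_comp => //; exact: measurable_cons_cVr.
apply: eq_integral => y _; congr f.
rewrite /cons_cV /= mul_block_col !mul1mx mul0mx addr0; congr col_mx.
by rewrite mul_mx_scalar addrC.
Qed.

(** Gaussian elimination: a matrix with non-zero pivot is a lower shear times a block triangular
    matrix whose corner [D], the Schur complement, is invertible of smaller size. *)
Lemma unitmx_linear_cov n (M : 'M[R]_n) : \det M != 0 -> linear_cov M.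
Proof.
elim: n M => [|n IH] M dM.
  move=> f mf f0; rewrite det_mx00 normr1 mul1e.
  by apply: eq_integral => x _; rewrite (flatmx0 (M *m x)) (flatmx0 x).
have step (M' : 'M[R]_(1 + n)) : ulsubmx M' 0 0 != 0 -> \det M' != 0 -> linear_cov M'.
  move=> a0 dM'.
  pose a := ulsubmx M' 0 0; pose B := ursubmx M'; pose C := dlsubmx M'.
  pose D := drsubmx M' - a^-1 *: (C *m B).
  have M'E : M' = block_mx (1%:M : 'M[R]_1) 0 (a^-1 *: C) 1%:M *m block_mx (a%:M : 'M[R]_1) B 0 D.
    rewrite mulmx_block !mul1mx !mul0mx !addr0 -!scalemxAl mul_mx_scalar.
    rewrite scalerA mulVf// scale1r addrC subrK -[LHS]submxK.
    by congr block_mx; rewrite [ulsubmx M']mx11_scalar.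
  rewrite M'E; apply: linear_cov_mul; first exact: linear_cov_lower.
  apply: linear_cov_upper => //; apply: IH; apply: contra dM' => /eqP D0.
  by rewrite M'E det_mulmx det_ublock D0 !mulr0.
change (linear_cov (M : 'M[R]_(1 + n))).
have [a0|] := eqVneq ((ulsubmx (M : 'M[R]_(1 + n))) 0 0) 0; last by move=> /step; exact.
(* With a zero pivot, another entry of the first column is non-zero, since the determinant is; [U e]
   adds its row to the first one. *)
have [i Ci] : exists i, (dlsubmx (M : 'M[R]_(1 + n))) i 0 != 0.
  apply/existsP; rewrite -negb_forall; apply: contra dM => /forallP C0.
  rewrite (expand_det_col M 0) big1// => j _.
  suff -> : M j 0 = 0 by rewrite mul0r.
  have -> : 0 = lshift n (0 : 'I_1) :> 'I_(1 + n) by exact: val_inj.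
  case: (splitP (j : 'I_(1 + n))) => k jk.
    have -> : j = lshift n k :> 'I_(1 + n) by exact: val_inj.
    by rewrite (ord1 k); move: a0; rewrite !mxE.
  have -> : j = rshift 1 k :> 'I_(1 + n) by exact: val_inj.
  by have /eqP := C0 k; rewrite !mxE.
pose e : 'rV[R]_n := delta_mx 0 i.
pose U (v : 'rV[R]_n) : 'M[R]_(1 + n) := block_mx (1%:M : 'M[R]_1) v 0 1%:M.
have dU v : \det (U v) = 1 by rewrite det_ublock !det1 mulr1.
have -> : M = U (- e) *m (U e *m M).
  rewrite mulmxA mulmx_block !mul1mx !mulmx0 !mulmx1 !mul0mx !addr0 add0r.
  by rewrite addrN -scalar_mx_block mul1mx.
apply: linear_cov_mul.
  apply: linear_cov_upper; first exact: oner_neq0.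
  by apply: IH; rewrite det1 oner_neq0.
apply: step; last by rewrite det_mulmx dU mul1r.
have ulE (A : 'M[R]_(1 + n)) v : ulsubmx (U v *m A) = ulsubmx A + v *m dlsubmx A.
  by rewrite -[A in LHS]submxK /U mulmx_block block_mxKul mul1mx.
by rewrite ulE mxE a0 add0r /e -rowE mxE.
Qed.

End integral_cV.

(** * Homogeneous functions *)

Section topology_cV.
Context {R : realType}.

Lemma measurable_ball_cV n (x : 'cV[R]_n) (e : R) : measurable (ball x e).
Proof.
have [e0|e0] := ltP 0 e; last first.
  rewrite (_ : ball x e = set0)//; apply/seteqP; split => // y [e1 _].
  by move: e1; rewrite ltNge e0.
rewrite (_ : ball x e = \bigcap_(i in [set: 'I_n])
  ((fun y : 'cV[R]_n => y i 0) @^-1` ball (x i 0) e)).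
  apply: fin_bigcap_measurable => // i _.
  rewrite -[X in measurable X]setTI.
  by apply: (@measurable_coord _ R n 1 i 0) => //; exact: measurable_ball.
apply/seteqP; split => [y [_ xy] i _|y xy]; first exact: xy.
by split => // i j; rewrite (ord1 j); exact: xy.
Qed.

(** The sigma-algebra on vectors is generated by the coordinates; an open set is the countable union
    of the balls with rational centre and radius 1/(k+1) that it contains. *)
Lemma open_measurable_cV n (U : set 'cV[R]_n) : open U -> measurable U.
Proof.
move=> oU; pose B (q : 'cV[rat]_n * nat) : set 'cV[R]_n :=
  ball (map_mx (ratr : rat -> R) q.1) q.2.+1%:R^-1.
pose F q := if `[< B q `<=` U >] then B q else set0.
rewrite (_ : U = \bigcup_q F q).
  apply: countable_bigcupT_measurable => // q.
  by rewrite /F; case: ifP => _ //; exact: measurable_ball_cV.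
apply/seteqP; split => [x Ux|x [q _]]; last first.
  by rewrite /F; case: asboolP => // + Bx; exact.
have /nbhs_ballP[e /= e0 xeU] : nbhs x U by exact: open_nbhs_nbhs.
have [k ke] : exists k, k.+1%:R^-1 < e / 2.
  exists (Num.truncn (e / 2)^-1).
  rewrite -[ltRHS]invrK ltf_pV2 ?posrE ?invr_gt0 ?divr_gt0//.
  exact: truncnS_gt.
pose d : R := k.+1%:R^-1.
have d0 : 0 < d by rewrite invr_gt0.
have qP i : exists q : rat, ball (ratr q : R) d (x i 0).
  have /rat_in_itvoo[q] : x i 0 - d < x i 0 + d by lra.
  rewrite in_itv/= => /andP[q1 q2]; exists q.
  rewrite /ball/= ltr_norml; apply/andP; split; lra.
have [q qx] := choice qP.
exists (\col_i q i, k) => //; rewrite /F asboolT.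
  by split=> // i j; rewrite !mxE (ord1 j); exact: qx.
move=> y By; apply: xeU; apply: (@le_ball _ _ _ (d + d)).
  by move: ke; rewrite -/d; lra.
apply: (@ball_triangle _ _ (map_mx (ratr : rat -> R) (\col_i q i))); last exact: By.
by apply: ball_sym; split=> // i j; rewrite !mxE (ord1 j); exact: qx.
Qed.

Lemma continuous_measurable_cV n (f : 'cV[R]_n -> R) :
  continuous f -> measurable_fun setT f.
Proof.
move=> cf; apply: (measurability _ (RGenOpens.measurableE R)).
move=> _ [_ [a [b ->] <-]]; rewrite setTI; apply: open_measurable_cV.
by move/continuousP: cf; apply; exact: interval_open.
Qed.

Lemma trmx_continuous m n : continuous (@trmx R m n).
Proof.
move=> A B /nbhs_ballP[e /= e0 AB]; apply/nbhs_ballP; exists e => //= C [_ AC].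
by apply: AB; split=> // i j; rewrite !mxE; exact: AC.
Qed.

Lemma norm_trmx m n (A : 'M[R]_(m, n)) : `|A^T| = `|A|.
Proof.
have norm_le k l (B : 'M[R]_(k, l)) : `|B^T| <= `|B|.
  rewrite [leLHS]mx_normrE; apply/bigmax_leP; split => // -[i j] _ /=.
  by rewrite mxE /Num.norm /= mx_normrE; apply: (le_bigmax _ _ (j, i)).
by apply/eqP; rewrite eq_le norm_le -{1}(trmxK A) norm_le.
Qed.

Lemma le_mx_norm m n (A : 'M[R]_(m, n)) i j : `|A i j| <= `|A|.
Proof. by rewrite [leRHS]mx_normrE; apply: (le_bigmax _ _ (i, j)). Qed.

Lemma mx_norm_leP m n (A : 'M[R]_(m, n)) (c : R) : 0 <= c ->
  (forall i j, `|A i j| <= c) -> `|A| <= c.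
Proof.
by move=> c0 Ac; rewrite [leLHS]mx_normrE; apply/bigmax_leP; split => // -[i j] _ /=.
Qed.

End topology_cV.

Section compact_cV.
Context {R : realType}.

(** Transposition is an isometry onto row vectors, where the Heine-Borel theorem is stated. *)
Lemma bounded_closed_compact_cV n (A : set 'cV[R]_n) :
  bounded_set A -> closed A -> compact A.
Proof.
move=> bA cA; rewrite (_ : A = trmx @` (trmx @` A)); last first.
  rewrite image_comp (_ : _ \o _ = id) ?image_id//.
  by apply/funext => x /=; rewrite trmxK.
apply: continuous_compact; first exact/continuous_subspaceT/trmx_continuous.
apply: bounded_closed_compact.
- move: bA => [M [Mr MA]]; exists M; split => // e Me _ [x Ax <-].
  by rewrite /= norm_trmx; exact: MA.
- rewrite (_ : trmx @` A = trmx @^-1` A); last first.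
    apply/seteqP; split=> [_ [x Ax <-]|x Ax] /=; first by rewrite trmxK.
    by exists (x^T) => //; rewrite trmxK.
  by apply: closed_comp cA => x _; exact: trmx_continuous.
Qed.

Lemma compact_closed_ball_cV n (c : R) : compact [set x : 'cV[R]_n | `|x| <= c].
Proof.
apply: bounded_closed_compact_cV.
  exists c; split; first exact: num_real.
  by move=> e ce x /= /le_trans; apply; exact: ltW.
apply: (@closed_comp _ _ (fun x : 'cV[R]_n => `|x|) [set r | r <= c]).
  by move=> x _; exact: norm_continuous.
exact: closed_le.
Qed.

Lemma compact_sphere_cV n : compact [set x : 'cV[R]_n | `|x| = 1].
Proof.
apply: (@subclosed_compact _ _ [set x : 'cV[R]_n | `|x| <= 1]).
- apply: (@closed_comp _ _ (fun x : 'cV[R]_n => `|x|) [set 1]).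
    by move=> x _; exact: norm_continuous.
  exact: closed_eq.
- exact: compact_closed_ball_cV.
- by move=> x /= ->.
Qed.

End compact_cV.

(** * Functions homogeneous under a family of matrices [phi], later r |-> r^(E') *)

Section homogeneous_function.
Context {R : realType} (n : nat).
Variables (psi : 'cV[R]_n.+1 -> R) (phi : R -> 'M[R]_n.+1).
Hypothesis psi_cont : continuous psi.
Hypothesis psi_gt0 : forall x : 'cV[R]_n.+1, x != 0 -> 0 < psi x.
Hypothesis psi_hom : forall (r : R) (x : 'cV[R]_n.+1), 0 < r -> x != 0 ->
  psi (phi r *m x) = r * psi x.

(* Rescale phi r x to the unit sphere: there psi is bounded below, while
   homogeneity makes its value at most r times the maximum of psi on a ball. *)
Lemma homogeneous_contraction (K : R) : 0 < K ->
  exists2 r0, 0 < r0 & forall (r : R) (x : 'cV[R]_n.+1),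
    0 < r -> r <= r0 -> `|phi r *m x| * K <= `|x|.
Proof.
move=> K0.
pose S := [set x : 'cV[R]_n.+1 | `|x| = 1]; pose B := [set x : 'cV[R]_n.+1 | `|x| <= K].
have S1 : S (const_mx 1).
  apply/eqP; rewrite eq_le; apply/andP; split.
    by apply: mx_norm_leP => // i j; rewrite mxE normr1.
  by have := le_mx_norm (const_mx 1 : 'cV[R]_n.+1) 0 0; rewrite mxE normr1.
have [u /set_mem Su umin] : exists2 c, c \in S & forall t, t \in S -> psi c <= psi t.
  apply: compact_EVT_min; [by exists (const_mx 1)|exact: compact_sphere_cV|].
  exact: continuous_subspaceT.
have [v _ vmax] : exists2 c, c \in B & forall t, t \in B -> psi t <= psi c.
  apply: compact_EVT_max; [|exact: compact_closed_ball_cV|exact: continuous_subspaceT].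
  by exists 0; rewrite /B /= normr0 ltW.
have mu0 : 0 < psi u.
  by apply: psi_gt0; apply: contraTneq isT => u0; move: Su; rewrite /S /= u0 normr0 => /eqP; rewrite eq_sym oner_eq0.
pose M := Num.max (psi v) 1.
have M0 : 0 < M by rewrite lt_max ltr01 orbT.
exists (psi u / (M *+ 2)) => [|r x r0 rle].
  by rewrite divr_gt0// pmulrn_lgt0.
(* If the bound fails, dividing by |phi r x| puts x into the ball of radius K and its image on the
   unit sphere, so that psi u <= r M <= psi u / 2. *)
have [//|xlt] := leP (`|phi r *m x| * K) (`|x|).
set y := phi r *m x in xlt *.
have y0 : 0 < `|y| by rewrite -(pmulr_lgt0 _ K0) (le_lt_trans _ xlt).
have x0 : x != 0 by apply: contraTneq y0 => x0; rewrite /y x0 mulmx0 normr0 ltxx.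
have Sy : S (`|y|^-1 *: y).
  by rewrite /S /= normrZ normfV normr_id mulVf// gt_eqF.
have Bx : B (`|y|^-1 *: x).
  by rewrite /B /= normrZ normfV normr_id ler_pdivrMl// ltW.
have := umin _ (mem_set Sy); rewrite {2}/y scalemxAr psi_hom//; last first.
  by rewrite scaler_eq0 negb_or invr_eq0 gt_eqF.
move=> ule; have := vmax _ (mem_set Bx) => vge.
suff : psi u <= psi u / 2 by rewrite leNgt ltr_pdivrMr// ltr_pMr// ltr1n.
apply: (le_trans ule); apply: (@le_trans _ _ (r * M)).
  apply: ler_wpM2l; first exact: ltW.
  by apply: (le_trans vge); rewrite le_max lexx.
by move: rle; rewrite ler_pdivlMr ?pmulrn_lgt0//; lra.
Qed.

(** Nonnegativity is the limit of positive values. If psi 0 were positive, phi r x with r small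
    would be close to 0 by contraction, while its value r psi x would be below psi 0 / 2. *)
Lemma homogeneous_at0 : psi 0 = 0.
Proof.
have psi0_ge0 : 0 <= psi 0.
  rewrite leNgt; apply/negP => p0.
  have /nbhs_ballP[e /= e0 He] : nbhs (0 : 'cV[R]_n.+1) (psi @^-1` [set t | t < 0]).
    by apply: psi_cont; apply: open_nbhs_nbhs; split; [exact: open_lt|exact: p0].
  pose x : 'cV[R]_n.+1 := const_mx (e / 2).
  have x0 : x != 0.
    by apply/eqP => /matrixP/(_ 0 0); rewrite !mxE => /eqP; rewrite gt_eqF// divr_gt0.
  suff : psi x < 0 by rewrite ltNge ltW// psi_gt0.
  apply: He; split => // i j; rewrite !mxE /ball/= add0r normrN gtr0_norm ?divr_gt0//.
  by rewrite ltr_pdivrMr// ltr_pMr// ltr1n.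
apply/eqP; rewrite eq_le psi0_ge0 andbT leNgt; apply/negP => p0.
have /nbhs_ballP[e /= e0 He] :
    nbhs (0 : 'cV[R]_n.+1) (psi @^-1` [set t | psi 0 / 2 < t]).
  apply: psi_cont; apply: open_nbhs_nbhs; split; first exact: open_gt.
  by rewrite /= ltr_pdivrMr// ltr_pMr// ltr1n.
pose x : 'cV[R]_n.+1 := const_mx 1.
have x0 : x != 0.
  by apply/eqP => /matrixP/(_ 0 0); rewrite !mxE => /eqP; rewrite oner_eq0.
have nx0 : 0 < `|x| by rewrite normr_gt0.
(* The contraction factor 2 |x| / e brings phi r x to norm at most e / 2, inside the ball where psi
   exceeds psi 0 / 2. *)
have [r0 r00 Hr] := homogeneous_contraction (divr_gt0 (mulr_gt0 (ltr0Sn R 1) nx0) e0 : 0 < (1 + 1) * `|x| / e).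
pose r := Num.min r0 (psi 0 / 2 / psi x).
have r_gt0 : 0 < r by rewrite lt_min r00 !divr_gt0// psi_gt0.
have : psi 0 / 2 < psi (phi r *m x).
  apply: He; rewrite mx_norm_ball /ball_/= add0r normrN.
  have := Hr r x r_gt0; rewrite ge_min lexx => /(_ isT).
  rewrite -ler_pdivlMr ?divr_gt0 ?mulr_gt0// => /le_lt_trans; apply.
  have -> : `|x| / ((1 + 1) * `|x| / e) = e / 2 by field; rewrite !gt_eqF.
  by rewrite ltr_pdivrMr// ltr_pMr// ltr1n.
rewrite psi_hom// ltNge => /negP; apply.
by rewrite -ler_pdivlMr ?psi_gt0// ge_min lexx orbT.
Qed.

(** [phi r1] at least halves the norm and multiplies psi by r1, so each doubling of |x| costs at
    most a factor 1 / r1; the number of doublings is logarithmic in |x|. *)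
Lemma homogeneous_growth :
  exists (C : R) (m : nat), 0 < C /\ forall x, psi x <= C * (1 + `|x|) ^+ m.
Proof.
have [r1 r10 Hr1] := homogeneous_contraction (ltr0Sn R 1 : 0 < 1 + 1).
have [v _ vmax] : exists2 c, c \in [set x : 'cV[R]_n.+1 | `|x| <= 1] &
    forall t, t \in [set x : 'cV[R]_n.+1 | `|x| <= 1] -> psi t <= psi c.
  apply: compact_EVT_max; [|exact: compact_closed_ball_cV|exact: continuous_subspaceT].
  by exists 0; rewrite /= normr0.
pose M := Num.max (psi v) 1.
have M0 : 0 < M by rewrite lt_max ltr01 orbT.
have grow k x : `|x| <= 2 ^+ k -> psi x <= M * r1^-1 ^+ k.
  elim: k x => [|k IH] x xk.
    by rewrite expr0 mulr1 le_max vmax// inE /= -(expr0 2).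
  have [->|x0] := eqVneq x 0.
    by rewrite homogeneous_at0 mulr_ge0 ?exprn_ge0 ?invr_ge0 ?ltW.
  have := Hr1 r1 x r10 (lexx _) => xr.
  have := IH (phi r1 *m x) _; rewrite psi_hom// exprS mulrCA ler_pdivlMl//; apply.
  by rewrite -(ler_pM2r (ltr0Sn R 1)); apply: (le_trans xr); rewrite -exprSr.
(* The exponent: since 1 / r1 <= 2^p, the factor r1^-(k+1) is at most (2^(k+1))^p, and 2^k <= 1 +
   |x|. *)
pose p := (Num.truncn r1^-1).+1.
have rp : r1^-1 <= 2 ^+ p.
  apply: ltW; apply: (lt_trans (truncnS_gt _)); rewrite -natrX ltr_nat.
  exact: ltn_expl.
exists (M * 2 ^+ p), p; split; first by rewrite mulr_gt0// exprn_gt0.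
move=> x; pose k := trunc_log 2 (Num.truncn (1 + `|x|)).
have t1 : (0 < Num.truncn (1 + `|x|))%N by rewrite truncn_gt0 lerDl.
have le1 : 2 ^+ k <= 1 + `|x|.
  apply: (@le_trans _ _ (Num.truncn (1 + `|x|))%:R); last by rewrite truncn_le addr_ge0.
  by rewrite -natrX ler_nat trunc_logP.
have le2 : `|x| <= 2 ^+ k.+1.
  apply: (@le_trans _ _ (1 + `|x|)); first by rewrite lerDr.
  apply: ltW; apply: (lt_le_trans (truncnS_gt _)).
  by rewrite -natrX ler_nat trunc_log_ltn.
apply: (le_trans (grow _ _ le2)); rewrite -mulrA ler_pM2l//.
apply: (@le_trans _ _ ((2 ^+ p) ^+ k.+1)).
  by apply: lerXn2r => //; rewrite nnegrE ?exprn_ge0// invr_ge0 ltW.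
rewrite exprS ler_pM2l ?exprn_gt0// -exprM mulnC exprM.
by apply: lerXn2r => //; rewrite nnegrE ?exprn_ge0// addr_ge0.
Qed.

Lemma homogeneous_entries (K : R) : 0 < K ->
  exists2 r0, 0 < r0 & forall r, 0 < r -> r <= r0 ->
    forall i j, `|phi r i j| <= K.
Proof.
move=> K0; have Ki : 0 < K^-1 by rewrite invr_gt0.
have [r0 r00 H] := homogeneous_contraction Ki; exists r0 => // r rp rr0 i j.
have := H r (delta_mx j 0) rp rr0; rewrite ler_pdivrMr//.
rewrite -colE => Hj; apply: (le_trans _ (le_trans Hj _)).
  by have := le_mx_norm (col j (phi r)) i 0; rewrite mxE.
rewrite -[leRHS]mul1r ler_pM2r//; apply: mx_norm_leP => // k l.
by rewrite mxE; case: (_ && _); rewrite ?normr1 ?normr0.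
Qed.

(** In the Leibniz formula each of the (n+1)! products is at most K, from one factor, the others
    being at most 1; K is 1 / ((n+1)! + 1). The positivity of the trace will follow. *)
Lemma homogeneous_det_lt1 : exists r : R, 0 < r < 1 /\ `|\det (phi r)| < 1.
Proof.
pose K : R := (n.+1)`!.+1%:R^-1.
have K0 : 0 < K by rewrite invr_gt0.
have K1 : K <= 1 by rewrite invf_le1// ler1n.
have [r0 r00 H] := homogeneous_entries K0.
pose r := Num.min r0 (1 / 2).
have r_gt0 : 0 < r by rewrite lt_min r00 divr_gt0.
have Hr i j : `|phi r i j| <= K by apply: H => //; rewrite ge_min lexx.
exists r; split.
  by rewrite r_gt0 gt_min; apply/orP; right; lra.
apply: (@le_lt_trans _ _ (\sum_(s : 'S_n.+1) K)).
  apply: (le_trans (ler_norm_sum _ _ _)); apply: ler_sum => s _.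
  rewrite normrM normrX normrN1 expr1n mul1r normr_prod big_ord_recl.
  rewrite -[leRHS]mulr1; apply: ler_pM => //; first exact: prodr_ge0.
  by apply: prodr_ile1 => i _; rewrite normr_ge0 (le_trans (Hr _ _)).
rewrite sumr_const card_Sn -mulr_natr mulrC ltr_pdivrMr// mul1r.
by rewrite ltr_nat.
Qed.

End homogeneous_function.

(** * Powers of a matrix *)

Lemma cvg_sumr {R : realType} {T : Type} (F : set_system T) {FF : Filter F}
    (I : Type) (r : seq I) (f : I -> T -> R) (l : I -> R) :
  (forall i, f i x @[x --> F] --> l i) ->
  \sum_(i <- r) f i x @[x --> F] --> \sum_(i <- r) l i.
Proof.
move=> fl; elim: r => [|i r IH].
  by rewrite big_nil; under eq_fun do rewrite big_nil; exact: cvg_cst.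
by rewrite big_cons; under eq_fun do rewrite big_cons; exact: cvgD.
Qed.

Section matrix_exponential.
Context {R : realType} (n : nat).
Implicit Types (E : 'M[R]_n).

Lemma cvg_mx_entries (u : nat -> 'M[R]_n) (L : 'M[R]_n) :
  (forall i j, u k i j @[k --> \oo] --> L i j) -> u k @[k --> \oo] --> L.
Proof.
move=> uL A /nbhs_ballP[e /= e0 LA].
have uLe : \forall k \near \oo, forall i j, ball (L i j) e (u k i j).
  apply: filter_forall => i; apply: filter_forall => j.
  exact: (uL i j _ (nbhsx_ballx _ _ e0)).
by apply: filterS uLe => k uLk; apply: LA; split.
Qed.

(** The exponential of s E. The additive parameter s, the logarithm of that of [mxpow], is the one
    in which to differentiate. *)
Definition mexp (s : R) E : 'M[R]_n :=
  limn (series (fun k => (s ^+ k / k`!%:R) *: E ^+ k)).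

Lemma mxpowE (c : R) E : mxpow c E = mexp (ln c) E.
Proof. by []. Qed.

Let B E : R := n%:R * `|E|.

Let B_ge0 E : 0 <= B E. Proof. by rewrite mulr_ge0. Qed.

Lemma mx_expr_entry_le E k i j : `|(E ^+ k) i j| <= B E ^+ k.
Proof.
elim: k i j => [|k IH] i j.
  by rewrite !expr0 mxE; case: (_ == _); rewrite ?normr1 ?normr0.
rewrite !exprS mxE; apply: (le_trans (ler_norm_sum _ _ _)).
apply: (@le_trans _ _ (\sum_(l < n) `|E| * B E ^+ k)).
  apply: ler_sum => l _; rewrite normrM ler_pM//.
  by rewrite [leRHS]mx_normrE; apply: (le_bigmax _ _ (i, l)).
by rewrite sumr_const card_ord -mulrnAl -[_ *+ n]mulr_natl.
Qed.

Lemma is_cvg_pseries_fact (a : R^nat) (C b x : R) : 0 <= C -> 0 <= b ->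
  (forall k, `|a k| <= C * b ^+ k) -> cvgn (pseries (fun k => a k / k`!%:R) x).
Proof.
move=> C0 b0 ab; apply: normed_cvg.
apply: (@series_le_cvg _ _ (fun k => C * exp_coeff (b * `|x|) k)) => [k|k|k|].
- exact: normr_ge0.
- by rewrite mulr_ge0// divr_ge0// exprn_ge0// mulr_ge0.
- rewrite /exp_coeff /= !normrM normrX normfV [X in _ / X]ger0_norm//.
  have -> : C * ((b * `|x|) ^+ k / k`!%:R) = C * b ^+ k / k`!%:R * `|x| ^+ k.
    by rewrite exprMn; ring.
  by apply: ler_wpM2r; [exact: exprn_ge0|apply: ler_wpM2r; rewrite ?invr_ge0].
- by apply: is_cvg_seriesZ; exact: is_cvg_series_exp_coeff.
Qed.

Lemma pseries_diffs_fact (a : R^nat) :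
  pseries_diffs (fun k => a k / k`!%:R) = (fun k => a k.+1 / k`!%:R).
Proof.
apply/funext => k; rewrite /pseries_diffs factS natrM invfM mulrCA [X in _ * X]mulrA.
by rewrite mulfV ?mul1r// pnatr_eq0.
Qed.

Lemma is_cvg_mexp_entry s E i j :
  cvgn (pseries (fun k => (E ^+ k) i j / k`!%:R) s).
Proof.
apply: (@is_cvg_pseries_fact _ 1 (B E)) => // k.
by rewrite mul1r; exact: mx_expr_entry_le.
Qed.

Lemma mexp_cvg s E : series (fun k => (s ^+ k / k`!%:R) *: E ^+ k) k @[k --> \oo] -->
  (\matrix_(i, j) limn (pseries (fun k => (E ^+ k) i j / k`!%:R) s) : 'M[R]_n).
Proof.
apply: cvg_mx_entries => i j; rewrite mxE.
rewrite (_ : (fun k => _) = pseries (fun k => (E ^+ k) i j / k`!%:R) s).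
  exact: is_cvg_mexp_entry.
apply/funext => k; rewrite /series /= summxE; apply: eq_bigr => l _.
by rewrite mxE mulrC mulrA mulrAC.
Qed.

Lemma mexp_entry s E i j :
  mexp s E i j = limn (pseries (fun k => (E ^+ k) i j / k`!%:R) s).
Proof. by rewrite /mexp (cvg_lim _ (@mexp_cvg s E))// mxE. Qed.

Lemma mexp_mull s E i j :
  (E *m mexp s E) i j = limn (pseries (fun k => (E ^+ k.+1) i j / k`!%:R) s).
Proof.
apply/esym/(@cvg_lim R) => //; rewrite mxE.
have -> : pseries (fun k => (E ^+ k.+1) i j / k`!%:R) s =
    (fun m => \sum_(l < n) E i l * pseries (fun k => (E ^+ k) l j / k`!%:R) s m).
  apply/funext => m; rewrite /pseries /series /=.
  under [RHS]eq_bigr do rewrite mulr_sumr.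
  rewrite exchange_big /=; apply: eq_bigr => k _.
  rewrite exprS mxE mulr_suml mulr_suml; apply: eq_bigr => l _.
  by rewrite !mulrA.
apply: cvg_sumr => l; apply: cvgM; first exact: cvg_cst.
by rewrite mexp_entry; exact: is_cvg_mexp_entry.
Qed.

Lemma mexpC s E : E *m mexp s E = mexp s E *m E.
Proof.
apply/matrixP => i j; rewrite mexp_mull; apply: (@cvg_lim R) => //; rewrite mxE.
have -> : pseries (fun k => (E ^+ k.+1) i j / k`!%:R) s =
    (fun m => \sum_(l < n) pseries (fun k => (E ^+ k) i l / k`!%:R) s m * E l j).
  apply/funext => m; rewrite /pseries /series /=.
  under [RHS]eq_bigr do rewrite mulr_suml.
  rewrite exchange_big /=; apply: eq_bigr => k _.
  rewrite exprSr mxE mulr_suml mulr_suml; apply: eq_bigr => l _.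
  by ring.
apply: cvg_sumr => l; apply: cvgM; last exact: cvg_cst.
by rewrite mexp_entry; exact: is_cvg_mexp_entry.
Qed.

(** Termwise differentiation of the power series of an entry, which shifts the power of E by one.
    The criterion asks that the series and its first two formal derivatives converge at |s| + 1. *)
Lemma is_derive_mexp_entry s E i j :
  is_derive s (1 : R) (fun s => mexp s E i j) ((E *m mexp s E) i j).
Proof.
have cE k x : cvgn (pseries (fun m => (E ^+ (k + m)) i j / m`!%:R) x).
  apply: (@is_cvg_pseries_fact _ (B E ^+ k) (B E)); rewrite ?exprn_ge0// => m.
  by rewrite -exprD; exact: mx_expr_entry_le.
under eq_fun do rewrite mexp_entry.
rewrite mexp_mull.
have := @pseries_snd_diffs R (fun k => (E ^+ k) i j / k`!%:R) (`|s| + 1) s.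
rewrite (pseries_diffs_fact (fun k => (E ^+ k) i j)).
rewrite (pseries_diffs_fact (fun k => (E ^+ k.+1) i j)); apply.
- exact: (cE 0%N).
- exact: (cE 1%N).
- exact: (cE 2%N).
- by rewrite [ltRHS]ger0_norm ?addr_ge0// ltrDl.
Qed.

Lemma mexp0 E : mexp 0 E = 1%:M.
Proof.
apply/matrixP => i j; rewrite mexp_entry; apply: (@cvg_lim R) => //.
rewrite -cvg_shiftS; apply: cvg_near_cst; near=> k => /=.
rewrite /pseries /series /= big_nat_recl// big1 ?addr0.
  by rewrite !expr0 fact0 mulr1 divr1.
by move=> l _; rewrite expr0n /= mulr0.
Unshelve. all: by end_near. Qed.

(** The product of the exponentials at - x and x + c has zero derivative in x, hence equals its
    value at x = 0; the case c = 0 gives the inverse. *)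
Lemma mexpD a s E : mexp (s + a) E = mexp s E *m mexp a E.
Proof.
have H c x : mexp (- x) E *m mexp (x + c) E = mexp c E.
  rewrite -[RHS]mul1mx -(mexp0 E) -[X in _ = mexp X E *m _]oppr0 -[X in _ = _ *m mexp X E]add0r.
  apply/matrixP => i j; rewrite !mxE.
  pose F l : R -> R := (fun s => mexp (- s) E i l) * (fun s => mexp (s + c) E l j).
  have FE y : \sum_l mexp (- y) E i l * mexp (y + c) E l j = (\sum_l F l) y.
    by rewrite fct_sumE.
  rewrite !FE; apply: is_derive_0_is_cst => y.
  have d1 l : is_derive y (1 : R) (fun s => mexp (- s) E i l) (- (mexp (- y) E *m E) i l).
    have := @is_derive1_comp R (fun s => mexp s E i l) -%R y _ _
      (is_derive_mexp_entry (- y) E i l) (is_deriveNid y 1).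
    by rewrite mulrN1 mexpC.
  have d2 l : is_derive y (1 : R) (fun s => mexp (s + c) E l j) ((E *m mexp (y + c) E) l j).
    have := @is_derive1_comp R (fun s => mexp s E l j) (fun s => s + c) y _ _
      (is_derive_mexp_entry (y + c) E l j) (is_derive_shift y 1 c).
    by rewrite mulr1.
  apply: is_derive_eq.
  under eq_bigr => l _ do rewrite scalerN /GRing.scale /= [X in _ - X]mulrC.
  rewrite sumrB.
  transitivity ((mexp (- y) E *m (E *m mexp (y + c) E)) i j - ((mexp (- y) E *m E) *m mexp (y + c) E) i j).
    by rewrite !mxE.
  by rewrite mulmxA subrr.
have inv y : mexp y E *m mexp (- y) E = 1%:M.
  by have := H 0 (- y); rewrite opprK addr0 mexp0.
by rewrite -(H a s) mulmxA inv mul1mx.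
Qed.

Lemma mexp_trmx s E : (mexp s E)^T = mexp s E^T.
Proof.
apply/matrixP => i j; rewrite mxE !mexp_entry.
suff H k : (E^T ^+ k) = (E ^+ k)^T.
  by congr (limn (pseries _ s)); apply/funext => k; rewrite H mxE.
elim: k => [|k IH]; first by rewrite !expr0 trmx1.
by rewrite exprS exprSr trmx_mul IH.
Qed.

End matrix_exponential.

Lemma is_derive_prod {R : realType} (I : eqType) (r : seq I) (f : I -> R -> R)
    (df : I -> R) (x : R) : uniq r ->
  (forall i, is_derive x (1 : R) (f i) (df i)) ->
  is_derive x (1 : R) (fun s => \prod_(i <- r) f i s)
    (\sum_(i <- r) df i * \prod_(j <- r | j != i) f j x).
Proof.
move=> + dfi; elim: r => [|a r IH] /=.
  move=> _; rewrite big_nil; under eq_fun do rewrite big_nil.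
  exact: is_derive_cst.
move=> /andP[ar ur]; under eq_fun do rewrite big_cons.
have := @is_deriveM _ _ _ _ _ (1 : R) _ _ (dfi a) (IH ur).
move=> H; apply: (is_derive_eq H).
rewrite /GRing.scale /= big_cons big_cons eqxx /= addrC; congr (_ + _).
  rewrite mulrC; congr (_ * _); rewrite [RHS]big_seq_cond [LHS]big_seq.
  by apply: eq_bigl => j; case jr: (j \in r) => //=; apply/esym; apply: contraNneq ar => <-.
rewrite mulr_sumr; apply: eq_big_seq => i ir.
rewrite big_cons ifT; first by rewrite mulrCA.
by apply: contraNneq ar => ->.
Qed.

(** * The determinant of an exponential *)

Section det_exponential.
Context {R : realType} (n : nat).
Implicit Types (E : 'M[R]_n).

(** Jacobi's formula at the identity: in the Leibniz expansion only the identity permutation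
    contributes to the derivative. *)
Lemma is_derive_det (F : R -> 'M[R]_n) (D : 'M[R]_n) (x : R) :
  F x = 1%:M ->
  (forall i j, is_derive x (1 : R) (fun s => F s i j) (D i j)) ->
  is_derive x (1 : R) (fun s => \det (F s)) (\tr D).
Proof.
move=> Fx dF.
pose G (s : {perm 'I_n}) : R -> R := fun u => (-1) ^+ s * \prod_(i <- index_enum 'I_n) F u i (s i).
pose dG (s : {perm 'I_n}) : R := (-1) ^+ s *
  (\sum_(i <- index_enum 'I_n) D i (s i) * \prod_(j <- index_enum 'I_n | j != i) F x j (s j)).
have dGP s : is_derive x (1 : R) (G s) (dG s).
  have := @is_derive_prod R _ (index_enum 'I_n) (fun i u => F u i (s i))
    (fun i => D i (s i)) x (index_enum_uniq _) (fun i => dF i (s i)).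
  move=> H; have := @is_deriveZ _ _ _ _ ((-1) ^+ s) x 1 _ H.
  by [].
have HG : is_derive x (1 : R) (fun u => \sum_(s <- index_enum {perm 'I_n}) G s u)
    (\sum_(s <- index_enum {perm 'I_n}) dG s).
  elim: (index_enum _) => [|s r IH].
    by rewrite big_nil; under eq_fun do rewrite big_nil; exact: is_derive_cst.
  by rewrite big_cons; under eq_fun do rewrite big_cons; exact: is_deriveD.
apply: (is_derive_eq HG).
rewrite (bigD1_seq (1%g : {perm 'I_n})) ?index_enum_uniq ?mem_index_enum//=.
rewrite big1 ?addr0 => [|s s1].
  rewrite /dG odd_perm1 expr0 mul1r; apply: eq_bigr => i _.
  rewrite perm1 big1 ?mulr1// => j ji; by rewrite Fx perm1 mxE eqxx.
rewrite /dG big1 ?mulr0// => i _.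
(* A permutation other than the identity moves at least two points, so after differentiating the
   factor i an off-diagonal zero of the identity matrix is left. *)
have [j ji sj] : exists2 j, j != i & s j != j.
  apply: contrapT => H; move/eqP: s1; apply; apply/permP => j; rewrite perm1.
  have fixj k : k != i -> s k = k.
    by move=> ki; apply/eqP; apply: contrapT => /negP sk; apply: H; exists k.
  have [->|/fixj//] := eqVneq j i.
  apply/eqP; apply: contrapT => /negP si.
  by have := fixj _ si => /perm_inj /eqP; rewrite (negbTE si).
rewrite (bigD1 j ji) /= Fx mxE eq_sym (negbTE sj).
by rewrite mul0r mulr0.
Qed.

(** The group law propagates the derivative at 0: f' = (tr E) f everywhere, so f (u) exp (- u tr E)
    is constant. *)
Lemma det_mexp s E : \det (mexp s E) = expR (s * \tr E).
Proof.
pose f u := \det (mexp u E).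
have fD u v : f (u + v) = f u * f v by rewrite /f mexpD det_mulmx.
have f0 : f 0 = 1 by rewrite /f mexp0 det1.
have df0 : is_derive (0 : R) (1 : R) f (\tr E).
  apply: is_derive_det; first exact: mexp0.
  by move=> i j; have := is_derive_mexp_entry 0 E i j; rewrite mexp0 mulmx1.
have df u : is_derive u (1 : R) f (f u * \tr E).
  have -> : f = (fun v => f u * f (v - u)).
    by apply/funext => v; rewrite -fD addrC subrK.
  rewrite -/(f u).
  have H : is_derive u (1 : R) (fun v => f (v - u)) (\tr E).
    have := @is_derive1_comp R f (fun v => v - u) u _ _ _ (is_derive_shift u 1 (- u)).
    by rewrite subrr => /(_ _ df0); rewrite mulr1.
  by have := @is_deriveZ _ _ _ _ (f u) u 1 _ H; rewrite subrr f0 mulr1.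
have dexp (u : R) : is_derive u (1 : R) (fun v => expR (- (v * \tr E))) (- \tr E * expR (- (u * \tr E))).
  have H : is_derive u (1 : R) (fun v : R => - (v * \tr E)) (- \tr E).
    under eq_fun do rewrite mulrC.
    apply: (is_derive_eq (is_deriveN (is_deriveZ (\tr E) (is_derive_id u 1)))).
    by rewrite /GRing.scale /= mulr1.
  have := @is_derive1_comp R expR (fun v => - (v * \tr E)) u _ _ (is_derive_expR _) H.
  by rewrite mulrC.
have cst : f s * expR (- (s * \tr E)) = 1.
  transitivity ((f * (fun v => expR (- (v * \tr E)))) s) => //.
  transitivity ((f * (fun v => expR (- (v * \tr E)))) 0).
    apply: is_derive_0_is_cst => u.
    apply: (is_derive_eq (is_deriveM (df u) (dexp u))).
    by rewrite /GRing.scale /=; ring.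
  transitivity (f 0 * expR (- (0 * \tr E))) => //.
  by rewrite f0 mul1r mul0r oppr0 expR0.
by rewrite -/(f s) -[LHS]mulr1 -(expRxMexpNx_1 (s * \tr E)) mulrCA cst mulr1.
Qed.

End det_exponential.

Section mxpow_theory.
Context {R : realType} (n : nat).
Implicit Types (E : 'M[R]_n) (a b : R).

Lemma mxpowM a b E : 0 < a -> 0 < b ->
  mxpow (a * b) E = mxpow a E *m mxpow b E.
Proof. by move=> a0 b0; rewrite !mxpowE lnM ?posrE// mexpD. Qed.

Lemma mxpow1 E : mxpow 1 E = 1%:M.
Proof. by rewrite mxpowE ln1 mexp0. Qed.

Lemma mxpow_trmx a E : (mxpow a E)^T = mxpow a E^T.
Proof. by rewrite !mxpowE mexp_trmx. Qed.

Lemma det_mxpow a E : 0 < a -> \det (mxpow a E) = a `^ \tr E.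
Proof. by move=> a0; rewrite mxpowE det_mexp /powR gt_eqF// mulrC. Qed.

End mxpow_theory.

(** * Integrability and Fubini *)

Section integral_misc.
Context d (T : measurableType d) {R : realType}.
Implicit Types mu : {measure set T -> \bar R}.

Lemma integrable_le mu (f g : T -> R) : measurable_fun setT f ->
  (forall x, `|f x| <= g x) -> mu.-integrable setT (EFin \o g) ->
  mu.-integrable setT (EFin \o f).
Proof.
move=> mf fg; apply: le_integrable => //; first exact/measurable_EFinP.
by move=> x _ /=; rewrite lee_fin (le_trans (fg x))// ler_norm.
Qed.

Lemma EFin_Rintegral mu (f : T -> R) : mu.-integrable setT (EFin \o f) ->
  (\int[mu]_x f x)%:E = (\int[mu]_x (f x)%:E)%E.
Proof. by move=> fi; rewrite /Rintegral fineK//; exact: integrable_fin_num. Qed.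

Lemma integrable_measurable mu (f : T -> R) :
  mu.-integrable setT (EFin \o f) -> measurable_fun setT f.
Proof. by move=> /measurable_int /measurable_EFinP. Qed.

Lemma Rintegral_sum mu (I : Type) (s : seq I) (f : I -> T -> R) :
  (forall i, mu.-integrable setT (EFin \o f i)) ->
  \int[mu]_x (\sum_(i <- s) f i x) = \sum_(i <- s) \int[mu]_x f i x.
Proof.
move=> fi; rewrite /Rintegral; under eq_integral do rewrite -sumEFin.
rewrite (integral_sum measurableT fi) -sum_fine// => i _.
exact: integrable_fin_num (fi i).
Qed.

Lemma integrable_sumr mu (I : Type) (s : seq I) (f : I -> T -> R) :
  (forall i, mu.-integrable setT (EFin \o f i)) ->
  mu.-integrable setT (EFin \o (fun x => \sum_(i <- s) f i x)).
Proof.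
move=> fi; have : mu.-integrable setT (fun x => \sum_(i <- s) (EFin \o f i) x)%E.
  by apply: integrable_sum => // i _; exact: fi.
by apply: eq_integrable => // x _ /=; rewrite sumEFin.
Qed.

Lemma integrableDr mu (f g : T -> R) : mu.-integrable setT (EFin \o f) ->
  mu.-integrable setT (EFin \o g) -> mu.-integrable setT (EFin \o (fun x => f x + g x)).
Proof. by move=> fi gi; have := integrableD measurableT fi gi; exact: eq_integrable. Qed.

Lemma integrableBr mu (f g : T -> R) : mu.-integrable setT (EFin \o f) ->
  mu.-integrable setT (EFin \o g) -> mu.-integrable setT (EFin \o (fun x => f x - g x)).
Proof. by move=> fi gi; have := integrableB measurableT fi gi; exact: eq_integrable. Qed.

Lemma integrableZlr mu (k : R) (f : T -> R) : mu.-integrable setT (EFin \o f) ->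
  mu.-integrable setT (EFin \o (fun x => k * f x)).
Proof. by move=> fi; have := integrableZl measurableT k fi; exact: eq_integrable. Qed.

Lemma integrableMbounded mu (h g : T -> R) (C : R) : measurable_fun setT h ->
  (forall x, `|h x| <= C) -> mu.-integrable setT (EFin \o g) ->
  mu.-integrable setT (EFin \o (fun x => h x * g x)).
Proof.
move=> mh hC gi; apply: (@integrable_le _ _ (fun x => C * `|g x|)).
- by apply: measurable_funM => //; exact: integrable_measurable gi.
- by move=> x; rewrite normrM ler_wpM2r.
- by apply: integrableZlr; exact: (integrable_norm gi).
Qed.

Lemma ge0_integrable mu (f : T -> R) : measurable_fun setT f ->
  (forall x, 0 <= f x) -> (\int[mu]_x (f x)%:E < +oo)%E ->
  mu.-integrable setT (EFin \o f).
Proof.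
move=> mf f0 foo; apply/integrableP; split; first exact/measurable_EFinP.
by under eq_integral => x _ do rewrite /= ger0_norm//.
Qed.

End integral_misc.

(** * Fubini for real functions dominated by a product *)

Section fubini_misc.
Context d1 d2 (T1 : measurableType d1) (T2 : measurableType d2) {R : realType}.
Variables (m1 : {sigma_finite_measure set T1 -> \bar R})
  (m2 : {sigma_finite_measure set T2 -> \bar R}).
Variables (f : T1 * T2 -> R) (g : T1 -> R) (k : T2 -> R).
Hypothesis mf : measurable_fun setT f.
Hypothesis gi : m1.-integrable setT (EFin \o g).
Hypothesis ki : m2.-integrable setT (EFin \o k).
Hypothesis fgk : forall x y, `|f (x, y)| <= g x * k y.

Lemma dominated_integrable_prod : (m1 \x m2)%E.-integrable setT (EFin \o f).
Proof.
apply/integrable12ltyP; first exact/measurable_EFinP.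
apply: (@le_lt_trans _ _ (\int[m1]_x (`|g x|%:E * \int[m2]_y `|k y|%:E))%E).
  apply: ge0_le_integral => //.
  - by move=> x _; apply: integral_ge0.
  - apply: (@measurable_fun_fubini_tonelli_F _ _ _ _ _ m2 (fun p => `|(f p)%:E|)%E) => //.
    by apply: measurableT_comp => //; exact/measurable_EFinP.
  - apply: emeasurable_funM => //; apply/measurable_EFinP; apply: measurableT_comp => //.
    exact: integrable_measurable gi.
  - move=> x _; rewrite -ge0_integralZl//; last first.
      by apply/measurable_EFinP; apply: measurableT_comp => //; exact: integrable_measurable ki.
    apply: ge0_le_integral => //.
    + by apply: measurableT_comp => //; apply/measurable_EFinP; apply: measurableT_comp => //; exact: measurable_pair1.
    + apply: emeasurable_funM => //; apply/measurable_EFinP; apply: measurableT_comp => //.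
      exact: integrable_measurable ki.
    + move=> y _; rewrite /= -EFinM lee_fin -normrM (le_trans (fgk x y))// ler_norm//.
rewrite ge0_integralZr//; last 2 first.
- by apply/measurable_EFinP; apply: measurableT_comp => //; exact: integrable_measurable gi.
- by apply: integral_ge0.
have /integrableP[_ goo] := gi; have /integrableP[_ koo] := ki.
by apply: lte_mul_pinfty; rewrite ?integral_ge0// ge0_fin_numE// integral_ge0.
Qed.

Lemma dominated_integrable1 x : m2.-integrable setT (EFin \o (fun y => f (x, y))).
Proof.
apply: (@integrable_le _ _ _ _ _ (fun y => g x * k y)) => //.
- by apply: measurableT_comp => //; exact: measurable_pair1.
- by apply: integrableZlr.
Qed.

Lemma dominated_integrable2 y : m1.-integrable setT (EFin \o (fun x => f (x, y))).
Proof.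
apply: (@integrable_le _ _ _ _ _ (fun x => k y * g x)) => //.
- by apply: measurableT_comp => //; exact: measurable_pair2.
- by move=> x; rewrite mulrC.
- by apply: integrableZlr.
Qed.

Lemma dominated_integral_prod :
  \int[(m1 \x m2)%E]_p f p = \int[m1]_x \int[m2]_y f (x, y).
Proof.
have fi := dominated_integrable_prod.
rewrite /Rintegral -integral12_prod_meas1//; congr fine.
by apply: eq_integral => x _; exact/esym/(EFin_Rintegral (dominated_integrable1 x)).
Qed.

Lemma dominated_Fubini :
  \int[m1]_x \int[m2]_y f (x, y) = \int[m2]_y \int[m1]_x f (x, y).
Proof.
have fi := dominated_integrable_prod.
rewrite -dominated_integral_prod /Rintegral -integral21_prod_meas1//; congr fine.
by apply: eq_integral => y _; exact/esym/(EFin_Rintegral (dominated_integrable2 y)).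
Qed.

End fubini_misc.

(** * Sine kernels *)

Section sinc.
Context {R : realType}.
Local Notation mu := (@lebesgue_measure R).
Implicit Types (x y t a b : R).

Lemma continuous_mfun (f : R -> R) : continuous f -> measurable_fun setT f.
Proof. exact: continuous_measurable_fun. Qed.

Lemma normr_sin_le1 x : `|sin x| <= 1.
Proof. by rewrite ler_norml sin_geN1 sin_le1. Qed.

Lemma normr_cos_le1 x : `|cos x| <= 1.
Proof. by rewrite ler_norml cos_geN1 cos_le1. Qed.

Lemma normr_sin_le x : `|sin x| <= `|x|.
Proof.
have pos y : 0 <= y -> `|sin y| <= y.
  rewrite le_eqVlt => /predU1P[<-|y0]; first by rewrite sin0 normr0.
  have [|c _] := @MVT_segment R sin cos 0 y (ltW y0) (fun x _ => is_derive_sin x).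
    by apply: continuous_subspaceT; exact: continuous_sin.
  rewrite sin0 !subr0 => ->; rewrite normrM (gtr0_norm y0).
  by rewrite ler_piMl ?normr_cos_le1// ltW.
have [x0|x0] := leP 0 x; first by rewrite (ger0_norm x0) pos.
by rewrite -normrN -sinN [leRHS]ltr0_norm// pos// oppr_ge0 ltW.
Qed.

Lemma integral_oneDsqr : mu.-integrable setT (EFin \o (fun x => (1 + x ^+ 2)^-1)).
Proof.
have c : continuous (fun x : R => (1 + x ^+ 2)^-1) by exact: continuous_oneDsqrV.
apply: ge0_integrable.
- exact: continuous_mfun.
- by move=> x; rewrite invr_ge0 addr_ge0// sqr_ge0.
- rewrite ge0_symfun_integralT//.
  + rewrite (_ : [set x : R | _] = `[0, +oo[%classic); last first.
      by apply/seteqP; split => x/=; rewrite in_itv/= andbT.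
    by rewrite integral0y_oneDsqr -EFinM ltry.
  + by move=> x; rewrite invr_ge0 addr_ge0// sqr_ge0.
  + by move=> x /=; rewrite sqrrN.
Qed.

(** A null integral would make f vanish almost everywhere. The interval (0, 1) is a set of positive
    measure on which all the kernels below are visibly positive. *)
Lemma integral_gt0 (f : R -> R) : measurable_fun setT f -> (forall x, 0 <= f x) ->
  (forall x, 0 < x < 1 -> 0 < f x) -> mu.-integrable setT (EFin \o f) ->
  0 < \int[mu]_x f x.
Proof.
move=> mf f0 fpos fi; rewrite lt_neqAle Rintegral_ge0// andbT.
apply/eqP => /esym If0.
have : (\int[mu]_x `|(f x)%:E| = 0)%E.
  under eq_integral => x _ do rewrite /= ger0_norm//.
  by rewrite -EFin_Rintegral// If0.
move=> /(ae_eq_integral_abs _ measurableT _).1; case; first exact/measurable_EFinP.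
move=> A [mA A0 sub].
have : (mu `]0%R, 1%R[%classic <= mu A)%E.
  apply: le_measure; rewrite ?inE//.
  move=> x /=; rewrite in_itv/= => x01; apply: sub => /= /(_ I) /eqP.
  by rewrite eqe gt_eqF// fpos.
by rewrite A0 lebesgue_measure_itv/= lte_fin ltr01 -EFinB subr0 lee_fin ler10.
Qed.

Lemma sin_gt0_01 x : 0 < x < 1 -> 0 < sin x.
Proof.
move=> /andP[x0 x1]; apply: sin_gt0_pihalf; rewrite x0/=.
exact: (lt_le_trans x1 (pihalf_ge1 R)).
Qed.

(** By the convention on inverses the value at 0 is 0, not 1. The integrals ignore it, and it makes
    the test function vanish where psi may vanish. *)
Definition sinc x := sin x / x.

Lemma measurable_sin : measurable_fun setT (@sin R).
Proof. by apply: continuous_mfun; exact: continuous_sin. Qed.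

Lemma measurable_cos : measurable_fun setT (@cos R).
Proof. by apply: continuous_mfun; exact: continuous_cos. Qed.

(** The formula x exp (- ln x^2) also holds at 0, where both sides are 0, and is a composition of
    measurable functions. *)
Lemma measurable_invr : measurable_fun setT (fun x : R => x^-1).
Proof.
rewrite (_ : (fun x => _) = (fun x : R => x * expR (- ln (x ^+ 2)))).
  apply: measurable_funM => //; apply: measurableT_comp; first exact: measurable_expR.
  by apply: measurableT_comp => //; apply: measurableT_comp; first exact: measurable_ln.
apply/funext => x; have [->|x0] := eqVneq x 0; first by rewrite invr0 mul0r.
by rewrite expRN lnK ?posrE ?exprn_even_gt0// expr2 invfM mulrA mulfV// mul1r.
Qed.

Lemma measurable_sinc : measurable_fun setT sinc.
Proof. by apply: measurable_funM; [exact: measurable_sin|exact: measurable_invr]. Qed.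

Lemma sinc_gt0 x : 0 < x < 1 -> 0 < sinc x.
Proof. by move=> x01; rewrite divr_gt0// ?sin_gt0_01//; case/andP: x01. Qed.

Lemma normr_sinc_le1 x : `|sinc x| <= 1.
Proof.
have [->|x0] := eqVneq x 0; first by rewrite /sinc invr0 mulr0 normr0.
by rewrite normrM normfV ler_pdivrMr ?normr_gt0// mul1r normr_sin_le.
Qed.

Lemma sincN x : sinc (- x) = sinc x.
Proof. by rewrite /sinc sinN invrN mulrNN. Qed.

Lemma sinc2_le x : sinc x ^+ 2 <= 2 / (1 + x ^+ 2).
Proof.
have d : 0 < 1 + x ^+ 2 by rewrite ltr_pwDl// sqr_ge0.
rewrite ler_pdivlMr// mulrDr mulr1 [leRHS](_ : _ = 1 + 1)//; apply: lerD.
  by rewrite -real_normK ?num_real// expr_le1// normr_sinc_le1.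
have [->|x0] := eqVneq x 0; first by rewrite expr0n mulr0.
by rewrite -exprMn /sinc divfK// -real_normK ?num_real// expr_le1// normr_sin_le1.
Qed.

(** By scaling, the integral of (1 - cos (a x)) / x^2 is |a| times a constant: absolute values are
    thereby integrals of cosines. The positive constant [versine_cst] stays symbolic. *)
Definition versine_kernel x := (1 - cos x) / x ^+ 2.

Lemma versineE x : versine_kernel x = sinc (x / 2) ^+ 2 / 2.
Proof.
rewrite /versine_kernel /sinc; have [->|x0] := eqVneq x 0.
  by rewrite expr0n invr0 mulr0 mul0r invr0 mulr0 expr0n mul0r.
have -> : cos x = 1 - 2 * sin (x / 2) ^+ 2.
  rewrite -[X in cos X](_ : x / 2 *+ 2 = x); last by rewrite -mulr_natr divfK.
  by rewrite cos_mulr2n cos2sin2; ring.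
by field.
Qed.

Lemma versine_ge0 x : 0 <= versine_kernel x.
Proof. by rewrite versineE divr_ge0// sqr_ge0. Qed.

Lemma measurable_versine : measurable_fun setT versine_kernel.
Proof.
apply: measurable_funM; first by apply: measurable_funB => //; exact: measurable_cos.
by apply: measurableT_comp; [exact: measurable_invr|exact: exprn_measurable].
Qed.

Lemma integrable_sinc2 : mu.-integrable setT (EFin \o (fun x => sinc x ^+ 2)).
Proof.
have h : mu.-integrable setT (EFin \o (fun x => 2 * (1 + x ^+ 2)^-1)).
  by apply: integrableZlr; exact: integral_oneDsqr.
apply: integrable_le h; first by apply: measurable_funX; exact: measurable_sinc.
by move=> x; rewrite ger0_norm ?sqr_ge0// sinc2_le.
Qed.

Definition versine_cst : R := \int[mu]_x versine_kernel x.

Lemma integral_versine a :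
  (\int[mu]_x ((1 - cos (a * x)) / x ^+ 2)%:E = `|a|%:E * \int[mu]_x (versine_kernel x)%:E)%E.
Proof.
have [->|a0] := eqVneq a 0.
  rewrite normr0 mul0e; apply: integral0_eq => x _.
  by rewrite mul0r cos0 subrr mul0r.
rewrite -(@ge0_integral_affine _ a 0 a0 (EFin \o versine_kernel)); last 2 first.
- by apply/measurable_EFinP; exact: measurable_versine.
- by move=> x; rewrite lee_fin versine_ge0.
rewrite muleA -EFinM -expr2 real_normK ?num_real// -ge0_integralZl//; last 3 first.
- apply/measurable_EFinP; apply: measurableT_comp; first exact: measurable_versine.
  exact: measurable_affine.
- by move=> x _; rewrite lee_fin versine_ge0.
- by rewrite lee_fin sqr_ge0.
apply: eq_integral => x _; rewrite /= -EFinM addr0 /versine_kernel; congr EFin.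
rewrite exprMn; have [->|x0] := eqVneq x 0; first by rewrite mulr0 cos0 subrr !mul0r mulr0.
by field; rewrite a0 x0.
Qed.

Lemma integrable_versine a :
  mu.-integrable setT (EFin \o (fun x => (1 - cos (a * x)) / x ^+ 2)).
Proof.
apply: ge0_integrable.
- apply: measurable_funM.
    apply: measurable_funB => //; apply: measurableT_comp; first exact: measurable_cos.
    exact: mulrl_measurable.
  by apply: measurableT_comp; [exact: measurable_invr|exact: exprn_measurable].
- by move=> x; rewrite divr_ge0 ?sqr_ge0// subr_ge0 cos_le1.
rewrite integral_versine lte_mul_pinfty//.
suff h : mu.-integrable setT (EFin \o versine_kernel).
  exact: (integrable_lty measurableT h).
have h : mu.-integrable setT (EFin \o (fun x => 4 * (1 + x ^+ 2)^-1)).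
  by apply: integrableZlr; exact: integral_oneDsqr.
apply: integrable_le h; first exact: measurable_versine.
move=> x; rewrite ger0_norm ?versine_ge0// versineE ler_pdivrMr//.
apply: (le_trans (sinc2_le _)).
have d : 0 < 1 + x ^+ 2 by rewrite ltr_pwDl// sqr_ge0.
have d' : 0 < 1 + (x / 2) ^+ 2 by rewrite ltr_pwDl// sqr_ge0.
rewrite ler_pdivrMr// (_ : 4 / (1 + x ^+ 2) * 2 * (1 + (x / 2) ^+ 2)
  = 8 * (1 + (x / 2) ^+ 2) / (1 + x ^+ 2)); last by ring.
by rewrite ler_pdivlMr//; have := sqr_ge0 (x : R); move: (x : R) => y; nra.
Qed.

Lemma Rintegral_versine a :
  \int[mu]_x ((1 - cos (a * x)) / x ^+ 2) = `|a| * versine_cst.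
Proof.
rewrite /Rintegral integral_versine fineM// /versine_cst.
have := integrable_versine 1; rewrite (_ : (fun x => _) = versine_kernel).
  by move=> /integrable_fin_num; apply.
by apply/funext => x; rewrite mul1r.
Qed.

Lemma versine_cst_gt0 : 0 < versine_cst.
Proof.
apply: integral_gt0.
- exact: measurable_versine.
- exact: versine_ge0.
- move=> x /andP[x0 x1]; rewrite versineE divr_gt0// exprn_gt0// sinc_gt0//; lra.
- have := integrable_versine 1; rewrite (_ : (fun x => _) = versine_kernel)//.
  by apply/funext => x; rewrite mul1r.
Qed.

(** The product-to-sum formula. The four signs cancel, so each cosine may be replaced by the
    opposite of 1 - cos, which is integrable against 1 / x^2. *)
Let sinsincosE a b t x : sin (a * x) * sin (b * x) / x ^+ 2 * cos (t * x) =
  4^-1 * ((1 - cos ((t + a + b) * x)) / x ^+ 2 + (1 - cos ((t - a - b) * x)) / x ^+ 2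
   - (1 - cos ((t + a - b) * x)) / x ^+ 2 - (1 - cos ((t - a + b) * x)) / x ^+ 2).
Proof.
apply: (@mulfI _ 4) => //; rewrite [RHS]mulrA divff// mul1r.
by rewrite !(mulrDl, mulNr) !(cosD, sinD, cosN, sinN); ring.
Qed.

Lemma integrable_sinsincos a b t : mu.-integrable setT
  (EFin \o (fun x => sin (a * x) * sin (b * x) / x ^+ 2 * cos (t * x))).
Proof.
under eq_fun do rewrite sinsincosE.
apply: integrableZlr; apply: integrableBr; last exact: integrable_versine.
apply: integrableBr; last exact: integrable_versine.
by apply: integrableDr; exact: integrable_versine.
Qed.

(** As a function of t, a trapezoid with kinks at the points +-a +-b: for a = b = 1 the triangle on
    [-2, 2], in general the source of the trapezoids that approximate indicators. *)
Lemma Rintegral_sinsincos a b t :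
  \int[mu]_x (sin (a * x) * sin (b * x) / x ^+ 2 * cos (t * x)) =
  versine_cst / 4 * (`|t + a + b| + `|t - a - b| - `|t + a - b| - `|t - a + b|).
Proof.
under eq_Rintegral do rewrite sinsincosE.
have iv := integrable_versine.
have i1 := integrableDr (iv (t + a + b)) (iv (t - a - b)).
have i2 := integrableBr i1 (iv (t + a - b)).
have i3 := integrableBr i2 (iv (t - a + b)).
rewrite RintegralZl// RintegralB// RintegralB// RintegralD//.
by rewrite !Rintegral_versine; ring.
Qed.

End sinc.

(** * Powers of sin x / x have compactly supported cosine transforms *)

Section sinc_power.
Context {R : realType}.
Local Notation mu := (@lebesgue_measure R).
Implicit Types (x y t a b : R).

Lemma integrable_sinc_power p : mu.-integrable setT (EFin \o (fun x => sinc x ^+ p.+2)).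
Proof.
apply: integrable_le (@integrable_sinc2 R).
  by apply: measurable_funX; exact: measurable_sinc.
move=> x; rewrite -addn2 exprD normrM [X in _ * X]ger0_norm ?sqr_ge0//.
by rewrite ler_piMl ?sqr_ge0// normrX exprn_ile1// normr_sinc_le1.
Qed.

Lemma measurable_cosM t c : measurable_fun setT (fun x : R => cos (t * x + c)).
Proof. by apply: measurableT_comp; [exact: measurable_cos|exact: measurable_affine]. Qed.

(** Multiplying by 2 [sinc] amounts to integrating the frequency over a window of half-width 1. *)
Lemma integral_cos_average t x : x != 0 ->
  \int[mu]_u (\1_`[(-1), 1]%classic u * cos ((t + u) * x)) = 2 * (sinc x * cos (t * x)).
Proof.
move=> x0.
have dF u : is_derive u (1 : R) (fun u => sin ((t + u) * x) / x) (cos ((t + u) * x)).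
  have dL : is_derive u (1 : R) (fun u => (t + u) * x) x.
    under eq_fun do rewrite mulrC addrC.
    apply: (is_derive_eq (is_deriveZ x (is_derive_shift u 1 t))).
    by rewrite /GRing.scale /= mulr1.
  have := @is_derive1_comp R sin (fun u => (t + u) * x) u _ _ (is_derive_sin _) dL.
  move=> /(is_deriveZ x^-1) H.
  under eq_fun do rewrite mulrC.
  by apply: (is_derive_eq H); rewrite /GRing.scale /= mulrCA mulVf// mulr1.
have cF u : {for u, continuous (fun u => sin ((t + u) * x) / x)}.
  by apply: differentiable_continuous; apply/derivable1_diffP; apply: (@ex_derive _ _ _ _ _ _ _ (dF u)).
rewrite (_ : (fun u => _) = (fun u => cos ((t + u) * x)) \_ `[(-1), 1]%classic); last first.
  by apply/funext => u; rewrite patch_indic /= mulrC.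
rewrite -Rintegral_mkcond /Rintegral (@continuous_FTC2 _ _ (fun u => sin ((t + u) * x) / x)) //.
- rewrite -EFinB /= /sinc !(mulrDl t) !mulNr !mul1r !sinD cosN sinN; field.
  exact: x0.
- apply: continuous_subspaceT => u.
  apply: (@continuous_comp _ _ _ (fun u => (t + u) * x) cos); last exact: continuous_cos.
  by apply: cvgMl; apply: cvgD; [exact: cvg_cst|exact: cvg_id].
- split; first by move=> u _; apply: (@ex_derive _ _ _ _ _ _ _ (dF u)).
  + by apply: cvg_at_right_filter; exact: cF.
  + by apply: cvg_at_left_filter; exact: cF.
- by move=> u _; rewrite derive1E; exact: (@derive_val _ _ _ _ _ _ _ (dF u)).
Qed.

Definition sinc_transform p t := \int[mu]_x (cos (t * x) * sinc x ^+ p).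

(** Induction from the exponent 2, whose transform is a triangle: by Fubini one more factor averages
    the transform over [t - 1, t + 1], so the support grows by 1 on each side. *)
Lemma sinc_transform_vanish p t : p.+2%:R <= `|t| -> sinc_transform p.+2 t = 0.
Proof.
rewrite /sinc_transform; elim: p t => [|p IH] t pt.
  transitivity (\int[mu]_x (sin (1 * x) * sin (1 * x) / x ^+ 2 * cos (t * x))).
    apply: eq_Rintegral => x _; rewrite !mul1r /sinc exprMn exprVn mulrC.
    by rewrite expr2.
  rewrite Rintegral_sinsincos.
  have [t0|t0] := leP 0 t.
    rewrite (ger0_norm t0) in pt.
    rewrite !ger0_norm; last 4 first; try lra.
  rewrite (ltr0_norm t0) in pt.
  rewrite !ler0_norm; last 4 first; try lra.
pose f (p' : R * R) := sinc p'.1 ^+ p.+2 * (\1_`[(-1), 1]%classic p'.2 * cos ((t + p'.2) * p'.1)).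
have mf : measurable_fun setT f.
  apply: measurable_funM.
    apply: measurable_funX; apply: measurableT_comp; last exact: measurable_fst.
    exact: measurable_sinc.
  apply: measurable_funM.
    by apply: measurableT_comp; [exact: measurable_indic|exact: measurable_snd].
  apply: measurableT_comp; first exact: measurable_cos.
  by apply: measurable_funM => //; apply: measurable_funD.
have fb x u : `|f (x, u)| <= `|sinc x ^+ p.+2| * \1_`[(-1), 1]%classic u.
  rewrite /f /= normrM ler_wpM2l// normrM ger0_norm ?indic_ge0//.
  by rewrite ler_piMr ?indic_ge0// normr_cos_le1.
have := @dominated_Fubini _ _ _ _ _ mu mu f _ _ mf
  (integrable_norm (integrable_sinc_power p)) (integrable_indic_itv _ _ _ _) fb.
have -> : \int[mu]_u \int[mu]_x f (x, u) = 0.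
  rewrite -[RHS](mul0r (fine (mu setT))) -(Rintegral_cst _ measurableT 0).
  apply: eq_Rintegral => u _; rewrite /f /= indicE.
  have [|_] := boolP (u \in _); last first.
    by under eq_Rintegral do rewrite mul0r mulr0; rewrite Rintegral_cst// mul0r.
  rewrite inE /= in_itv/= => /andP[u1 u2].
  under eq_Rintegral do rewrite mul1r mulrC.
  apply: IH.
  have u3 : `|u : R| <= 1 by rewrite ler_norml u1.
  have := ler_normB (t + (u : R)) u; rewrite addrK.
  by move: pt u3; rewrite -natr1; lra.
have -> : \int[mu]_x \int[mu]_u f (x, u) =
    \int[mu]_x (2 * (cos (t * x) * sinc x ^+ p.+3)).
  apply: eq_Rintegral => x _; rewrite /f /=.
  have [->|x0] := eqVneq x 0.
    rewrite /sinc sin0 mul0r !expr0n/= !mulr0; under eq_Rintegral do rewrite mul0r.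
    by rewrite Rintegral_cst// mul0r.
  rewrite RintegralZl//; last first.
    have := @integrableMbounded _ _ _ mu _ _ 1 (measurable_cosM x (t * x)) (fun u => normr_cos_le1 _)
      (integrable_indic_itv (-1) 1 true false).
    by apply: eq_integrable => // u _ /=; rewrite mulrC mulrDl [t * x + _]addrC (mulrC u).
  by rewrite integral_cos_average// (exprS _ p.+2); ring.
rewrite RintegralZl//; last first.
  have := @integrableMbounded _ _ _ mu _ _ 1 (measurable_cosM t 0) (fun x => normr_cos_le1 _)
    (integrable_sinc_power p.+1).
  by under eq_fun do rewrite addr0.
by move/eqP; rewrite mulf_eq0 pnatr_eq0 => /eqP.
Qed.

End sinc_power.

Section reflection.
Context {R : realType}.
Local Notation mu := (@lebesgue_measure R).

Lemma integral_reflection (f : R -> \bar R) : measurable_fun setT f ->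
  (\int[mu]_x f (- x)%R = \int[mu]_x f x)%E.
Proof.
have pos (g : R -> \bar R) : measurable_fun setT g -> (forall x, 0 <= g x)%E ->
    (\int[mu]_x g (- x)%R = \int[mu]_x g x)%E.
  move=> mg g0; have a0 : -1 != 0 :> R by rewrite oppr_eq0 oner_eq0.
  rewrite -[RHS](ge0_integral_affine 0 a0)// normrN1 mul1e.
  by apply: eq_integral => x _; rewrite mulN1r addr0.
move=> mf; rewrite integralE [RHS]integralE.
congr (_ - _)%E.
  rewrite -(pos (funepos f)); last exact: funepos_ge0.
    by apply: eq_integral => x _; rewrite !funeposE.
  exact: measurable_funepos.
rewrite -(pos (funeneg f)); last exact: funeneg_ge0.
  by apply: eq_integral => x _; rewrite !funenegE.
exact: measurable_funeneg.
Qed.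

Lemma Rintegral_odd (f : R -> R) : mu.-integrable setT (EFin \o f) ->
  (forall x, f (- x) = - f x) -> \int[mu]_x f x = 0.
Proof.
move=> fi fodd; have mf := integrable_measurable fi.
have : \int[mu]_x f x = - \int[mu]_x f x.
  rewrite -mulN1r -RintegralZl// /Rintegral -(@integral_reflection (EFin \o f)).
    by congr fine; apply: eq_integral => x _; rewrite /= fodd mulN1r.
  exact/measurable_EFinP.
by lra.
Qed.

Lemma Rintegral_cos_even (h : R -> R) (t c : R) : mu.-integrable setT (EFin \o h) ->
  (forall x, h (- x) = h x) ->
  \int[mu]_x (cos (t * x + c) * h x) = cos c * \int[mu]_x (cos (t * x) * h x).
Proof.
move=> hi heven.
have ci (s : R) : mu.-integrable setT (EFin \o (fun x => cos (t * x + s) * h x)).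
  exact: (@integrableMbounded _ _ _ mu _ _ 1 (measurable_cosM t s) (fun x => normr_cos_le1 _) hi).
have ci0 : mu.-integrable setT (EFin \o (fun x => cos (t * x) * h x)).
  by have := ci 0; under eq_fun do rewrite addr0.
have si : mu.-integrable setT (EFin \o (fun x => sin (t * x) * h x)).
  have := ci (- (pi / 2)); apply: eq_integrable => // x _ /=.
  by rewrite cosBpihalf.
transitivity (\int[mu]_x (cos c * (cos (t * x) * h x) - sin c * (sin (t * x) * h x))).
  by apply: eq_Rintegral => x _; rewrite cosD; ring.
rewrite RintegralB//; [|exact: integrableZlr|exact: integrableZlr].
rewrite !RintegralZl// (@Rintegral_odd (fun x => sin (t * x) * h x))// ?mulr0 ?subr0//.
by move=> x; rewrite heven mulrN sinN mulNr.
Qed.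

End reflection.

(** * Cosine transforms of product functions *)

Section product_function.
Context {R : realType}.
Local Notation mu := (@lebesgue_measure R).
Local Notation leb := (@lebesgue_cV R).
Implicit Types (h : R -> R).

Definition prodfun h n (x : 'cV[R]_n) : R := \prod_(i < n) h (x i 0).

Lemma prodfun_cons h n (p : R * 'cV[R]_n) : prodfun h (cons_cV p) = h p.1 * prodfun h p.2.
Proof.
rewrite /prodfun big_ord_recl cons_cVE unlift_none; congr (_ * _).
by apply: eq_bigr => i _; rewrite cons_cVE liftK.
Qed.

Lemma measurable_prodfun h n : measurable_fun setT h -> measurable_fun setT (@prodfun h n).
Proof.
move=> mh; apply: measurable_prod => i _.
by apply: measurableT_comp => //; exact: measurable_coord.
Qed.

Lemma integrable_cVS n (f : 'cV[R]_n.+1 -> R) : measurable_fun setT f ->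
  (mu \x leb n)%E.-integrable setT (EFin \o (f \o @cons_cV R n)) ->
  (leb n.+1).-integrable setT (EFin \o f).
Proof.
move=> mf fi; apply: (integrable_pushforward (@measurable_cons_cV R n)) => //.
exact/measurable_EFinP.
Qed.

Lemma Rintegral_cVS n (f : 'cV[R]_n.+1 -> R) : measurable_fun setT f ->
  (mu \x leb n)%E.-integrable setT (EFin \o (f \o @cons_cV R n)) ->
  \int[leb n.+1]_x f x = \int[(mu \x leb n)%E]_p f (cons_cV p).
Proof.
move=> mf fi; rewrite /Rintegral.
by rewrite (integral_pushforward (@measurable_cons_cV R n))//; exact/measurable_EFinP.
Qed.

Lemma integrable_prodfun h n : mu.-integrable setT (EFin \o h) ->
  (leb n).-integrable setT (EFin \o @prodfun h n).
Proof.
move=> hi; have mh := integrable_measurable hi.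
elim: n => [|n IH].
  apply: (@measurable_bounded_integrable _ _ _ (leb 0)) => //.
  - by rewrite /= diracT ltry.
  - exact: measurable_prodfun.
  - exists 1; split; first exact: num_real.
    by move=> M /ltW M1 x _; rewrite /= /prodfun big_ord0 normr1.
apply: integrable_cVS; first exact: measurable_prodfun.
apply: (@dominated_integrable_prod _ _ _ _ _ mu (leb n) _ (fun x => `|h x|) (fun y => `|prodfun h y|)).
- by apply: measurableT_comp; [exact: measurable_prodfun|exact: measurable_cons_cV].
- exact: (integrable_norm hi).
- exact: (integrable_norm IH).
- by move=> x y /=; rewrite prodfun_cons normrM.
Qed.

Lemma innerE n (t x : 'cV[R]_n) : inner t x = \sum_(i < n) t i 0 * x i 0.
Proof. by rewrite /inner mxE; apply: eq_bigr => i _; rewrite mxE. Qed.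

Lemma inner_cons n (t : 'cV[R]_n.+1) p :
  inner t (cons_cV p) = t 0 0 * p.1 + inner (\col_i t (lift 0 i) 0) p.2.
Proof.
rewrite !innerE big_ord_recl cons_cVE unlift_none; congr (_ + _).
by apply: eq_bigr => i _; rewrite cons_cVE liftK mxE.
Qed.

Lemma measurable_inner n (t : 'cV[R]_n) : measurable_fun setT (inner t).
Proof.
rewrite (_ : inner t = fun x => \sum_(i < n) t i 0 * x i 0); last first.
  by apply/funext => x; rewrite innerE.
by apply: measurable_sum => i; apply: measurable_funM => //; exact: measurable_coord.
Qed.

Lemma measurable_cos_inner n (t : 'cV[R]_n) c : measurable_fun setT (fun x => cos (inner t x + c)).
Proof.
apply: measurableT_comp; first exact: measurable_cos.
by apply: measurable_funD => //; exact: measurable_inner.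
Qed.

(** The phase c makes the induction work: when a coordinate is split off, its contribution joins the
    phase of the remaining ones, and evenness of h turns a phase into a factor cos c. *)
Lemma Rintegral_cos_prodfun h n (t : 'cV[R]_n) c : mu.-integrable setT (EFin \o h) ->
  (forall x, h (- x) = h x) ->
  \int[leb n]_x (cos (inner t x + c) * prodfun h x) =
  cos c * \prod_(i < n) \int[mu]_x (cos (t i 0 * x) * h x).
Proof.
move=> hi heven; have mh := integrable_measurable hi.
elim: n t c => [|n IH] t c.
  rewrite big_ord0 mulr1 /Rintegral /= integral_dirac//; last first.
    apply/measurable_EFinP; apply: measurable_funM; last exact: measurable_prodfun.
    exact: measurable_cos_inner.
  by rewrite diracT mul1e /= innerE big_ord0 add0r /prodfun big_ord0 mulr1.
have mf : measurable_fun setT (fun x : 'cV[R]_n.+1 => cos (inner t x + c) * prodfun h x).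
  by apply: measurable_funM; [exact: measurable_cos_inner|exact: measurable_prodfun].
pose f (p : R * 'cV[R]_n) := cos (inner t (cons_cV p) + c) * prodfun h (cons_cV p).
have mf' : measurable_fun setT f.
  by apply: (measurableT_comp mf); exact: measurable_cons_cV.
have fb x y : `|f (x, y)| <= `|h x| * `|prodfun h y|.
  by rewrite /f prodfun_cons normrM normrM ler_piMl ?mulr_ge0// normr_cos_le1.
have ih := integrable_norm hi; have ip := integrable_norm (@integrable_prodfun h n hi).
have P1 := @dominated_integrable_prod _ _ _ _ _ mu (leb n) f _ _ mf' ih ip fb.
have P2 := @dominated_integral_prod _ _ _ _ _ mu (leb n) f _ _ mf' ih ip fb.
rewrite (Rintegral_cVS mf P1) -/f P2.
have inner_int (a : R) : \int[leb n]_y f (a, y) =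
    h a * (cos (t 0 0 * a + c) * \prod_(i < n) \int[mu]_x (cos ((\col_i t (lift 0 i) 0) i 0 * x) * h x)).
  rewrite -IH -RintegralZl//; last first.
    apply: (@integrableMbounded _ _ _ (leb n) _ _ 1); last exact: integrable_prodfun.
      exact: measurable_cos_inner.
    by move=> x; exact: normr_cos_le1.
  apply: eq_Rintegral => y _; rewrite /f prodfun_cons inner_cons /=.
  by rewrite addrAC (addrC _ (inner _ _)) mulrCA.
under eq_Rintegral do rewrite inner_int.
rewrite big_ord_recl mulrA -Rintegral_cos_even// -RintegralZr//; last first.
  exact: (@integrableMbounded _ _ _ mu _ _ 1 (measurable_cosM _ _) (fun x => normr_cos_le1 _) hi).
apply: eq_Rintegral => x _; rewrite mulrA (mulrC (h x)); congr (_ * _).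
by apply: eq_bigr => i _; under eq_Rintegral do rewrite mxE.
Qed.

End product_function.

(** * The spectral lower bound *)

Section kernel_lower_bound.
Context {R : realType} (n : nat).
Local Notation mu := (@lebesgue_measure R).
Local Notation leb := (@lebesgue_cV R).

(** The norm is the maximum of the coordinates and all factors are at least 1. A product weight
    reduces integrability against psi^e to one dimension. *)
Lemma norm_le_prod (x : 'cV[R]_n.+1) : 1 + `|x| <= \prod_(i < n.+1) (1 + `|x i 0|).
Proof.
have ge1 (r : seq 'I_n.+1) : 1 <= \prod_(i <- r) (1 + `|x i 0|).
  elim: r => [|i r IH]; first by rewrite big_nil.
  by rewrite big_cons -[X in X <= _]mulr1 ler_pM// lerDl.
rewrite -lerBrDl; apply: mx_norm_leP => [|i j]; first by rewrite subr_ge0 ge1.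
rewrite (ord1 j) lerBrDl (bigD1 i)//= ler_peMr ?addr_ge0//.
by rewrite -big_filter; exact: ge1.
Qed.

Lemma powR_growth (psi : 'cV[R]_n.+1 -> R) (C e : R) (m : nat) :
  0 < C -> 0 <= e -> (forall x, 0 <= psi x <= C * (1 + `|x|) ^+ m) ->
  exists M : nat, forall x, psi x `^ e <= C `^ e * \prod_(i < n.+1) (1 + `|x i 0|) ^+ M.
Proof.
move=> C0 e0 psile.
exists (Num.truncn (m%:R * e)).+1 => x.
have /andP[p0 ple] := psile x.
have x1 : 1 <= 1 + `|x| by rewrite lerDl.
have x0 : 0 <= 1 + `|x| by rewrite addr_ge0.
apply: (@le_trans _ _ ((C * (1 + `|x|) ^+ m) `^ e)).
  by apply: ge0_ler_powR => //; rewrite nnegrE// (le_trans p0).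
rewrite powRM ?exprn_ge0 ?(ltW C0)// ler_wpM2l ?powR_ge0//.
rewrite -powR_mulrn// -powRrM.
apply: (@le_trans _ _ ((1 + `|x|) ^+ (Num.truncn (m%:R * e)).+1)).
  by rewrite -powR_mulrn//; apply: ler_powR => //; exact/ltW/truncnS_gt.
rewrite prodrXl; apply: lerXn2r; rewrite ?nnegrE//; last exact: norm_le_prod.
by apply: prodr_ge0 => i _; rewrite addr_ge0.
Qed.

(** Half of the powers of [sinc] are dropped; the others are bounded by (2 / (1 + a^2))^(M+1), the
    weight by (2 (1 + a^2))^M, and one integrable factor 1 / (1 + a^2) is left. *)
Lemma integrable_sinc_weight (M : nat) : mu.-integrable setT
  (EFin \o (fun a => (sinc a ^+ (2 * M.+1)) ^+ 2 * (1 + `|a|) ^+ M)).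
Proof.
have h : mu.-integrable setT (EFin \o (fun a => 2 ^+ M.+1 * 2 ^+ M * (1 + a ^+ 2)^-1)).
  by apply: integrableZlr; exact: integral_oneDsqr.
apply: integrable_le h.
  apply: measurable_funM; first by do 2 apply: measurable_funX; exact: measurable_sinc.
  by apply: measurable_funX; apply: measurable_funD.
move=> a; have d : 0 < 1 + a ^+ 2 by rewrite ltr_pwDl// sqr_ge0.
rewrite ger0_norm; last first.
  by apply: mulr_ge0; [exact: sqr_ge0|apply: exprn_ge0; rewrite addr_ge0].
have -> : 2 ^+ M.+1 * 2 ^+ M * (1 + a ^+ 2)^-1 = (2 / (1 + a ^+ 2)) ^+ M.+1 * (2 * (1 + a ^+ 2)) ^+ M.
  move: (1 + a ^+ 2) (gt_eqF d) => D /negbT D0.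
  by rewrite !exprMn exprVn !exprS; field; rewrite ?mulf_neq0 ?expf_neq0.
apply: ler_pM; [exact: sqr_ge0|by rewrite exprn_ge0// addr_ge0| |].
  rewrite exprM; apply: (@le_trans _ _ ((sinc a ^+ 2) ^+ M.+1)).
    have s0 := sqr_ge0 (sinc (a : R)).
    have s1 : sinc (a : R) ^+ 2 <= 1.
      by rewrite -real_normK ?num_real// expr_le1// normr_sinc_le1.
    by rewrite expr2; apply: ler_piMl; [exact: exprn_ge0|exact: exprn_ile1].
  by apply: lerXn2r; rewrite ?nnegrE ?sqr_ge0 ?divr_ge0 ?(ltW d)// sinc2_le.
apply: (@le_trans _ _ ((1 + `|a|) ^+ 2 ^+ M)).
  by rewrite -exprM; apply: ler_weXn2l; [rewrite lerDl|rewrite leq_pmull].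
apply: lerXn2r; rewrite ?nnegrE ?sqr_ge0 ?mulr_ge0 ?(ltW d)//.
rewrite -(real_normK (num_real a)); have := sqr_ge0 (`|a| - 1); nra.
Qed.

(** The transform of a product function is a product of transforms, so a single coordinate of size
    at least p annihilates it. The constant J^2 / (W + 1) involves neither the number of frequencies
    nor their coefficients. *)
Lemma kernel_lower_bound (psi : 'cV[R]_n.+1 -> R) (C e : R) (m : nat) :
  measurable_fun setT psi -> (forall x, x != 0 -> 0 < psi x) ->
  0 < C -> 0 <= e -> (forall x, 0 <= psi x <= C * (1 + `|x|) ^+ m) ->
  exists2 c : R, 0 < c & exists p : nat, (0 < p)%N /\
    forall k (x : 'I_k -> 'cV[R]_n.+1) (a : 'I_k -> R),
    (forall i, exists j, p%:R <= `|x i j 0|) ->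
    (c%:E <= \int[leb n.+1]_y ((1 - \sum_(i < k) a i * cos (inner (x i) y)) ^+ 2
                               / (psi y `^ e))%:E)%E.
Proof.
move=> mpsi psi_gt0 C0 e0 psile.
have [M psiM] := powR_growth C0 e0 psile.
(* An even exponent makes h nonnegative, so that J > 0; its size makes h^2 integrable against the
   weight (1 + |a|)^M. *)
pose p := (2 * M.+1)%N; pose h a : R := sinc a ^+ p.
have pE : p = (M * 2).+2 by rewrite /p mul2n -muln2 mulSn.
have hi : mu.-integrable setT (EFin \o h) by rewrite /h pE; exact: integrable_sinc_power.
have heven a : h (- a) = h a by rewrite /h sincN.
pose g := @prodfun R h n.+1.
have gi : (leb n.+1).-integrable setT (EFin \o g) by exact: integrable_prodfun.
have mg := integrable_measurable gi.
pose H a : R := h a ^+ 2 * (1 + `|a|) ^+ M.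
have Hi : (leb n.+1).-integrable setT (EFin \o @prodfun R H n.+1).
  by apply: integrable_prodfun; exact: integrable_sinc_weight.
pose w y := g y ^+ 2 * psi y `^ e.
have w0 y : 0 <= w y by rewrite mulr_ge0 ?sqr_ge0 ?powR_ge0.
have mpe : measurable_fun setT (fun y => psi y `^ e).
  by apply: (measurableT_comp (measurable_powR e)).
have mw : measurable_fun setT w by apply: measurable_funM => //; exact: measurable_funX.
have wi : (leb n.+1).-integrable setT (EFin \o w).
  apply: (@integrable_le _ _ _ (leb n.+1) w (fun y => C `^ e * prodfun H y)) => //.
    move=> y; rewrite ger0_norm// /w /prodfun /H big_split/= mulrCA.
    by rewrite [X in _ <= X * _]prodrXl; apply: ler_wpM2l; [exact: sqr_ge0|exact: psiM].
  exact: integrableZlr.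
pose J := \int[leb n.+1]_y g y; pose W := \int[leb n.+1]_y w y.
have cosJ x : \int[leb n.+1]_y (cos (inner x y) * g y) =
    \prod_(i < n.+1) \int[mu]_a (cos (x i 0 * a) * h a).
  have := @Rintegral_cos_prodfun R h n.+1 x 0 hi heven; rewrite cos0 mul1r => <-.
  by apply: eq_Rintegral => y _; rewrite addr0.
have J0 : 0 < J.
  have -> : J = \prod_(i < n.+1) \int[mu]_a h a.
    transitivity (\int[leb n.+1]_y (cos (inner 0 y) * g y)).
      apply: eq_Rintegral => y _; rewrite innerE big1 ?cos0 ?mul1r// => i _.
      by rewrite mxE mul0r.
    rewrite cosJ; apply: eq_bigr => i _; apply: eq_Rintegral => a _.
    by rewrite mxE mul0r cos0 mul1r.
  apply: prodr_gt0 => i _; apply: integral_gt0 => //.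
  - exact: integrable_measurable hi.
  - by move=> a; rewrite /h /p exprM exprn_ge0// sqr_ge0.
  - by move=> a a01; rewrite exprn_gt0// sinc_gt0.
have W0 : 0 <= W by exact: Rintegral_ge0.
have W1 : 0 < W + 1 by rewrite ltr_wpDl.
exists (J ^+ 2 / (W + 1)); first by rewrite divr_gt0// exprn_gt0.
exists p; split; first by rewrite pE.
move=> k x a xp.
pose v y := 1 - \sum_(i < k) a i * cos (inner (x i) y).
pose F y := v y ^+ 2 / (psi y `^ e).
have cosi i : (leb n.+1).-integrable setT (EFin \o (fun y => cos (inner (x i) y) * g y)).
  apply: (@integrableMbounded _ _ _ (leb n.+1) _ _ 1) => //.
    by have := measurable_cos_inner (x i) 0; under eq_fun do rewrite addr0.
  by move=> y; exact: normr_cos_le1.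
have vgE : (fun y => v y * g y) = (fun y => g y - \sum_(i < k) a i * (cos (inner (x i) y) * g y)).
  apply/funext => y; rewrite /v mulrBl mul1r mulr_suml; congr (_ - _).
  by apply: eq_bigr => i _; rewrite mulrA.
have sumi : (leb n.+1).-integrable setT
    (EFin \o (fun y => \sum_(i < k) a i * (cos (inner (x i) y) * g y))).
  by apply: integrable_sumr => i; exact: integrableZlr.
have vgi : (leb n.+1).-integrable setT (EFin \o (fun y => v y * g y)).
  by rewrite vgE; exact: integrableBr.
have vgJ : \int[leb n.+1]_y (v y * g y) = J.
  rewrite vgE RintegralB// Rintegral_sum; last by move=> i; exact: integrableZlr.
  rewrite big1 ?subr0// => i _; rewrite RintegralZl// cosJ.
  have [j pj] := xp i; rewrite (bigD1 j)//= (_ : \int[mu]_a _ = 0) ?mul0r ?mulr0//.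
  by rewrite /h pE; apply: sinc_transform_vanish; rewrite -pE.
have mv : measurable_fun setT v.
  apply: measurable_funB => //; apply: measurable_sum => i; apply: measurable_funM => //.
  by have := measurable_cos_inner (x i) 0; under eq_fun do rewrite addr0.
have mF : measurable_fun setT F.
  apply: measurable_funM; first exact: measurable_funX.
  by apply: (measurableT_comp measurable_invr).
have F0 y : 0 <= F y by rewrite divr_ge0 ?sqr_ge0 ?powR_ge0.
have [Foo|] := ltP (\int[leb n.+1]_y (F y)%:E)%E +oo%E; last first.
  by rewrite leye_eq => /eqP ->; rewrite leey.
have Fi := ge0_integrable mF F0 Foo.
rewrite -EFin_Rintegral// lee_fin.
(* The weight of the AM-GM inequality is such that W / l <= J; from 2 J <= l I + W / l there remains
   J <= l I, that is I >= J^2 / (W + 1). *)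
pose l := (W + 1) / J.
have l0 : 0 < l by rewrite divr_gt0.
(* AM-GM; at y = 0, where psi may vanish, g vanishes as well. *)
have amgm y : 2 * (v y * g y) <= l * F y + l^-1 * w y.
  have [pe0|pe0] := eqVneq (psi y `^ e) 0.
    have y0 : y = 0.
      apply/eqP; apply: contraT => /psi_gt0 py.
      by move: pe0 => /eqP; rewrite gt_eqF// powR_gt0.
    have -> : g y = 0.
      rewrite /g /prodfun big_ord_recl y0 mxE /h /sinc sin0 mul0r pE expr0n.
      by rewrite mul0r.
    by rewrite !mulr0 addr_ge0// mulr_ge0// ?invr_ge0 ltW.
  have pgt0 : 0 < psi y `^ e by rewrite lt_neqAle eq_sym pe0 powR_ge0.
  rewrite /F /w -subr_ge0.
  have -> : l * (v y ^+ 2 / psi y `^ e) + l^-1 * (g y ^+ 2 * psi y `^ e) - 2 * (v y * g y)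
     = (l * v y - g y * psi y `^ e) ^+ 2 / (l * psi y `^ e).
    by field; rewrite pe0 gt_eqF.
  by rewrite divr_ge0 ?sqr_ge0// mulr_ge0// ltW.
have : 2 * J <= l * (\int[leb n.+1]_y F y) + l^-1 * W.
  rewrite -vgJ -!RintegralZl// -RintegralD//; [|exact: integrableZlr|exact: integrableZlr].
  apply: le_Rintegral => //; first exact: integrableZlr.
  by apply: integrableDr; exact: integrableZlr.
move: (\int[leb n.+1]_y F y) => I; rewrite /l invf_div => HI.
rewrite ler_pdivrMr//.
have : J / (W + 1) * W <= J.
  by rewrite mulrAC ler_pdivrMr// ler_pM2l// lerDl.
move=> H2; have : J <= (W + 1) / J * I by lra.
by rewrite mulrAC ler_pdivlMr// expr2 (mulrC I).
Qed.

End kernel_lower_bound.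

(** * The polar norm and the polar radius *)

Section tau_theory.
Context {R : realType} (n : nat).
Variables (E : 'M[R]_n) (nE : 'cV[R]_n -> R).
Hypothesis hnE : polar_norm E nE.

Lemma norm_upper_bound : exists2 C : R, 0 < C & forall x, nE x <= C * `|x|.
Proof.
case: hnE => -[_ nZ nD] _.
have n0 : nE 0 = 0 by rewrite -(scale0r (0 : 'cV[R]_n)) nZ normr0 mul0r.
have nge0 x : 0 <= nE x.
  have := nD x (- x); rewrite subrr n0 -scaleN1r nZ normrN1 mul1r; lra.
have nsum (r : seq 'I_n) (f : 'I_n -> 'cV[R]_n) : nE (\sum_(i <- r) f i) <= \sum_(i <- r) nE (f i).
  elim: r => [|i r IH]; first by rewrite !big_nil n0.
  by rewrite !big_cons (le_trans (nD _ _))// lerD2l.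
(* The summand 1 keeps the constant positive even for an empty sum. *)
exists (1 + \sum_(i < n) nE (delta_mx i 0)); first by rewrite ltr_pwDl// sumr_ge0.
move=> x; have {1}-> : x = \sum_(i < n) x i 0 *: delta_mx i 0.
  rewrite {1}(matrix_sum_delta x); apply: eq_bigr => i _.
  by rewrite big_ord1.
apply: (le_trans (nsum _ _)).
rewrite mulrDl mul1r mulr_suml -[X in X <= _]add0r lerD//.
by apply: ler_sum => i _; rewrite nZ mulrC ler_wpM2l// le_mx_norm.
Qed.

Lemma tau_gt0P x : x != 0 -> 0 < tau E nE x /\
  exists2 theta, nE theta = 1 & x = mxpow (tau E nE x) E *m theta.
Proof.
move=> x0; rewrite /tau (negbTE x0).
case: hnE => _ [g [[_ gA] [_ gK] _ _]].
apply: (xgetPex 0 (P := [set r : R | 0 < r /\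
   exists2 theta, nE theta = 1 & x = mxpow r E *m theta])).
have [/= g1 g2] := gA _ x0.
by exists (g x).1; split => //; exists (g x).2 => //; rewrite gK.
Qed.

Lemma tau_ge0 x : 0 <= tau E nE x.
Proof.
have [->|x0] := eqVneq x 0; first by rewrite /tau eqxx.
exact/ltW/(tau_gt0P x0).1.
Qed.

End tau_theory.

Lemma inner_mulmx {R : realType} n (A : 'M[R]_n) (s x : 'cV[R]_n) :
  inner s (A *m x) = inner (A^T *m s) x.
Proof. by rewrite /inner trmx_mul trmxK mulmxA. Qed.

(** * Rescaling to large frequencies *)

Section spectral_lower_bound.
Context {R : realType} (n : nat).
Variables (E : 'M[R]_n.+1) (nE : 'cV[R]_n.+1 -> R) (psi : 'cV[R]_n.+1 -> R).
Hypothesis hnE : polar_norm E nE.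
Hypothesis psi_ge0 : forall x, 0 <= psi x.
Hypothesis psi_cont : continuous psi.
Hypothesis psi_hom : homogeneous E^T psi.
Local Notation leb := (@lebesgue_cV R).

Let phi r := mxpow r E^T.

Let psi_gt0 (x : 'cV[R]_n.+1) : x != 0 -> 0 < psi x.
Proof. by move=> /psi_hom[]. Qed.

Let psi_phi (r : R) (x : 'cV[R]_n.+1) : 0 < r -> x != 0 -> psi (phi r *m x) = r * psi x.
Proof. by move=> r0 /psi_hom[_]; exact. Qed.

Let psi0 : psi 0 = 0.
Proof. exact: (homogeneous_at0 psi_cont psi_gt0 psi_phi). Qed.

(** The determinant r^(tr E) of r^(E') is below 1 for some r < 1. Thus the exponent 2 + tr E is
    nonnegative and the growth bound of psi may be raised to it. *)
Lemma mxtrace_gt0 : 0 < \tr E.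
Proof.
have [r [/andP[r0 r1] dr]] := homogeneous_det_lt1 psi_cont psi_gt0 psi_phi.
move: dr; rewrite /phi det_mxpow// mxtrace_tr ger0_norm ?powR_ge0//.
rewrite /powR gt_eqF// -expR0 ltr_expR => H.
by have := ln_lt0 (introT andP (conj r0 r1)); move: H; nra.
Qed.

(** For r = rho r0 the substitution by r^(- E') replaces the frequencies s_i by y_i = r^(- E) s_i,
    which [kernel_lower_bound] handles, and c r^2 comes out. *)
Lemma spectral_lower_bound : exists2 c : R, 0 < c &
  forall k (s : 'I_k -> 'cV[R]_n.+1) (a : 'I_k -> R) (rho : R), 0 < rho ->
  (forall i, rho <= tau E nE (s i)) ->
  ((c * rho ^+ 2)%:E <= \int[leb n.+1]_y ((1 - \sum_(i < k) a i * cos (inner (s i) y)) ^+ 2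
                               / (psi y `^ (2 + \tr E)))%:E)%E.
Proof.
have [C [m [C0 psiC]]] := homogeneous_growth psi_cont psi_gt0 psi_phi.
have mpsi := continuous_measurable_cV psi_cont.
have e0 : 0 <= 2 + \tr E by rewrite addr_ge0// ltW// mxtrace_gt0.
have psiC' x : 0 <= psi x <= C * (1 + `|x|) ^+ m by rewrite psi_ge0 psiC.
have [c c0 [p [p0 Hc]]] := kernel_lower_bound mpsi psi_gt0 C0 e0 psiC'.
have [D D0 nED] := norm_upper_bound hnE.
(* K is the bound on the entries that makes D (n+1) K p equal to 1: coordinates of y_i all below p
   would then give the polar direction of s_i a norm below 1. *)
pose K : R := (D * n.+1%:R * p%:R)^-1.
have K0 : 0 < K by rewrite invr_gt0 !mulr_gt0// ltr0n.
have [r0 r00 HK] := homogeneous_entries psi_cont psi_gt0 psi_phi K0.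
exists (c * r0 ^+ 2); first by rewrite mulr_gt0// exprn_gt0.
move=> k s a rho rho0 srho.
pose r := rho * r0; have r_gt0 : 0 < r by rewrite mulr_gt0.
have ri0 : 0 < r^-1 by rewrite invr_gt0.
pose y i := mxpow r^-1 E *m s i.
have yp i : exists j, p%:R <= `|y i j 0|.
  apply: contrapT => /forallNP H.
  have t0 : 0 < tau E nE (s i) by rewrite (lt_le_trans rho0).
  have s0 : s i != 0 by apply: contraTneq t0 => ->; rewrite /tau eqxx ltxx.
  have [_ [theta th1 sE]] := tau_gt0P hnE s0.
  set t := tau E nE (s i) in t0 sE.
  (* The polar direction is y_i moved by a power at a parameter r / t <= r0, because t >= rho; there
     the entries are at most K. *)
  have thE : theta = mxpow (r / t) E *m y i.
    rewrite /y mulmxA -mxpowM ?divr_gt0// mulrAC divff ?gt_eqF// mul1r sE mulmxA.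
    by rewrite -mxpowM ?invr_gt0// mulVf ?gt_eqF// mxpow1 mul1mx.
  have rt : r / t <= r0.
    by rewrite ler_pdivrMr// /r mulrC ler_pM2l// srho.
  have ylt : `|y i| < p%:R.
    rewrite [ltLHS]mx_normrE; apply/bigmax_ltP; split; first by rewrite ltr0n.
    by move=> [j l] _ /=; rewrite (ord1 l) ltNge; apply/negP/H.
  have thle : `|theta| <= n.+1%:R * K * `|y i|.
    rewrite thE; apply: mx_norm_leP => [|j l]; first by rewrite !mulr_ge0// ltW.
    rewrite mxE; apply: (le_trans (ler_norm_sum _ _ _)).
    apply: (@le_trans _ _ (\sum_(l' < n.+1) K * `|y i|)); last first.
      by rewrite sumr_const card_ord -mulrA [leRHS]mulr_natl.
    apply: ler_sum => l' _; rewrite normrM ler_pM ?le_mx_norm//.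
    have := HK (r / t) (divr_gt0 r_gt0 t0) rt l' j.
    by rewrite /phi -mxpow_trmx mxE.
  have := nED theta; rewrite th1 leNgt => /negP; apply.
  apply: (@le_lt_trans _ _ (D * (n.+1%:R * K * `|y i|))); first by rewrite ler_pM2l.
  apply: (@lt_le_trans _ _ (D * (n.+1%:R * K * p%:R))).
    by rewrite !ltr_pM2l// mulr_gt0.
  by rewrite /K le_eqVlt; apply/orP; left; apply/eqP; field; rewrite !gt_eqF// ltr0n.
pose F x := (1 - \sum_(i < k) a i * cos (inner (s i) x)) ^+ 2 / (psi x `^ (2 + \tr E)).
pose G x := (1 - \sum_(i < k) a i * cos (inner (y i) x)) ^+ 2 / (psi x `^ (2 + \tr E)).
have mG (z : 'I_k -> 'cV[R]_n.+1) : measurable_fun setT (fun x =>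
    ((1 - \sum_(i < k) a i * cos (inner (z i) x)) ^+ 2 / (psi x `^ (2 + \tr E)))%:E).
  apply/measurable_EFinP; apply: measurable_funM.
    apply: measurable_funX; apply: measurable_funB => //.
    apply: measurable_sum => i; apply: measurable_funM => //.
    by have := measurable_cos_inner (z i) 0; under eq_fun do rewrite addr0.
  apply: (measurableT_comp measurable_invr).
  exact: (measurableT_comp (measurable_powR _)).
have dphi : \det (phi r^-1) != 0 by rewrite det_mxpow// gt_eqF// powR_gt0.
rewrite -(unitmx_linear_cov dphi (mG s)); last first.
  by move=> x; rewrite lee_fin divr_ge0 ?sqr_ge0 ?powR_ge0.
have rV q : r^-1 `^ q = (r `^ q)^-1.
  by rewrite -powR_inv1 ?(ltW r_gt0)// -powRrM mulN1r powRN.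
have FE x : F (phi r^-1 *m x) = r `^ (2 + \tr E) * G x.
  rewrite /F /G mulrCA; congr (_ * _).
    congr ((1 - _) ^+ 2); apply: eq_bigr => i _.
    by rewrite inner_mulmx /phi mxpow_trmx trmxK.
  have -> : psi (phi r^-1 *m x) = r^-1 * psi x.
    have [->|x0] := eqVneq x 0; first by rewrite mulmx0 psi0 mulr0.
    exact: psi_phi.
  by rewrite powRM ?(ltW ri0)// invfM rV invrK.
under eq_integral => x _ do rewrite -/(F _) FE EFinM.
rewrite ge0_integralZl//; last 3 first.
- exact: mG.
- by move=> x _; rewrite lee_fin divr_ge0 ?sqr_ge0 ?powR_ge0.
- by rewrite lee_fin powR_ge0.
rewrite muleA -EFinM det_mxpow// mxtrace_tr ger0_norm ?powR_ge0//.
(* The trace from the determinant cancels the one in the exponent of psi; only the square is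
   left. *)
have -> : r^-1 `^ \tr E * r `^ (2 + \tr E) = r ^+ 2.
  rewrite rV powRD; last by rewrite (gt_eqF r_gt0) implybT.
  by rewrite mulrCA mulVf ?mulr1 ?powR_mulrn ?(ltW r_gt0)// gt_eqF// powR_gt0.
apply: (@le_trans _ _ ((r ^+ 2)%:E * c%:E)%E).
  by rewrite -EFinM lee_fin /r exprMn; lra.
by rewrite lee_pmul2l// ?lte_fin ?exprn_gt0//; exact: Hc.
Qed.

End spectral_lower_bound.

(** * Gaussian stochastic integrals *)

Local Notation Re := complex.Re.
Local Notation Im := complex.Im.
Local Notation normc := Normc.normc.

Section complex_misc.
Context {R : realType}.
Implicit Types (z : R[i]).

Lemma normc2E z : normc z ^+ 2 = Re z ^+ 2 + Im z ^+ 2.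
Proof. by case: z => a b /=; rewrite sqr_sqrtr// addr_ge0// sqr_ge0. Qed.

Lemma cReD z1 z2 : Re (z1 + z2) = Re z1 + Re z2.
Proof. by case: z1 z2 => [a b] [c e]. Qed.

Lemma cImD z1 z2 : Im (z1 + z2) = Im z1 + Im z2.
Proof. by case: z1 z2 => [a b] [c e]. Qed.

Lemma cReN z : Re (- z) = - Re z.
Proof. by case: z. Qed.

Lemma cImN z : Im (- z) = - Im z.
Proof. by case: z. Qed.

Lemma cReM z1 z2 : Re (z1 * z2) = Re z1 * Re z2 - Im z1 * Im z2.
Proof. by case: z1 z2 => [a b] [c e]. Qed.

Lemma cImM z1 z2 : Im (z1 * z2) = Re z1 * Im z2 + Im z1 * Re z2.
Proof. by case: z1 z2 => [a b] [c e]. Qed.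

Lemma Re_sum (I : Type) (s : seq I) (f : I -> R[i]) :
  Re (\sum_(i <- s) f i) = \sum_(i <- s) Re (f i).
Proof. by elim: s => [|i s IH]; rewrite ?big_nil// !big_cons cReD IH. Qed.

Lemma Im_sum (I : Type) (s : seq I) (f : I -> R[i]) :
  Im (\sum_(i <- s) f i) = \sum_(i <- s) Im (f i).
Proof. by elim: s => [|i s IH]; rewrite ?big_nil// !big_cons cImD IH. Qed.

Lemma Re_conj z : Re (Num.conj z) = Re z.
Proof. by case: z. Qed.

Lemma Im_conj z : Im (Num.conj z) = - Im z.
Proof. by case: z. Qed.

Lemma normc2D z1 z2 : normc (z1 + z2) ^+ 2 <= 2 * normc z1 ^+ 2 + 2 * normc z2 ^+ 2.
Proof.
rewrite !normc2E cReD cImD.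
have := sqr_ge0 (Re z1 - Re z2); have := sqr_ge0 (Im z1 - Im z2); nra.
Qed.

Lemma normc2N z : normc (- z) ^+ 2 = normc z ^+ 2.
Proof. by rewrite !normc2E cReN cImN !sqrrN. Qed.

Lemma normc2Z (a : R) z : normc (a%:C%C * z) ^+ 2 = a ^+ 2 * normc z ^+ 2.
Proof. by rewrite !normc2E cReM cImM /=; ring. Qed.

(** The real and imaginary parts of m p times the conjugate of m q are what the covariance
    prescribes. With m generic, one expansion serves the random measure and the indicators. *)
Lemma normc2_sum (J : Type) (s : seq (R[i] * J)) (m : J -> R[i]) :
  normc (\sum_(p <- s) p.1 * m p.2) ^+ 2 = \sum_(p <- s) \sum_(q <- s)
    ((Re p.1 * Re q.1 + Im p.1 * Im q.1) * Re (m p.2 * Num.conj (m q.2)) -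
     (Im p.1 * Re q.1 - Re p.1 * Im q.1) * Im (m p.2 * Num.conj (m q.2))).
Proof.
rewrite normc2E Re_sum Im_sum !expr2 !mulr_suml -big_split/=; apply: eq_bigr => p _.
rewrite !mulr_sumr -big_split/=; apply: eq_bigr => q _.
by rewrite !(cReM, cImM) Re_conj Im_conj; ring.
Qed.

End complex_misc.

Section integral_normc2_sum.
Context d (T : measurableType d) {R : realType} (mu : {measure set T -> \bar R}).

Lemma integrable_sum_seq (I : eqType) (s : seq I) (f : I -> T -> R) :
  (forall i, i \in s -> mu.-integrable setT (EFin \o f i)) ->
  mu.-integrable setT (EFin \o (fun x => \sum_(i <- s) f i x)).
Proof.
elim: s => [|i s IH] fi.
  by under eq_fun do rewrite big_nil; exact: integrable0.
under eq_fun do rewrite big_cons; apply: integrableDr.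
  by apply: fi; rewrite mem_head.
by apply: IH => j js; apply: fi; rewrite inE js orbT.
Qed.

Lemma Rintegral_sum_seq (I : eqType) (s : seq I) (f : I -> T -> R) :
  (forall i, i \in s -> mu.-integrable setT (EFin \o f i)) ->
  \int[mu]_x (\sum_(i <- s) f i x) = \sum_(i <- s) \int[mu]_x f i x.
Proof.
elim: s => [|i s IH] fi.
  rewrite big_nil; under eq_Rintegral do rewrite big_nil.
  by rewrite Rintegral_cst// mul0r.
have fs j : j \in s -> mu.-integrable setT (EFin \o f j).
  by move=> js; apply: fi; rewrite inE js orbT.
rewrite big_cons -IH//; under eq_Rintegral do rewrite big_cons.
by rewrite RintegralD//; [apply: fi; rewrite mem_head|exact: integrable_sum_seq].
Qed.

Variables (J : choiceType) (m : J -> T -> R[i]) (good : J -> Prop).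
Hypothesis Si : forall A B, good A -> good B ->
  mu.-integrable setT (EFin \o (fun w => Re (m A w * Num.conj (m B w)))).
Hypothesis Di : forall A B, good A -> good B ->
  mu.-integrable setT (EFin \o (fun w => Im (m A w * Num.conj (m B w)))).

Let term (p q : R[i] * J) (w : T) :=
  ((Re p.1 * Re q.1 + Im p.1 * Im q.1) * Re (m p.2 w * Num.conj (m q.2 w)) -
   (Im p.1 * Re q.1 - Re p.1 * Im q.1) * Im (m p.2 w * Num.conj (m q.2 w))).

Let term_int p q : good p.2 -> good q.2 -> mu.-integrable setT (EFin \o term p q).
Proof.
by move=> gp gq; apply: integrableBr; apply: integrableZlr; [exact: Si|exact: Di].
Qed.

Lemma integrable_normc2_sum (s : seq (R[i] * J)) : (forall p, p \in s -> good p.2) ->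
  mu.-integrable setT (EFin \o (fun w => normc (\sum_(p <- s) p.1 * m p.2 w) ^+ 2)).
Proof.
move=> gs; under eq_fun do rewrite (@normc2_sum _ _ s (fun A => m A _)).
apply: integrable_sum_seq => p ps; apply: integrable_sum_seq => q qs.
by apply: term_int; exact: gs.
Qed.

Lemma Rintegral_normc2_sum (s : seq (R[i] * J)) : (forall p, p \in s -> good p.2) ->
  \int[mu]_w (normc (\sum_(p <- s) p.1 * m p.2 w) ^+ 2) =
  \sum_(p <- s) \sum_(q <- s)
    ((Re p.1 * Re q.1 + Im p.1 * Im q.1) * \int[mu]_w Re (m p.2 w * Num.conj (m q.2 w)) -
     (Im p.1 * Re q.1 - Re p.1 * Im q.1) * \int[mu]_w Im (m p.2 w * Num.conj (m q.2 w))).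
Proof.
move=> gs; under eq_Rintegral do rewrite (@normc2_sum _ _ s (fun A => m A _)).
rewrite Rintegral_sum_seq => [|p ps]; last first.
  by apply: integrable_sum_seq => q qs; apply: term_int; exact: gs.
rewrite big_seq [RHS]big_seq; apply: eq_bigr => p ps.
rewrite Rintegral_sum_seq => [|q qs]; last by apply: term_int; exact: gs.
rewrite big_seq [RHS]big_seq; apply: eq_bigr => q qs.
have gp := gs _ ps; have gq := gs _ qs.
rewrite RintegralB//; [|by apply: integrableZlr; exact: Si|by apply: integrableZlr; exact: Di].
by rewrite !RintegralZl//; [exact: Di|exact: Si].
Qed.

End integral_normc2_sum.

(** * The isometry on simple functions *)

Section isometry.
Context {d : measure_display} {T : measurableType d} {R : realType}.
Variables (P : probability T R) (N : nat) (M : set 'cV[R]_N -> T -> R[i]).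
Hypothesis hM : gaussian_random_measure P M.
Local Notation leb := (@lebesgue_cV R N).

Lemma measurable_ReM A : finite_borel A -> measurable_fun setT (fun w => Re (M A w)).
Proof.
move=> fA; have [+ _] := grm_gaussian hM (k := 1) (fun=> 1) (fun=> 0) (fun=> fA).
by under eq_fun do rewrite big_ord1 mul1r mul0r addr0.
Qed.

Lemma measurable_ImM A : finite_borel A -> measurable_fun setT (fun w => Im (M A w)).
Proof.
move=> fA; have [+ _] := grm_gaussian hM (k := 1) (fun=> 0) (fun=> 1) (fun=> fA).
by under eq_fun do rewrite big_ord1 mul1r mul0r add0r.
Qed.

Lemma integrable_normc2M A : finite_borel A ->
  P.-integrable setT (EFin \o (fun w => normc (M A w) ^+ 2)).
Proof.
move=> fA; apply: ge0_integrable.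
- under eq_fun do rewrite normc2E.
  by apply: measurable_funD; apply: measurable_funX; [exact: measurable_ReM|exact: measurable_ImM].
- by move=> w; exact: sqr_ge0.
- have [+ _] := grm_covariance hM fA fA.
  rewrite unlock setIid => H.
  have -> : (\int[P]_w (normc (M A w) ^+ 2)%:E = leb A)%E.
    rewrite -H; apply: eq_integral => w _; congr EFin.
    by rewrite normc2E cReM Re_conj Im_conj; ring.
  by case: fA.
Qed.

Let finite_borelI (A B : set 'cV[R]_N) : finite_borel A -> finite_borel B -> finite_borel (A `&` B).
Proof.
move=> [mA Aoo] [mB Boo]; split; first exact: measurableI.
by apply: le_lt_trans Aoo; apply: le_measure; rewrite ?inE//; exact: measurableI.
Qed.

Let M_int (A B : set 'cV[R]_N) (f : R[i] -> R[i] -> R) : finite_borel A -> finite_borel B ->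
  measurable_fun setT (fun w => f (M A w) (M B w)) ->
  (forall x y, `|f x y| <= 2 * (normc x ^+ 2 + normc y ^+ 2)) ->
  P.-integrable setT (EFin \o (fun w => f (M A w) (M B w))).
Proof.
move=> fA fB mf fb.
apply: (@integrable_le _ _ _ P _ (fun w => 2 * (normc (M A w) ^+ 2 + normc (M B w) ^+ 2))) => //.
by apply: integrableZlr; apply: integrableDr; exact: integrable_normc2M.
Qed.

Lemma integrable_ReMM A B : finite_borel A -> finite_borel B ->
  P.-integrable setT (EFin \o (fun w => Re (M A w * Num.conj (M B w)))).
Proof.
move=> fA fB; apply: (@M_int A B (fun x y => Re (x * Num.conj y))) => //.
  under eq_fun do rewrite cReM Re_conj Im_conj.
  apply: measurable_funB; apply: measurable_funM; try exact: measurable_ReM; try exact: measurable_ImM.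
  by apply: measurableT_comp => //; exact: measurable_ImM.
move=> x y; rewrite !normc2E cReM Re_conj Im_conj ler_norml.
have := sqr_ge0 (Re x - Re y); have := sqr_ge0 (Im x - Im y).
have := sqr_ge0 (Re x + Re y); have := sqr_ge0 (Im x + Im y).
have := sqr_ge0 (Re x); have := sqr_ge0 (Re y); have := sqr_ge0 (Im x); have := sqr_ge0 (Im y).
by move=> *; apply/andP; split; nra.
Qed.

Lemma integrable_ImMM A B : finite_borel A -> finite_borel B ->
  P.-integrable setT (EFin \o (fun w => Im (M A w * Num.conj (M B w)))).
Proof.
move=> fA fB; apply: (@M_int A B (fun x y => Im (x * Num.conj y))) => //.
  under eq_fun do rewrite cImM Re_conj Im_conj.
  apply: measurable_funD; apply: measurable_funM; try exact: measurable_ReM; try exact: measurable_ImM.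
  by apply: measurableT_comp => //; exact: measurable_ImM.
move=> x y; rewrite !normc2E cImM Re_conj Im_conj ler_norml.
have := sqr_ge0 (Re x - Im y); have := sqr_ge0 (Im x - Re y).
have := sqr_ge0 (Re x + Im y); have := sqr_ge0 (Im x + Re y).
have := sqr_ge0 (Re x); have := sqr_ge0 (Re y); have := sqr_ge0 (Im x); have := sqr_ge0 (Im y).
by move=> *; apply/andP; split; nra.
Qed.

Let ind (A : set 'cV[R]_N) (x : 'cV[R]_N) : R[i] := (\1_A x)%:C%C.

Let Re_ind A B : (fun x => Re (ind A x * Num.conj (ind B x))) = \1_(A `&` B).
Proof.
apply/funext => x; rewrite cReM Re_conj Im_conj /= oppr0 mulr0 subr0.
by rewrite !indicE in_setI; case: (x \in A); case: (x \in B); rewrite /= ?mulr0 ?mul0r ?mulr1.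
Qed.

Let Im_ind A B : (fun x => Im (ind A x * Num.conj (ind B x))) = cst 0.
Proof. by apply/funext => x; rewrite cImM Re_conj Im_conj /= oppr0 mulr0 mul0r addr0. Qed.

Let ind_Si A B : finite_borel A -> finite_borel B ->
  leb.-integrable setT (EFin \o (fun x => Re (ind A x * Num.conj (ind B x)))).
Proof.
move=> fA fB; rewrite Re_ind; have [mI Ioo] := finite_borelI fA fB.
apply: ge0_integrable => //.
by rewrite integral_indic// setIT.
Qed.

Let ind_Di A B : finite_borel A -> finite_borel B ->
  leb.-integrable setT (EFin \o (fun x => Im (ind A x * Num.conj (ind B x)))).
Proof. by move=> fA fB; rewrite Im_ind; exact: integrable0. Qed.

Lemma integrable_simple_integral s : (forall p, p \in s -> finite_borel p.2) ->
  P.-integrable setT (EFin \o (fun w => normc (simple_integral M s w) ^+ 2)).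
Proof. exact: (integrable_normc2_sum integrable_ReMM integrable_ImMM). Qed.

Lemma integrable_simple_fun s : (forall p, p \in s -> finite_borel p.2) ->
  leb.-integrable setT (EFin \o (fun x => normc (simple_fun s x) ^+ 2)).
Proof. exact: (integrable_normc2_sum ind_Si ind_Di). Qed.

(** Both sides expand into the same double sum: the covariance of M(A) and M(B) and the integral of
    the product of the indicators are the measure of the intersection. *)
Lemma simple_isometry s : (forall p, p \in s -> finite_borel p.2) ->
  \int[P]_w (normc (simple_integral M s w) ^+ 2) =
  \int[leb]_x (normc (simple_fun s x) ^+ 2).
Proof.
move=> fs; rewrite (Rintegral_normc2_sum integrable_ReMM integrable_ImMM fs).
rewrite (Rintegral_normc2_sum ind_Si ind_Di fs).
rewrite big_seq [RHS]big_seq; apply: eq_bigr => p ps.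
rewrite big_seq [RHS]big_seq; apply: eq_bigr => q qs.
have fp := fs _ ps; have fq := fs _ qs; have [mI Ioo] := finite_borelI fp fq.
have [cR cI] := grm_covariance hM fp fq; rewrite unlock in cR cI.
rewrite [in RHS](Re_ind p.2 q.2) [in RHS](Im_ind p.2 q.2).
rewrite /Rintegral cR cI integral_indic// setIT.
by rewrite /= integral0.
Qed.

End isometry.

Section complex_measurable.
Context d (U : measurableType d) {R : realType}.
Implicit Types (f g : U -> R[i]).

Definition cmeasurable f : Prop :=
  measurable_fun setT (fun x => Re (f x)) /\ measurable_fun setT (fun x => Im (f x)).

Lemma cmeasurable_cst z : cmeasurable (cst z).
Proof. by split; exact: measurable_cst. Qed.

Lemma cmeasurable_real (f : U -> R) : measurable_fun setT f -> cmeasurable (fun x => (f x)%:C%C).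
Proof. by move=> mf; split => //=; exact: measurable_cst. Qed.

Lemma cmeasurableD f g : cmeasurable f -> cmeasurable g -> cmeasurable (fun x => f x + g x).
Proof.
move=> [fr fi] [gr gi]; split.
  by under eq_fun do rewrite cReD; exact: measurable_funD.
by under eq_fun do rewrite cImD; exact: measurable_funD.
Qed.

Lemma cmeasurableM f g : cmeasurable f -> cmeasurable g -> cmeasurable (fun x => f x * g x).
Proof.
move=> [fr fi] [gr gi]; split.
  by under eq_fun do rewrite cReM; apply: measurable_funB; exact: measurable_funM.
by under eq_fun do rewrite cImM; apply: measurable_funD; exact: measurable_funM.
Qed.

Lemma cmeasurableB f g : cmeasurable f -> cmeasurable g -> cmeasurable (fun x => f x - g x).
Proof.
move=> mf mg; have := cmeasurableD mf (cmeasurableM (cmeasurable_cst (-1)) mg).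
by rewrite /cmeasurable; under eq_fun do rewrite mulN1r; under [X in _ /\ measurable_fun _ X]eq_fun do rewrite mulN1r.
Qed.

Lemma measurable_normc2 f : cmeasurable f -> measurable_fun setT (fun x => normc (f x) ^+ 2).
Proof.
move=> [mr mi]; under eq_fun do rewrite normc2E.
by apply: measurable_funD; exact: measurable_funX.
Qed.

Lemma cmeasurable_sum (J : choiceType) (s : seq (R[i] * J)) (m : J -> U -> R[i]) :
  (forall p, p \in s -> cmeasurable (m p.2)) ->
  cmeasurable (fun x => \sum_(p <- s) p.1 * m p.2 x).
Proof.
elim: s => [|p s IH] ms.
  rewrite (_ : (fun x => _) = cst 0); first exact: cmeasurable_cst.
  by apply/funext => x; rewrite big_nil.
have H := cmeasurableD (cmeasurableM (cmeasurable_cst p.1) (ms _ (mem_head _ _)))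
  (IH (fun q qs => ms q (mem_behead (s := p :: s) qs))).
rewrite (_ : (fun x => _) = (fun x => p.1 * m p.2 x + \sum_(p <- s) p.1 * m p.2 x))//.
by apply/funext => x; rewrite big_cons.
Qed.

End complex_measurable.

(** * Real-valued stochastic integrals *)

Section stochastic_integral.
Context {d : measure_display} {T : measurableType d} {R : realType}.
Variables (P : probability T R) (N : nat) (M : set 'cV[R]_N -> T -> R[i]).
Hypothesis hM : gaussian_random_measure P M.
Local Notation leb := (@lebesgue_cV R N).

Lemma cmeasurable_simple_fun s : (forall p, p \in s -> finite_borel p.2) ->
  cmeasurable (fun x : 'cV[R]_N => simple_fun s x).
Proof.
move=> fs; apply: (cmeasurable_sum (m := fun A x => (\1_A x)%:C%C)) => p /fs[mp _] //.
by apply: cmeasurable_real; exact: measurable_indic.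
Qed.

Lemma cmeasurable_simple_integral s : (forall p, p \in s -> finite_borel p.2) ->
  cmeasurable (simple_integral M s).
Proof.
move=> fs; apply: cmeasurable_sum => p /fs fp; split.
- exact: (measurable_ReM hM).
- exact: (measurable_ImM hM).
Qed.

(** A stochastic integral with real values, together with the measurability that L^2 estimates on
    integrand and integral require. *)
Definition wiener (f : 'cV[R]_N -> R[i]) (Y : T -> R) : Prop :=
  [/\ cmeasurable f, measurable_fun setT Y & is_stochastic_integral P M f (fun w => (Y w)%:C%C)].

Lemma wiener0 : wiener (cst 0) (cst 0).
Proof.
split; [exact: cmeasurable_cst|exact: measurable_cst|exists (fun=> [::]); split => //].
  apply: cvg_near_cst; apply: nearW => k; apply: integral0_eq => x _.
  by rewrite /simple_fun big_nil subr0 normc2E /= expr0n /= addr0.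
rewrite unlock; apply: cvg_near_cst; apply: nearW => k; apply: integral0_eq => x _.
by rewrite /simple_integral big_nil subr0 normc2E /= expr0n /= addr0.
Qed.

Let cvg_comb (u v z : (\bar R)^nat) (a b : R) : 0 <= a -> 0 <= b ->
  u k @[k --> \oo] --> 0%E -> v k @[k --> \oo] --> 0%E ->
  (forall k, 0 <= z k <= a%:E * u k + b%:E * v k)%E -> z k @[k --> \oo] --> 0%E.
Proof.
move=> a0 b0 u0 v0 zle.
apply: (@squeeze_cvge _ _ _ _ (cst 0%E) z (fun k => a%:E * u k + b%:E * v k)%E).
- by near=> k; exact: zle.
- exact: cvg_cst.
- have -> : 0%E = (a%:E * 0 + b%:E * 0)%E :> \bar R by rewrite !mule0 adde0.
  by apply: cvgeD; [by rewrite !mule0|exact: cvgeZl|exact: cvgeZl].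
Unshelve. all: by end_near. Qed.

Let le_comb d' (U : measurableType d') (mu : {measure set U -> \bar R})
   (z1 z2 : U -> R[i]) (a : R) :
  cmeasurable z1 -> cmeasurable z2 ->
  (0 <= \int[mu]_x (normc (a%:C%C * z1 x + z2 x) ^+ 2)%:E <=
   (2 * a ^+ 2)%:E * \int[mu]_x (normc (z1 x) ^+ 2)%:E +
   2%:E * \int[mu]_x (normc (z2 x) ^+ 2)%:E)%E.
Proof.
move=> c1 c2; apply/andP; split.
  by apply: integral_ge0 => x _; rewrite lee_fin sqr_ge0.
have m1 := measurable_normc2 c1; have m2 := measurable_normc2 c2.
rewrite -ge0_integralZl//; last 3 first.
- exact/measurable_EFinP.
- by move=> x _; rewrite lee_fin sqr_ge0.
- by rewrite lee_fin mulr_ge0// sqr_ge0.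
rewrite -ge0_integralZl//; last 2 first.
- exact/measurable_EFinP.
- by move=> x _; rewrite lee_fin sqr_ge0.
rewrite -ge0_integralD//; last 4 first.
- by move=> x _; rewrite -EFinM lee_fin mulr_ge0 ?sqr_ge0// mulr_ge0 ?sqr_ge0.
- by apply: emeasurable_funM => //; exact/measurable_EFinP.
- by move=> x _; rewrite -EFinM lee_fin mulr_ge0 ?sqr_ge0.
- by apply: emeasurable_funM => //; exact/measurable_EFinP.
apply: ge0_le_integral => //.
- by move=> x _; rewrite lee_fin sqr_ge0.
- apply/measurable_EFinP; apply: measurable_normc2.
  by apply: cmeasurableD => //; apply: cmeasurableM => //; exact: cmeasurable_cst.
- by apply: emeasurable_funD; apply: emeasurable_funM => //; exact/measurable_EFinP.
- by move=> x _; rewrite -!EFinM -EFinD lee_fin (le_trans (normc2D _ _))// normc2Z mulrA.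
Qed.

Lemma wiener_axpy (a : R) f1 Y1 f2 Y2 : wiener f1 Y1 -> wiener f2 Y2 ->
  wiener (fun x => a%:C%C * f1 x + f2 x) (fun w => a * Y1 w + Y2 w).
Proof.
move=> [mf1 mY1 [s1 [fs1 c1 e1]]] [mf2 mY2 [s2 [fs2 c2 e2]]]; split.
- by apply: cmeasurableD => //; apply: cmeasurableM => //; exact: cmeasurable_cst.
- by apply: measurable_funD => //; exact: measurable_funM.
pose s k := [seq (a%:C%C * p.1, p.2) | p <- s1 k] ++ s2 k.
have sumE (g : set 'cV[R]_N -> R[i]) k :
    \sum_(p <- s k) p.1 * g p.2 =
    a%:C%C * (\sum_(p <- s1 k) p.1 * g p.2) + \sum_(p <- s2 k) p.1 * g p.2.
  rewrite /s big_cat big_map /= mulr_sumr; congr (_ + _).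
  by apply: eq_bigr => p _; rewrite mulrA.
have subE (z1 z2 y1 y2 : R[i]) : a%:C%C * z1 + z2 - (a%:C%C * y1 + y2) =
    a%:C%C * (z1 - y1) + (z2 - y2).
  by ring.
have a2 : 0 <= 2 * a ^+ 2 by rewrite mulr_ge0// sqr_ge0.
exists s; split.
- by move=> k p; rewrite mem_cat => /orP[/mapP[q qs ->]|]; [exact: (fs1 k q qs)|exact: fs2].
- apply: (cvg_comb a2 (ler0n _ 2) c1 c2) => k.
  have := @le_comb _ _ leb (fun x => simple_fun (s1 k) x - f1 x)
    (fun x => simple_fun (s2 k) x - f2 x) a
    (cmeasurableB (cmeasurable_simple_fun (fs1 k)) mf1)
    (cmeasurableB (cmeasurable_simple_fun (fs2 k)) mf2).
  by under eq_integral do rewrite -subE -(sumE (fun A => (\1_A _)%:C%C)).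
- rewrite unlock in e1 e2 *.
  apply: (cvg_comb a2 (ler0n _ 2) e1 e2) => k.
  have := @le_comb _ _ P (fun w => simple_integral M (s1 k) w - (Y1 w)%:C%C)
    (fun w => simple_integral M (s2 k) w - (Y2 w)%:C%C) a
    (cmeasurableB (cmeasurable_simple_integral (fs1 k)) (cmeasurable_real mY1))
    (cmeasurableB (cmeasurable_simple_integral (fs2 k)) (cmeasurable_real mY2)).
  under eq_integral do rewrite -subE -(sumE (fun A => M A _)).
  by under eq_integral do rewrite -rmorphM -rmorphD.
Qed.

Lemma wiener_sum (I : Type) (r : seq I) (a : I -> R) f Y :
  (forall i, wiener (f i) (Y i)) ->
  wiener (fun x => \sum_(i <- r) (a i)%:C%C * f i x) (fun w => \sum_(i <- r) a i * Y i w).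
Proof.
move=> fY; elim: r => [|i r IH].
  under eq_fun do rewrite big_nil; under [X in wiener _ X]eq_fun do rewrite big_nil.
  exact: wiener0.
under eq_fun do rewrite big_cons; under [X in wiener _ X]eq_fun do rewrite big_cons.
exact: wiener_axpy.
Qed.

Lemma cvge0_lt (u : (\bar R)^nat) (e : R) : u k @[k --> \oo] --> 0%E -> 0 < e ->
  \forall k \near \oo, (u k < e%:E)%E.
Proof.
move=> u0 e0; apply: (u0 [set x | (x < e%:E)%E]).
suff : nbhs (0 : R) (fun r : R => (r%:E < e%:E)%E) by [].
apply/nbhs_ballP; exists e => //= r.
by rewrite /ball /= sub0r normrN lte_fin => /ltr_normlW.
Qed.

Lemma wiener_sqr_integrable f Y : wiener f Y -> P.-integrable setT (EFin \o (fun w => Y w ^+ 2)).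
Proof.
move=> [mf mY [s [fs c e]]]; rewrite unlock in e.
have [k _ /(_ k (leqnn k)) ek] := cvge0_lt e ltr01.
have cI := cmeasurable_simple_integral (fs k).
have Di : P.-integrable setT (EFin \o (fun w => normc (simple_integral M (s k) w - (Y w)%:C%C) ^+ 2)).
  apply: ge0_integrable; last exact: (lt_trans ek (ltry _)).
  - by apply: measurable_normc2; apply: cmeasurableB => //; exact: cmeasurable_real.
  - by move=> w; exact: sqr_ge0.
have Ii := integrable_simple_integral hM (fs k).
have Hi := integrableDr (integrableZlr 2 Di) (integrableZlr 2 Ii).
apply: integrable_le Hi; first exact: measurable_funX.
move=> w; rewrite ger0_norm ?sqr_ge0//.
have -> : Y w ^+ 2 = normc (- (simple_integral M (s k) w - (Y w)%:C%C) + simple_integral M (s k) w) ^+ 2.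
  by rewrite opprB subrK normc2E /= expr0n addr0.
by rewrite (le_trans (normc2D _ _))// normc2N.
Qed.

(** Half of the isometry, up to a factor: |x + y|^2 <= 2 |x|^2 + 2 |y|^2 is applied once between f
    and a simple function and once between its integral and Y, which produces the 4. *)
Lemma wiener_lower f Y : wiener f Y ->
  (\int[leb]_x (normc (f x) ^+ 2)%:E <= (4 * \int[P]_w (Y w ^+ 2))%:E)%E.
Proof.
move=> fY; have Yi := wiener_sqr_integrable fY.
move: fY => [mf mY [s [fs c e]]]; rewrite unlock in e.
apply/lee_addgt0Pr => r r0.
(* Each approximation error is doubled to r / 3, and the one on the side of Y once more: r / 3 + 2
   (r / 3) = r. *)
have r6 : 0 < r / 6 by rewrite divr_gt0.
have H := filterI (cvge0_lt c r6) (cvge0_lt e r6).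
have [k _ /(_ k (leqnn k)) [ck ek]] := H.
have cf := cmeasurable_simple_fun (fs k).
have cI := cmeasurable_simple_integral (fs k).
have cY := cmeasurable_real mY.
have /andP[_ h1] := @le_comb _ _ leb _ _ (-1) (cmeasurableB cf mf) cf.
have /andP[_ h2] := @le_comb _ _ P _ _ 1 (cmeasurableB cI cY) cY.
have e1 : (\int[leb]_x (normc ((-1)%:C%C * (simple_fun (s k) x - f x) + simple_fun (s k) x) ^+ 2)%:E =
    \int[leb]_x (normc (f x) ^+ 2)%:E)%E.
  apply: eq_integral => x _; congr (_ ^+ 2)%:E; congr normc.
  by rewrite rmorphN1 mulN1r opprB subrK.
have e2 : (\int[P]_w (normc (1%:C%C * (simple_integral M (s k) w - (Y w)%:C%C) + (Y w)%:C%C) ^+ 2)%:E =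
    (\int[leb]_x (normc (simple_fun (s k) x) ^+ 2)%R)%:E)%E.
  rewrite -(simple_isometry hM (fs k)) (EFin_Rintegral (integrable_simple_integral hM (fs k))).
  apply: eq_integral => x _; congr (_ ^+ 2)%:E; congr normc.
  by rewrite rmorph1 mul1r subrK.
have e3 : (\int[P]_w (normc ((Y w)%:C%C) ^+ 2)%:E = (\int[P]_w (Y w ^+ 2)%R)%:E)%E.
  rewrite EFin_Rintegral//; apply: eq_integral => w _; congr EFin.
  by rewrite normc2E /= expr0n addr0.
rewrite e1 -(EFin_Rintegral (integrable_simple_fun (fs k))) in h1.
rewrite e2 e3 in h2.
apply: (le_trans h1).
have ck' : ((2 * (-1) ^+ 2)%:E * \int[leb]_x (normc (simple_fun (s k) x - f x) ^+ 2)%:E <= (r / 3)%:E)%E.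
  apply: (@le_trans _ _ (2%:E * (r / 6)%:E)%E); last by rewrite -EFinM lee_fin; lra.
  by rewrite sqrrN expr1n mulr1; apply: lee_pmul; [by rewrite lee_fin|by apply: integral_ge0 => x _; rewrite lee_fin sqr_ge0|by []|exact: ltW].
have ek' : ((2 * 1 ^+ 2)%:E * \int[P]_w (normc (simple_integral M (s k) w - (Y w)%:C%C) ^+ 2)%:E <= (r / 3)%:E)%E.
  apply: (@le_trans _ _ (2%:E * (r / 6)%:E)%E); last by rewrite -EFinM lee_fin; lra.
  by rewrite expr1n mulr1; apply: lee_pmul; [by rewrite lee_fin|by apply: integral_ge0 => x _; rewrite lee_fin sqr_ge0|by []|exact: ltW].
have h2' : \int[leb]_x (normc (simple_fun (s k) x) ^+ 2) <= r / 3 + 2 * \int[P]_w (Y w ^+ 2).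
  rewrite -lee_fin; apply: (le_trans h2).
  apply: (@le_trans _ _ ((r / 3)%:E + 2%:E * (\int[P]_w (Y w ^+ 2)%R)%:E)%E); first exact: leeD.
  by rewrite -EFinM -EFinD.
apply: (@le_trans _ _ ((r / 3)%:E + (2 * (r / 3 + 2 * \int[P]_w (Y w ^+ 2)))%:E)%E).
  apply: leeD => //; rewrite -EFinM lee_fin; exact: ler_wpM2l.
by rewrite -!EFinD lee_fin; lra.
Qed.

(** The real part of a simple integral is a finite real combination of the Re M(A) and Im M(A),
    hence Gaussian; Y being real, it is at least as close to Y as the complex integral. *)
Lemma wiener_approx f Y : wiener f Y -> exists I : nat -> T -> R,
  (forall k, centered_gaussian P (I k)) /\
  (forall k, P.-integrable setT (EFin \o (fun w => I k w ^+ 2))) /\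
  (forall e : R, 0 < e -> exists k, \int[P]_w ((I k w - Y w) ^+ 2) < e).
Proof.
move=> [mf mY [s [fs c e]]]; rewrite unlock in e.
pose I k w := Re (simple_integral M (s k) w); exists I; split; last split.
- move=> k; pose m := size (s k).
  pose A (i : 'I_m) := (nth (0, set0) (s k) i).2.
  pose a (i : 'I_m) := Re (nth (0, set0) (s k) i).1.
  pose b (i : 'I_m) := - Im (nth (0, set0) (s k) i).1.
  have fA i : finite_borel (A i) by apply: (fs k); exact: mem_nth.
  rewrite (_ : I k = fun w => \sum_(i < m) (a i * Re (M (A i) w) + b i * Im (M (A i) w))).
    exact: (grm_gaussian hM a b fA).
  apply/funext => w; rewrite /I /simple_integral Re_sum (big_nth (0, set0)) big_mkord.
  by apply: eq_bigr => i _; rewrite cReM mulNr.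
- move=> k; have [mI _] := cmeasurable_simple_integral (fs k).
  apply: integrable_le (integrable_simple_integral hM (fs k)).
    exact: measurable_funX.
  by move=> w; rewrite normc2E ger0_norm ?sqr_ge0// lerDl sqr_ge0.
- move=> r r0; have [k _ /(_ k (leqnn k)) ek] := cvge0_lt e r0; exists k.
  have cI := cmeasurable_simple_integral (fs k).
  have Di : P.-integrable setT (EFin \o (fun w => normc (simple_integral M (s k) w - (Y w)%:C%C) ^+ 2)).
    apply: ge0_integrable; last exact: (lt_trans ek (ltry _)).
    - by apply: measurable_normc2; apply: cmeasurableB => //; exact: cmeasurable_real.
    - by move=> w; exact: sqr_ge0.
  have le2 w : (I k w - Y w) ^+ 2 <= normc (simple_integral M (s k) w - (Y w)%:C%C) ^+ 2.
    by rewrite normc2E cReD cReN /= lerDl sqr_ge0.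
  apply: (@le_lt_trans _ _ (\int[P]_w (normc (simple_integral M (s k) w - (Y w)%:C%C) ^+ 2))).
    apply: le_Rintegral => //.
    apply: integrable_le Di; last by move=> w; rewrite ger0_norm ?sqr_ge0.
    by apply: measurable_funX; apply: measurable_funB => //; case: cI.
  by rewrite -lte_fin EFin_Rintegral.
Qed.

End stochastic_integral.

(** * Gaussian characteristic functions *)

Section density.
Local Open Scope ereal_scope.
Context d (T : measurableType d) {R : realType}.
Variables (mu nu : {measure set T -> \bar R}) (g : T -> R).
Hypothesis mg : measurable_fun setT g.
Hypothesis g0 : forall x, (0 <= g x)%R.
Hypothesis nuE : forall A, measurable A -> nu A = \int[mu]_(x in A) (g x)%:E.

Import HBNNSimple.

Let density_nnsfun (h : {nnsfun T >-> R}) :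
  \int[nu]_x (h x)%:E = \int[mu]_x ((h x)%:E * (g x)%:E).
Proof.
have mh r : measurable (h @^-1` [set r]) by exact: measurable_sfunP.
have mgE : measurable_fun setT (fun x => (g x)%:E) by exact/measurable_EFinP.
transitivity (\sum_(r \in range h) (r%:E * nu (h @^-1` [set r]))).
  by rewrite integralT_nnsfun sintegralE.
under [RHS]eq_integral => x _.
  rewrite fimfunE -fsumEFin// ge0_mule_fsuml => [|r]; last exact: nnfun_muleindic_ge0.
  over.
rewrite ge0_integral_fsum//; last 2 first.
- move=> r; apply: emeasurable_funM => //; apply/measurable_EFinP.
  by apply: measurable_funM => //; exact: measurable_indic.
- by move=> r x _; apply: mule_ge0; [exact: nnfun_muleindic_ge0|rewrite lee_fin].
apply: eq_fsbigr => r; rewrite inE => -[x _ rx].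
have r0 : (0 <= r)%R by rewrite -rx.
under [RHS]eq_integral do rewrite EFinM -muleA.
rewrite ge0_integralZl//; last 2 first.
- by apply: emeasurable_funM => //; apply/measurable_EFinP; exact: measurable_indic.
- by move=> y _; rewrite mule_ge0// lee_fin// indicE.
congr (_ * _); rewrite nuE// integral_mkcond; apply: eq_integral => y _.
by rewrite patchE indicE; case: ifPn => _; rewrite ?mul1e ?mul0e.
Qed.

Lemma ge0_integral_density (f : T -> \bar R) : measurable_fun setT f -> (forall x, 0 <= f x) ->
  \int[nu]_x f x = \int[mu]_x (f x * (g x)%:E).
Proof.
move=> mf f0; pose h := nnsfun_approx measurableT mf.
have mgE : measurable_fun setT (fun x => (g x)%:E) by exact/measurable_EFinP.
have hf x : (h n x)%:E @[n --> \oo] --> f x.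
  by apply: cvg_nnsfun_approx => //.
have ndh x : {homo (fun n => h n x) : m n / (m <= n)%N >-> (m <= n)%R}.
  by move=> m n mn; exact/lefP/nd_nnsfun_approx.
transitivity (limn (fun n => \int[nu]_x (h n x)%:E)).
  rewrite -monotone_convergence//.
  - by apply: eq_integral => x _; apply/esym/cvg_lim => //; exact: hf.
  - by move=> n; exact/measurable_EFinP.
  - by move=> n x _; rewrite lee_fin.
  - by move=> x _ m n mn; rewrite lee_fin; exact: ndh.
under eq_fun do rewrite density_nnsfun.
rewrite -(monotone_convergence mu measurableT (g' := fun n x => (h n x)%:E * (g x)%:E)).
- by apply: eq_integral => x _; apply/cvg_lim => //; apply: cvgeZr.
- by move=> n; apply: emeasurable_funM => //; exact/measurable_EFinP.
- by move=> n x _; rewrite mule_ge0 ?lee_fin.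
- by move=> x _ m n mn; rewrite lee_wpmul2r ?lee_fin//; exact: ndh.
Qed.

End density.

Section gaussian_law.
Context {R : realType}.
Local Notation mu := (@lebesgue_measure R).
Implicit Types (x s t c : R).

Definition gauss_pdf (x : R) : R := normal_pdf 0 1 x.

Lemma gauss_pdfE x : gauss_pdf x = normal_peak 1 * expR (- (x ^+ 2) / 2).
Proof.
by rewrite /gauss_pdf normal_pdfE ?oner_eq0// /normal_fun subr0 expr1n.
Qed.

Lemma measurable_gauss_pdf : measurable_fun setT gauss_pdf.
Proof. exact: measurable_normal_pdf. Qed.

Lemma gauss_pdf_ge0 x : 0 <= gauss_pdf x.
Proof. exact: normal_pdf_ge0. Qed.

Lemma gauss_pdfN x : gauss_pdf (- x) = gauss_pdf x.
Proof. by rewrite !gauss_pdfE sqrrN. Qed.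

Lemma integrable_gauss_pdf : mu.-integrable setT (EFin \o gauss_pdf).
Proof. exact: integrable_normal_pdf. Qed.

Lemma integral_gauss_pdf : \int[mu]_x gauss_pdf x = 1.
Proof. by rewrite /Rintegral integral_normal_pdf. Qed.

Lemma normal_pdf_scale s x : s != 0 -> `|s| * normal_pdf 0 s (s * x) = gauss_pdf x.
Proof.
move=> s0; rewrite gauss_pdfE normal_pdfE// /normal_fun subr0 mulrA; congr (_ * expR _).
  rewrite /normal_peak -mulrnAr sqrtrM ?sqr_ge0// sqrtr_sqr invfM mulrA divff ?normr_eq0//.
  by rewrite mul1r expr1n mul1r.
by rewrite exprMn; field.
Qed.

Lemma ge0_integral_normal s (f : R -> \bar R) : s != 0 ->
  measurable_fun setT f -> (forall x, 0 <= f x)%E ->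
  (\int[normal_prob 0 s]_x f x = \int[mu]_x (f (s * x)%R * (gauss_pdf x)%:E))%E.
Proof.
move=> s0 mf f0.
have -> : (\int[normal_prob 0 s]_x f x = \int[mu]_x (f x * (normal_pdf 0 s x)%:E))%E.
  exact: (@ge0_integral_density _ _ _ mu (normal_prob 0 s) (normal_pdf 0 s)
    (measurable_normal_pdf 0 s) (normal_pdf_ge0 0 s) (fun A _ => erefl) f mf f0).
have mfp : measurable_fun setT (fun x => f x * (normal_pdf 0 s x)%:E)%E.
  by apply: emeasurable_funM => //; apply/measurable_EFinP; exact: measurable_normal_pdf.
rewrite -(@ge0_integral_affine _ s 0 s0 (fun x => f x * (normal_pdf 0 s x)%:E)%E)//; last first.
  by move=> x; rewrite mule_ge0// lee_fin normal_pdf_ge0.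
rewrite -ge0_integralZl//; last 2 first.
- by apply: (measurableT_comp mfp); exact: measurable_affine.
- by move=> x _; rewrite mule_ge0// lee_fin normal_pdf_ge0.
by apply: eq_integral => x _; rewrite addr0 muleCA -EFinM normal_pdf_scale.
Qed.

End gaussian_law.

Section gaussian_characteristic_function.
Context {R : realType}.
Local Notation mu := (@lebesgue_measure R).
Implicit Types (x s t c : R).

Lemma normr_cosB_le x y : `|cos x - cos y| <= `|x - y|.
Proof.
have -> : cos x - cos y = - (sin ((x - y) / 2) * sin ((x + y) / 2) * 2).
  set p := (x + y) / 2; set q := (x - y) / 2.
  have -> : x = p + q by rewrite /p /q; field.
  have -> : y = p - q by rewrite /p /q; field.
  by rewrite cosD cosB; ring.
rewrite normrN !normrM (ger0_norm (ler0n _ 2)).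
have h1 := normr_sin_le ((x - y) / 2); have h2 := normr_sin_le1 ((x + y) / 2).
have -> : `|x - y| = `|(x - y) / 2| * 2.
  by rewrite normrM (ger0_norm (_ : 0 <= 2^-1))// mulfVK.
rewrite ler_pM2r//; apply: (le_trans _ h1).
by rewrite -[leRHS]mulr1 ler_wpM2l.
Qed.

Lemma cosD1_ge0 x : 0 <= 1 + cos x.
Proof. by have := cos_geN1 x; lra. Qed.

(** The characteristic function of the standard Gaussian law, kept as an integral; it enters through
    its evenness, a Lipschitz bound and the product rule [gauss_charM]. *)
Definition gauss_char s : R := \int[mu]_x (cos (s * x) * gauss_pdf x).

Definition gauss_moment2 : R := \int[mu]_x (x ^+ 2 * gauss_pdf x).

Lemma gauss_char0 : gauss_char 0 = 1.
Proof.
rewrite /gauss_char -integral_gauss_pdf; apply: eq_Rintegral => x _.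
by rewrite mul0r cos0 mul1r.
Qed.

Lemma gauss_charN s : gauss_char (- s) = gauss_char s.
Proof. by rewrite /gauss_char; apply: eq_Rintegral => x _; rewrite mulNr cosN. Qed.

Lemma gauss_char_norm s : gauss_char `|s| = gauss_char s.
Proof. by have [_|_] := ger0P s => //; rewrite gauss_charN. Qed.

(** Since x^2 <= 4 exp (x^2 / 4), the integrand is dominated by a multiple of the Gaussian density
    of variance 2. *)
Lemma integrable_gauss_moment2 : mu.-integrable setT (EFin \o (fun x => x ^+ 2 * gauss_pdf x)).
Proof.
have s20 : Num.sqrt 2 != 0 :> R by rewrite gt_eqF// sqrtr_gt0.
have H := integrableZlr (4 * normal_peak 1 / normal_peak (Num.sqrt 2)) (integrable_normal_pdf (0 : R) (Num.sqrt 2)).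
apply: integrable_le H.
  by apply: measurable_funM => //; exact: measurable_gauss_pdf.
move=> x; rewrite ger0_norm; last by apply: mulr_ge0; [exact: sqr_ge0|exact: gauss_pdf_ge0].
rewrite gauss_pdfE normal_pdfE// /normal_fun subr0 sqr_sqrtr//.
have p1 : 0 < normal_peak (1 : R) by exact: normal_peak_gt0 (oner_neq0 _).
have p2 := normal_peak_gt0 s20.
rewrite [leRHS](_ : _ = normal_peak 1 * (4 * expR (- (x ^+ 2 / 4)))); last first.
  rewrite (_ : - x ^+ 2 / (2 *+ 2) = - (x ^+ 2 / 4)); last by rewrite mulNr -mulr_natl -natrM.
  by field; rewrite gt_eqF.
rewrite mulrCA ler_pM2l// (_ : - x ^+ 2 / 2 = - (x ^+ 2 / 4) + - (x ^+ 2 / 4)); last by field.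
rewrite expRD mulrA ler_pM2r ?expR_gt0// mulrC.
rewrite expRN ler_pdivrMl ?expR_gt0//.
have := expR_ge1Dx (x ^+ 2 / 4).
by lra.
Qed.

Lemma gauss_moment2_gt0 : 0 < gauss_moment2.
Proof.
apply: integral_gt0.
- by apply: measurable_funM => //; exact: measurable_gauss_pdf.
- by move=> x; apply: mulr_ge0; [exact: sqr_ge0|exact: gauss_pdf_ge0].
- move=> x /andP[x0 _]; rewrite mulr_gt0 ?exprn_gt0// gauss_pdfE mulr_gt0 ?expR_gt0//.
  exact: normal_peak_gt0 (oner_neq0 _).
- exact: integrable_gauss_moment2.
Qed.

Lemma integrable_cos_gauss s c :
  mu.-integrable setT (EFin \o (fun x => cos (s * x + c) * gauss_pdf x)).
Proof.
exact: (@integrableMbounded _ _ _ mu _ _ 1 (measurable_cosM s c) (fun x => normr_cos_le1 _)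
  integrable_gauss_pdf).
Qed.

Lemma gauss_char_lipschitz : exists2 K : R, 0 <= K &
  forall s t, `|gauss_char s - gauss_char t| <= K * `|s - t|.
Proof.
have Hi := integrableDr integrable_gauss_pdf integrable_gauss_moment2.
exists (\int[mu]_x (gauss_pdf x + x ^+ 2 * gauss_pdf x)).
  by apply: Rintegral_ge0 => x _; rewrite -[X in X + _]mul1r -mulrDl mulr_ge0 ?gauss_pdf_ge0// addr_ge0// sqr_ge0.
have ic s : mu.-integrable setT (EFin \o (fun x => cos (s * x) * gauss_pdf x)).
  by have := integrable_cos_gauss s 0; under eq_fun do rewrite addr0.
move=> s t; rewrite /gauss_char -(RintegralB measurableT (ic s) (ic t)).
apply: (le_trans (le_normr_Rintegral measurableT (integrableBr (ic s) (ic t)))).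
rewrite mulrC -(RintegralZl _ measurableT Hi).
apply: le_Rintegral => //.
- exact: (integrable_norm (integrableBr (ic s) (ic t))).
- exact: integrableZlr.
move=> x _; rewrite -mulrBl normrM (ger0_norm (gauss_pdf_ge0 x)).
rewrite -[X in _ * (X + _)]mul1r -mulrDl mulrA ler_wpM2r ?gauss_pdf_ge0//.
apply: (le_trans (normr_cosB_le _ _)); rewrite -mulrBl normrM ler_wpM2l//.
by rewrite -[x ^+ 2]real_normK ?num_real//; have := normr_ge0 x; nra.
Qed.

Lemma prodfun_gauss2 (x : 'cV[R]_2) : prodfun gauss_pdf x =
  normal_peak 1 ^+ 2 * expR (- (x 0 0 ^+ 2 + x 1 0 ^+ 2) / 2).
Proof.
rewrite /prodfun !big_ord_recl big_ord0 mulr1 !gauss_pdfE.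
have -> : lift ord0 ord0 = 1 :> 'I_2 by exact: val_inj.
by rewrite mulrACA -expr2 -expRD; congr (_ * expR _); field.
Qed.

Lemma integrable_cos_prodfun n (h : R -> R) (v : 'cV[R]_n) c :
  mu.-integrable setT (EFin \o h) ->
  (lebesgue_cV n).-integrable setT (EFin \o (fun x : 'cV[R]_n => cos (inner v x + c) * prodfun h x)).
Proof.
move=> hi; apply: (@integrableMbounded _ _ _ _ _ _ 1 (measurable_cos_inner v c)).
- by move=> x; exact: normr_cos_le1.
- exact: integrable_prodfun.
Qed.

(* The planar standard Gaussian density is invariant under the rotation that
   sends the direction (s, t) to the first axis. *)
Lemma gauss_charM s t : gauss_char s * gauss_char t = gauss_char (Num.sqrt (s ^+ 2 + t ^+ 2)).
Proof.
set r := Num.sqrt _.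
have r2 : r ^+ 2 = s ^+ 2 + t ^+ 2 by rewrite sqr_sqrtr// addr_ge0 ?sqr_ge0.
have [r0|r0] := eqVneq r 0.
  move: r2; rewrite r0 expr0n /= => /esym/eqP.
  by rewrite paddr_eq0 ?sqr_ge0// !sqrf_eq0 => /andP[/eqP -> /eqP ->]; rewrite gauss_char0 mulr1.
pose v a b : 'cV[R]_2 := \col_i (if i == 0 then a else b).
have vE a b : gauss_char a * gauss_char b =
    \int[lebesgue_cV 2]_x (cos (inner (v a b) x + 0) * prodfun gauss_pdf x).
  rewrite Rintegral_cos_prodfun; [|exact: integrable_gauss_pdf|exact: gauss_pdfN].
  by rewrite cos0 mul1r !big_ord_recl big_ord0 mulr1 !mxE.
rewrite -[RHS]mulr1 -gauss_char0 !vE.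
pose A : 'M[R]_2 := r^-1 *: \matrix_(i, j) (if i == 0 then v s t else v (- t) s) j 0.
have A0 (x : 'cV[R]_2) : (A *m x) 0 0 = r^-1 * (s * x 0 0 + t * x 1 0).
  rewrite -scalemxAl !mxE !big_ord_recl big_ord0 addr0 !mxE /=; congr (_ * (_ + _ * x _ _)).
  exact: val_inj.
have A1 (x : 'cV[R]_2) : (A *m x) 1 0 = r^-1 * (- t * x 0 0 + s * x 1 0).
  rewrite -scalemxAl !mxE !big_ord_recl big_ord0 addr0 !mxE /=; congr (_ * (_ + _ * x _ _)).
  exact: val_inj.
have detA : \det A = 1.
  rewrite detZ (expand_det_row _ ord0) !big_ord_recl big_ord0 addr0 /cofactor !det_mx11 !mxE /=.
  by rewrite expr0 mul1r /bump /= addn0 expr1 mulN1r opprK -!expr2 -r2 -exprMn mulVf// expr1n.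
have innA (x : 'cV[R]_2) : inner (v r 0) (A *m x) = inner (v s t) x.
  rewrite !innerE !big_ord_recl !big_ord0 !addr0 A0 !mxE /= mul0r addr0 mulVKf//.
  by congr (_ + _ * x _ _); exact: val_inj.
have pA (x : 'cV[R]_2) : prodfun gauss_pdf (A *m x) = prodfun gauss_pdf x.
  rewrite !prodfun_gauss2 A0 A1; congr (_ * expR (- _ / 2)).
  rewrite !exprMn -mulrDr exprVn -[RHS](mulKf (expf_neq0 2 r0)) r2; congr (_ * _).
  by ring.
(* The substitution rule is stated for nonnegative functions: it is applied to 1 + cos, and the
   common integral of the density is cancelled afterwards. *)
have intE a b : (\int[lebesgue_cV 2]_x ((1 + cos (inner (v a b) x + 0)) * prodfun gauss_pdf x)%:E =
   (\int[lebesgue_cV 2]_x prodfun gauss_pdf x +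
    \int[lebesgue_cV 2]_x (cos (inner (v a b) x + 0) * prodfun gauss_pdf x))%:E)%E.
  have i1 := integrable_prodfun 2 (@integrable_gauss_pdf R).
  have i2 := integrable_cos_prodfun (v a b) 0 (@integrable_gauss_pdf R).
  rewrite -(RintegralD measurableT i1 i2) EFin_Rintegral; last exact: (integrableDr i1 i2).
  by apply: eq_integral => x _; rewrite mulrDl mul1r.
have covA : linear_cov A by apply: unitmx_linear_cov; rewrite detA oner_neq0.
have := covA (fun x : 'cV[R]_2 => ((1 + cos (inner (v r 0) x + 0)) * prodfun gauss_pdf x)%:E).
rewrite detA normr1 mul1e; under eq_integral do rewrite innA pA.
rewrite !intE => H.
apply: addrI; apply: (@EFin_inj R); apply: H.
  apply/measurable_EFinP; apply: measurable_funM; last first.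
    by apply: measurable_prodfun; exact: measurable_gauss_pdf.
  by apply: measurable_funD => //; exact: measurable_cos_inner.
move=> x; rewrite lee_fin; apply: mulr_ge0; first exact: cosD1_ge0.
by apply: prodr_ge0 => i _; exact: gauss_pdf_ge0.
Qed.

End gaussian_characteristic_function.

(** * Moments and characteristic function of a Gaussian variable *)

Section gaussian_variable.
Context {d : measure_display} {T : measurableType d} {R : realType}.
Variable P : probability T R.
Local Notation mu := (@lebesgue_measure R).

(** W has the law of s times a standard variable. The formula includes s = 0, where f (0) is
    multiplied by the total mass 1 of the density. *)
Lemma centered_gaussian_ge0_integral (W : T -> R) : centered_gaussian P W ->
  exists s : R, forall f : R -> \bar R, measurable_fun setT f -> (forall x, 0 <= f x)%E ->
    (\int[P]_w f (W w) = \int[mu]_x (f (s * x)%R * (gauss_pdf x)%:E))%E.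
Proof.
move=> [mW [s sP]]; exists s => f mf f0.
have mW' : measurable_fun setT (W : T -> measurableTypeR R) := mW.
pose nu : {measure set (measurableTypeR R) -> \bar R} :=
  measure_function_pushforward__canonical__measure_function_Measure P mW'.
have -> : (\int[P]_w f (W w) = \int[nu]_x f x)%E.
  by rewrite (ge0_integral_pushforward mW').
have [s0|s0] := eqVneq s 0; last first.
  rewrite -ge0_integral_normal//.
  apply: (@eq_measure_integral _ _ _ setT (normal_prob 0 s) nu) => A mA _.
  by have := sP A mA; rewrite (negbTE s0).
transitivity (\int[\d_((0 : R)%R : measurableTypeR R)]_x f x)%E.
  apply: (@eq_measure_integral _ _ _ setT (\d_((0 : R)%R : measurableTypeR R)) nu) => A mA _.
  by have := sP A mA; rewrite s0 eqxx.
rewrite integral_dirac// diracT mul1e s0.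
under eq_integral do rewrite mul0r.
rewrite ge0_integralZl//; last 2 first.
- by apply/measurable_EFinP; exact: measurable_gauss_pdf.
- by move=> x _; rewrite lee_fin gauss_pdf_ge0.
by rewrite -(EFin_Rintegral (integrable_gauss_pdf (R := R))) integral_gauss_pdf mule1.
Qed.

Lemma integrable_cos_rv (Y : T -> R) (c : R) : measurable_fun setT Y ->
  P.-integrable setT (EFin \o (fun w => cos (Y w + c))).
Proof.
move=> mY; apply: (@measurable_bounded_integrable _ _ _ P) => //.
- exact: (le_lt_trans (probability_le1 P measurableT) (ltry _)).
- apply: measurableT_comp; first exact: measurable_cos.
  exact: measurable_funD.
- exists 1; split; first exact: num_real.
  by move=> z z1 x _ /=; rewrite (le_trans (normr_cos_le1 _))// ltW.
Qed.

Lemma integrable_cst_rv (c : R) : P.-integrable setT (EFin \o (fun=> c : R)).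
Proof. exact: finite_measure_integrable_cst. Qed.

Lemma Rintegral_cst_rv (c : R) : \int[P]_(w in setT) c = c.
Proof.
rewrite /Rintegral integral_cst//.
transitivity (fine (c%:E * 1)); last by rewrite mule1.
by congr (fine (_ * _)%E); exact: probability_setT.
Qed.

Lemma centered_gaussian_char (W : T -> R) : centered_gaussian P W -> exists s : R,
  (forall c, \int[P]_w cos (W w + c) = cos c * gauss_char s) /\
  \int[P]_w (W w ^+ 2) = s ^+ 2 * gauss_moment2.
Proof.
move=> gW; have [s sP] := centered_gaussian_ge0_integral gW; case: gW => mW _.
exists s; split => [c|]; last first.
  rewrite -(RintegralZl _ measurableT (@integrable_gauss_moment2 R)).
  rewrite /Rintegral (sP (fun x => (x ^+ 2)%:E))//; last 2 first.
  - by apply/measurable_EFinP; exact: exprn_measurable.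
  - by move=> x; rewrite lee_fin sqr_ge0.
  by congr fine; apply: eq_integral => x _; rewrite -EFinM exprMn mulrA.
(* Adding 1 makes the integrand nonnegative, as the formula for the law requires. *)
apply: (@addrI _ 1); rewrite -[X in X + _](Rintegral_cst_rv 1).
have i1 := integrable_cst_rv 1; have i2 := integrable_cos_rv c mW.
rewrite -(RintegralD measurableT i1 i2).
rewrite /gauss_char -(Rintegral_cos_even _ _ (@integrable_gauss_pdf R) (@gauss_pdfN R)).
rewrite -[X in X + _]integral_gauss_pdf.
rewrite -(RintegralD measurableT (@integrable_gauss_pdf R) (integrable_cos_gauss s c)).
rewrite /Rintegral (sP (fun x => (1 + cos (x + c))%:E))//.
- by congr fine; apply: eq_integral => x _; rewrite -EFinM mulrDl mul1r.
- apply/measurable_EFinP; apply: measurable_funD => //.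
  apply: measurableT_comp; first exact: measurable_cos.
  exact: measurable_funD.
Qed.

End gaussian_variable.

Section square_integrable.
Context {d : measure_display} {T : measurableType d} {R : realType}.
Variable mu : {measure set T -> \bar R}.
Implicit Types f g : T -> R.

Lemma integrable_mul_sqr f g : measurable_fun setT f -> measurable_fun setT g ->
  mu.-integrable setT (EFin \o (fun x => f x ^+ 2)) ->
  mu.-integrable setT (EFin \o (fun x => g x ^+ 2)) ->
  mu.-integrable setT (EFin \o (fun x => f x * g x)).
Proof.
move=> mf mg fi gi; apply: integrable_le (integrableDr fi gi).
  exact: measurable_funM.
move=> x; rewrite ler_norml; apply/andP; split.
  by have := sqr_ge0 (f x + g x); have := sqr_ge0 (f x - g x); nra.
by have := sqr_ge0 (f x - g x); have := sqr_ge0 (f x + g x); nra.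
Qed.

Lemma Rintegral_sqrD f g (a : R) : measurable_fun setT f -> measurable_fun setT g ->
  mu.-integrable setT (EFin \o (fun x => f x ^+ 2)) ->
  mu.-integrable setT (EFin \o (fun x => g x ^+ 2)) ->
  \int[mu]_x ((f x + a * g x) ^+ 2) =
  \int[mu]_x (f x ^+ 2) + 2 * a * \int[mu]_x (f x * g x) + a ^+ 2 * \int[mu]_x (g x ^+ 2).
Proof.
move=> mf mg fi gi; have fgi := integrable_mul_sqr mf mg fi gi.
have i1 := integrableZlr (2 * a) fgi; have i2 := integrableZlr (a ^+ 2) gi.
rewrite -(RintegralZl _ measurableT fgi) -(RintegralZl _ measurableT gi).
rewrite -(RintegralD measurableT fi i1) -(RintegralD measurableT (integrableDr fi i1) i2).
by apply: eq_Rintegral => x _; ring.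
Qed.

Lemma integrable_sqrD f g (a : R) : measurable_fun setT f -> measurable_fun setT g ->
  mu.-integrable setT (EFin \o (fun x => f x ^+ 2)) ->
  mu.-integrable setT (EFin \o (fun x => g x ^+ 2)) ->
  mu.-integrable setT (EFin \o (fun x => (f x + a * g x) ^+ 2)).
Proof.
move=> mf mg fi gi; have fgi := integrable_mul_sqr mf mg fi gi.
have := integrableDr (integrableDr fi (integrableZlr (2 * a) fgi)) (integrableZlr (a ^+ 2) gi).
by apply: eq_integrable => // x _ /=; congr EFin; ring.
Qed.

Lemma Rintegral_cauchy_schwarz f g : measurable_fun setT f -> measurable_fun setT g ->
  mu.-integrable setT (EFin \o (fun x => f x ^+ 2)) ->
  mu.-integrable setT (EFin \o (fun x => g x ^+ 2)) ->
  (\int[mu]_x (f x * g x)) ^+ 2 <= \int[mu]_x (f x ^+ 2) * \int[mu]_x (g x ^+ 2).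
Proof.
move=> mf mg fi gi.
have H (a : R) : 0 <= \int[mu]_x (f x ^+ 2) + 2 * a * \int[mu]_x (f x * g x)
    + a ^+ 2 * \int[mu]_x (g x ^+ 2).
  by rewrite -(Rintegral_sqrD a mf mg fi gi); apply: Rintegral_ge0 => x _; exact: sqr_ge0.
have : 0 <= \int[mu]_x (g x ^+ 2) by apply: Rintegral_ge0 => x _; exact: sqr_ge0.
move: H; set A := \int[mu]_x (f x ^+ 2); set B := \int[mu]_x (g x ^+ 2).
set C := \int[mu]_x (f x * g x) => H.
rewrite le_eqVlt => /predU1P[B0|B0]; last first.
  have h := mulr_ge0 (H (- C / B)) (ltW B0).
  have e : (A + 2 * (- C / B) * C + (- C / B) ^+ 2 * B) * B = A * B - C ^+ 2.
    by field; rewrite gt_eqF.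
  by rewrite e in h; lra.
(* When g is null in L^2 the quadratic form is affine in a, and it stays nonnegative only if its
   slope is zero. *)
rewrite -B0 mulr0; suff -> : C = 0 by rewrite expr0n.
apply/eqP; apply/negPn/negP => C0.
have := H (- (A + 1) / (2 * C)); rewrite -B0 mulr0 addr0.
have -> : 2 * (- (A + 1) / (2 * C)) * C = - (A + 1) by field.
by lra.
Qed.

(** The reverse triangle inequality of L^2: standard deviations are continuous for the L^2
    distance. *)
Lemma sqrt_Rintegral_dist f g : measurable_fun setT f -> measurable_fun setT g ->
  mu.-integrable setT (EFin \o (fun x => f x ^+ 2)) ->
  mu.-integrable setT (EFin \o (fun x => g x ^+ 2)) ->
  (Num.sqrt (\int[mu]_x (f x ^+ 2)) - Num.sqrt (\int[mu]_x (g x ^+ 2))) ^+ 2 <=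
  \int[mu]_x ((f x - g x) ^+ 2).
Proof.
move=> mf mg fi gi; have CS := Rintegral_cauchy_schwarz mf mg fi gi.
have A0 : 0 <= \int[mu]_x (f x ^+ 2) by apply: Rintegral_ge0 => x _; exact: sqr_ge0.
have B0 : 0 <= \int[mu]_x (g x ^+ 2) by apply: Rintegral_ge0 => x _; exact: sqr_ge0.
have -> : \int[mu]_x ((f x - g x) ^+ 2) = \int[mu]_x ((f x + (-1) * g x) ^+ 2).
  by apply: eq_Rintegral => x _; rewrite mulN1r.
rewrite (Rintegral_sqrD (-1) mf mg fi gi) sqrrB !sqr_sqrtr// -sqrtrM//.
have : \int[mu]_x (f x * g x) <= Num.sqrt (\int[mu]_x (f x ^+ 2) * \int[mu]_x (g x ^+ 2)).
  by apply: (le_trans (ler_norm _)); rewrite -sqrtr_sqr ler_wsqrtr.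
rewrite sqrrN expr1n mul1r mulrN1 -mulr_natl; lra.
Qed.

End square_integrable.

(** * Stochastic integrals are Gaussian *)

Section wiener_law.
Context {d : measure_display} {T : measurableType d} {R : realType}.
Variables (P : probability T R) (N : nat) (M : set 'cV[R]_N -> T -> R[i]).
Hypothesis hM : gaussian_random_measure P M.

(** The value at 1 of the characteristic function of a centered Gaussian law of variance v; the
    product rule becomes multiplicativity in v. *)
Definition variance_char (v : R) : R := gauss_char (Num.sqrt (v / gauss_moment2)).

Lemma variance_charD (a b : R) : 0 <= a -> 0 <= b ->
  variance_char (a + b) = variance_char a * variance_char b.
Proof.
move=> a0 b0; have m0 := ltW (@gauss_moment2_gt0 R).
by rewrite /variance_char gauss_charM !sqr_sqrtr ?divr_ge0// mulrDl.
Qed.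

(** The formula holds for Gaussian approximations of Y in L^2(P), and both sides are continuous for
    the L^2 distance. *)
Lemma wiener_cos f Y c : wiener P M f Y ->
  \int[P]_w cos (Y w + c) = cos c * variance_char (\int[P]_w (Y w ^+ 2)).
Proof.
move=> fY; have Yi := wiener_sqr_integrable hM fY.
have [I [gI [Ii IY]]] := wiener_approx hM fY; have [_ mY _] := fY.
have m0 := @gauss_moment2_gt0 R.
have [K K0 Klip] := @gauss_char_lipschitz R.
set L := LHS; set r := RHS.
pose s0 : R := Num.sqrt gauss_moment2.
have s00 : 0 < s0 by rewrite sqrtr_gt0.
suff H e : 0 < e -> `|L - r| <= (1 + K / s0) * e.
  apply/eqP; rewrite -subr_eq0 -normr_le0; apply/ler_addgt0Pr => e e0.
  have c0 : 0 < 1 + K / s0 by rewrite ltr_wpDr// divr_ge0// ltW.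
  by rewrite add0r; have := H (e / (1 + K / s0)); rewrite divr_gt0// mulrC divfK ?gt_eqF//; exact.
move=> e0; have [k Ik] := IY (e ^+ 2) (exprn_gt0 2 e0).
have mI : measurable_fun setT (I k) by case: (gI k).
have [s [Ic I2]] := centered_gaussian_char (gI k).
have Di : P.-integrable setT (EFin \o (fun w => (I k w - Y w) ^+ 2)).
  have := integrable_sqrD (-1) mI mY (Ii k) Yi.
  by apply: eq_integrable => // w _ /=; rewrite mulN1r.
(* The cosine is 1-Lipschitz, and |D| <= e / 2 + D^2 / (2 e) turns the L^2 bound e^2 into the bound
   e. *)
have h1 : `|L - cos c * gauss_char s| <= e.
  rewrite -Ic -(RintegralB measurableT (integrable_cos_rv P c mY) (integrable_cos_rv P c mI)).
  have cBi := integrableBr (integrable_cos_rv P c mY) (integrable_cos_rv P c mI).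
  apply: (le_trans (le_normr_Rintegral measurableT cBi)).
  have Ei := integrableDr (integrable_cst_rv P (e / 2)) (integrableZlr (2 * e)^-1 Di).
  apply: (@le_trans _ _ (\int[P]_w (e / 2 + (2 * e)^-1 * (I k w - Y w) ^+ 2))).
    apply: le_Rintegral => //; first exact: (integrable_norm cBi).
    move=> w _; apply: (le_trans (normr_cosB_le _ _)).
    rewrite (_ : Y w + c - (I k w + c) = - (I k w - Y w)); last by ring.
    rewrite normrN -[(I k w - Y w) ^+ 2]real_normK ?num_real//.
    rewrite -subr_ge0 (_ : _ - _ = (`|I k w - Y w| - e) ^+ 2 / (2 * e)).
      by rewrite divr_ge0 ?sqr_ge0// mulr_ge0// ltW.
    by field; rewrite gt_eqF.
  rewrite (RintegralD measurableT (integrable_cst_rv P (e / 2)) (integrableZlr (2 * e)^-1 Di)).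
  rewrite Rintegral_cst_rv (RintegralZl _ measurableT Di).
  rewrite [leRHS](_ : _ = e / 2 + (2 * e)^-1 * e ^+ 2); last by field; rewrite gt_eqF.
  by rewrite lerD2l ler_pM2l ?invr_gt0 ?mulr_gt0// ltW.
(* Here the scales are compared: [gauss_char] is K-Lipschitz, and scales times s0 are standard
   deviations, at distance at most e. *)
have h2 : `|cos c * gauss_char s - r| <= K / s0 * e.
  rewrite /r -mulrBr normrM; apply: (@le_trans _ _ (1 * (K / s0 * e))); last by rewrite mul1r.
  apply: ler_pM => //; first exact: normr_cos_le1.
  rewrite /variance_char -gauss_char_norm; apply: (le_trans (Klip _ _)).
  rewrite -mulrA ler_wpM2l// ler_pdivlMl//.
  have sE : `|s| * s0 = Num.sqrt (\int[P]_w (I k w ^+ 2)).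
    by rewrite I2 sqrtrM ?sqr_ge0// sqrtr_sqr.
  have vE : Num.sqrt (\int[P]_w (Y w ^+ 2) / gauss_moment2) * s0 = Num.sqrt (\int[P]_w (Y w ^+ 2)).
    rewrite -sqrtrM ?divfK ?gt_eqF// divr_ge0 ?(ltW m0)//.
    by apply: Rintegral_ge0 => w _; exact: sqr_ge0.
  rewrite -[X in X * _](gtr0_norm s00) mulrC -normrM mulrBl sE vE.
  rewrite -(ler_pXn2r (ltn0Sn 1)) ?nnegrE ?(ltW e0)//.
  rewrite real_normK ?num_real//.
  by apply: (le_trans (sqrt_Rintegral_dist mI mY (Ii k) Yi)); exact: ltW.
rewrite (_ : L - r = (L - cos c * gauss_char s) + (cos c * gauss_char s - r)); last by ring.
by rewrite (le_trans (ler_normD _ _))// mulrDl mul1r lerD.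
Qed.

End wiener_law.

(** * Uncorrelated Gaussian variables are independent *)

Section dominated.
Context {d : measure_display} {T : measurableType d} {R : realType}.
Variable mu : {measure set T -> \bar R}.

Lemma Rintegral0_eq (f : T -> R) : (forall x, f x = 0) -> \int[mu]_x f x = 0.
Proof. by move=> f0; rewrite /Rintegral integral0_eq// => x _; rewrite f0. Qed.

Lemma dominated_Rintegral_cvg (f : nat -> T -> R) (g h : T -> R) :
  (forall k, measurable_fun setT (f k)) -> (forall x, f k x @[k --> \oo] --> g x) ->
  mu.-integrable setT (EFin \o h) -> (forall k x, `|f k x| <= h x) ->
  mu.-integrable setT (EFin \o g) /\ \int[mu]_x f k x @[k --> \oo] --> \int[mu]_x g x.
Proof.
move=> mf fg hi fh.
have mg : measurable_fun setT g by apply: (measurable_fun_cvg mf) => x _; exact: fg.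
have fi k : mu.-integrable setT (EFin \o f k) by exact: integrable_le (mf k) (fh k) hi.
have fg' x : (f k x)%:E @[k --> \oo] --> (g x)%:E.
  by apply: cvg_EFin; [exact: nearW|exact: fg].
have [] := @dominated_convergence _ _ _ mu setT measurableT
  (fun k => EFin \o f k) (EFin \o g) (EFin \o h).
- by move=> k; exact/measurable_EFinP.
- exact/measurable_EFinP.
- by apply: aeW => x _; exact: fg'.
- exact: hi.
- by apply: aeW => x k _; rewrite /= lee_fin.
by move=> gi _ H; split => //; apply: fine_cvg; rewrite EFin_Rintegral.
Qed.

End dominated.

Section cos_annihilation.
Context {R : realType}.
Local Notation mu := (@lebesgue_measure R).

(** For small e > 0: the function rising on [a, a + e], equal to 1 up to b and falling on
    [b, b + e], with limit the indicator of ]a, b]. The four absolute values are those of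
    [Rintegral_sinsincos]. *)
Definition trapezoid (a b e y : R) : R :=
  (`|y - a| + `|y - (b + e)| - `|y - b| - `|y - (a + e)|) / (2 * e).

Lemma measurable_trapezoid a b e : measurable_fun setT (trapezoid a b e).
Proof.
have m c : measurable_fun setT (fun y : R => `|y - c|).
  by apply: measurableT_comp => //; exact: measurable_funB.
apply: measurable_funM => //; apply: measurable_funB => //; apply: measurable_funB => //.
exact: measurable_funD.
Qed.

Lemma normr_trapezoid_le1 a b e y : 0 < e -> `|trapezoid a b e y| <= 1.
Proof.
move=> e0; have e2 : 0 < 2 * e by rewrite mulr_gt0.
rewrite normrM [X in _ * X]gtr0_norm ?invr_gt0// ler_pdivrMr// mul1r.
have h1 := ler_dist_dist (y - a) (y - (a + e)).
have h2 := ler_dist_dist (y - (b + e)) (y - b).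
rewrite (_ : y - a - _ = e) in h1; last by ring.
rewrite (_ : _ - (y - b) = - e) in h2; last by ring.
rewrite normrN (gtr0_norm e0) in h2; rewrite (gtr0_norm e0) in h1.
move: h1 h2; rewrite !ler_norml => /andP[? ?] /andP[? ?]; apply/andP; split; lra.
Qed.

Lemma trapezoid_out a b e y : 0 < e -> a <= b -> (y <= a) || (b + e <= y) ->
  trapezoid a b e y = 0.
Proof.
move=> e0 ab /orP[ya|yb]; rewrite /trapezoid.
  by rewrite !ler0_norm; try lra; rewrite (_ : _ - _ = 0) ?mul0r//; ring.
by rewrite !ger0_norm; try lra; rewrite (_ : _ - _ = 0) ?mul0r//; ring.
Qed.

Lemma trapezoid_in a b e y : 0 < e -> a + e <= y <= b -> trapezoid a b e y = 1.
Proof.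
move=> e0 /andP[ya yb]; rewrite /trapezoid.
rewrite (@ger0_norm _ (y - a)); last by lra.
rewrite (@ger0_norm _ (y - (a + e))); last by lra.
rewrite (@ler0_norm _ (y - (b + e))); last by lra.
rewrite (@ler0_norm _ (y - b)); last by lra.
by field; rewrite gt_eqF.
Qed.

Lemma trapezoid_cvg a b y : a <= b ->
  trapezoid a b k.+1%:R^-1 y @[k --> \oo] --> (\1_`]a, b] y : R).
Proof.
move=> ab; have lt_inv (e : R) : 0 < e -> \forall k \near \oo, (k.+1%:R^-1 : R) < e.
  by move=> e0; exact: (near_infty_natSinv_lt (PosNum e0)).
have i0 (k : nat) : 0 < (k.+1%:R^-1 : R) by rewrite invr_gt0.
rewrite indicE; have [/set_mem|/negP yab] := boolP (y \in _).
  rewrite /= in_itv/= => /andP[ya yb]; apply: cvg_near_cst.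
  have : 0 < y - a by rewrite subr_gt0.
  move=> /lt_inv; apply: filterS => k ek; apply: trapezoid_in => //.
  by rewrite yb andbT -lerBrDl ltW.
apply: cvg_near_cst; have [ya|ya] := leP y a.
  by apply: nearW => k; apply: trapezoid_out => //; rewrite ya.
have yb : 0 < y - b.
  rewrite subr_gt0 ltNge; apply/negP => yb; apply: yab.
  by apply/mem_set; rewrite /= in_itv/= ya.
move: (lt_inv _ yb); apply: filterS => k ek; apply: trapezoid_out => //.
by rewrite -lerBrDl (ltW ek) orbT.
Qed.

(** The half-widths al and be and the centre m put the four kinks m +-al +-be at a, a + e, b and b +
    e. For e = 0 both sides are 0 by the convention on inverses. *)
Lemma trapezoidE a b e : exists s : R -> R, [/\ measurable_fun setT s,
  mu.-integrable setT (EFin \o s) &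
  exists m, forall y, trapezoid a b e y = \int[mu]_x (s x * cos (x * y + - (m * x)))].
Proof.
pose al := e / 2; pose be := (b - a) / 2; pose m := (a + b + e) / 2.
pose K := @versine_cst R / 4 * (2 * e).
pose s x : R := K^-1 * (sin (al * x) * sin (be * x) / x ^+ 2).
have si : mu.-integrable setT (EFin \o s).
  have := integrableZlr K^-1 (integrable_sinsincos al be 0).
  by apply: eq_integrable => // x _ /=; rewrite mul0r cos0 mulr1.
exists s; split => //; first exact: integrable_measurable si.
exists m => y; have := Rintegral_sinsincos al be (y - m).
have -> : y - m + al + be = y - a by rewrite /m /al /be; field.
have -> : y - m - al - be = y - (b + e) by rewrite /m /al /be; field.
have -> : y - m + al - be = y - b by rewrite /m /al /be; field.
have -> : y - m - al + be = y - (a + e) by rewrite /m /al /be; field.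
move=> H; transitivity (K^-1 * \int[mu]_x (sin (al * x) * sin (be * x) / x ^+ 2 * cos ((y - m) * x))).
  rewrite H /trapezoid /K; have [->|e0] := eqVneq e 0.
    by rewrite !mulr0 invr0 mulr0 mul0r.
  by field; rewrite e0 gt_eqF// versine_cst_gt0.
rewrite -(RintegralZl _ measurableT (integrable_sinsincos al be (y - m))).
apply: eq_Rintegral => x _; rewrite /s !mulrA; congr (_ * cos _); ring.
Qed.

Context {d : measure_display} {T : measurableType d}.
Variable P : {finite_measure set T -> \bar R}.

Lemma measurable_cos_rv (Y : T -> R) (c : R) : measurable_fun setT Y ->
  measurable_fun setT (fun w => cos (Y w + c)).
Proof.
by move=> mY; apply: measurableT_comp; [exact: measurable_cos|exact: measurable_funD].
Qed.

Lemma integrable_cosM (Y W : T -> R) (c : R) : measurable_fun setT Y ->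
  P.-integrable setT (EFin \o W) -> P.-integrable setT (EFin \o (fun w => cos (Y w + c) * W w)).
Proof.
move=> mY Wi.
exact: (@integrableMbounded _ _ _ P _ _ 1 (measurable_cos_rv c mY) (fun x => normr_cos_le1 _) Wi).
Qed.

(* Cosine transforms determine trapezoids, which are cosine integrals of the
   integrable kernel sin sin / x^2. *)
Lemma annihilate_itv (y W : T -> R) (a b : R) : measurable_fun setT y ->
  P.-integrable setT (EFin \o W) ->
  (forall v c, \int[P]_w (cos (v * y w + c) * W w) = 0) ->
  \int[P]_w (\1_`]a, b] (y w) * W w) = 0.
Proof.
move=> my Wi H; have mW := integrable_measurable Wi.
have [ab|ba] := leP a b; last first.
  apply: Rintegral0_eq => w.
  by rewrite set_itv_ge ?indic0 ?mul0r// bnd_simp -leNgt ltW.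
have step e : 0 < e -> \int[P]_w (trapezoid a b e (y w) * W w) = 0.
  move=> e0; have [s [ms si [m sE]]] := trapezoidE a b e.
  pose f (p : T * measurableTypeR R) : R := s p.2 * cos (p.2 * y p.1 + - (m * p.2)) * W p.1.
  have mf : measurable_fun setT f.
    apply: measurable_funM; last by apply: measurableT_comp => //; exact: measurable_fst.
    apply: measurable_funM; first by apply: measurableT_comp => //; exact: measurable_snd.
    apply: measurableT_comp; first exact: measurable_cos.
    apply: measurable_funB; apply: measurable_funM => //; try exact: measurable_snd.
    by apply: measurableT_comp => //; exact: measurable_fst.
  have fle p : `|f p| <= `|W p.1| * `|s p.2|.
    rewrite /f !normrM mulrC ler_wpM2l// -[leRHS]mulr1 ler_wpM2l//.
    exact: normr_cos_le1.
  have := @dominated_Fubini _ _ T (measurableTypeR R) R P mu f (fun w => `|W w|) (fun x => `|s x|)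
    mf (integrable_norm Wi) (integrable_norm si) (fun w x => fle (w, x)).
  have -> : \int[mu]_x0 \int[P]_x f (x, x0) = 0.
    apply: Rintegral0_eq => x.
    transitivity (s x * \int[P]_w (cos (x * y w + - (m * x)) * W w)); last by rewrite H mulr0.
    have mxy : measurable_fun setT (fun w => x * y w) by exact: measurable_funM.
    rewrite -(RintegralZl _ measurableT (integrable_cosM (- (m * x)) mxy Wi)).
    by apply: eq_Rintegral => w _; rewrite /f mulrA.
  have ci w : mu.-integrable setT (EFin \o (fun x => s x * cos (x * y w + - (m * x)))).
    have mc : measurable_fun setT (fun x : measurableTypeR R => cos (x * y w + - (m * x))).
      apply: measurableT_comp; first exact: measurable_cos.
      by apply: measurable_funB; exact: measurable_funM.
    have := @integrableMbounded _ _ _ mu _ _ 1 mc (fun x => normr_cos_le1 _) si.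
    by apply: eq_integrable => // x _ /=; rewrite mulrC.
  move=> <-; apply: eq_Rintegral => w _; rewrite sE mulrC -(RintegralZl _ measurableT (ci w)).
  by apply: eq_Rintegral => x _; rewrite /f /= mulrC.
have [] := @dominated_Rintegral_cvg _ _ _ P
  (fun k w => trapezoid a b k.+1%:R^-1 (y w) * W w) (fun w => \1_`]a, b] (y w) * W w)
  (fun w => `|W w|).
- move=> k; apply: measurable_funM => //.
  by apply: measurableT_comp => //; exact: measurable_trapezoid.
- by move=> w; apply: cvgM; [exact: trapezoid_cvg|exact: cvg_cst].
- exact: (integrable_norm Wi).
- by move=> k w; rewrite normrM -[leRHS]mul1r ler_wpM2r// normr_trapezoid_le1// invr_gt0.
move=> _ cv; apply: (cvg_unique _ cv) => //.
by apply: cvg_near_cst; apply: nearW => k; apply: step; rewrite invr_gt0.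
Qed.

End cos_annihilation.

(** * From cosine transforms to generated events *)

Section cos_orthogonal.
Context {d : measure_display} {T : measurableType d} {R : realType}.
Variable P : {finite_measure set T -> \bar R}.
Variables (m : nat) (Y : 'I_m -> T -> R).
Hypothesis mY : forall j, measurable_fun setT (Y j).

(** Orthogonality to all trigonometric functions of the linear combinations, the phase c accounting
    for the sines. It amounts to a zero conditional expectation given the variables, by
    [cos_orthogonal_sigma]. *)
Definition cos_orthogonal (W : T -> R) : Prop :=
  P.-integrable setT (EFin \o W) /\
  forall (a : 'I_m -> R) c, \int[P]_w (cos (\sum_j a j * Y j w + c) * W w) = 0.

Let mlin (a : 'I_m -> R) : measurable_fun setT (fun w => \sum_j a j * Y j w).
Proof. by apply: measurable_sum => j; exact: measurable_funM. Qed.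

Lemma cos_orthogonal_integral0 W : cos_orthogonal W -> \int[P]_w W w = 0.
Proof.
move=> [_ /(_ (fun=> 0) 0)] <-; apply: eq_Rintegral => w _.
by rewrite big1 ?addr0 ?cos0 ?mul1r// => j _; rewrite mul0r.
Qed.

Lemma integrable_indicM (A : set T) (W : T -> R) : measurable A ->
  P.-integrable setT (EFin \o W) -> P.-integrable setT (EFin \o (fun w => \1_A w * W w)).
Proof.
move=> mA; apply: (@integrableMbounded _ _ _ P _ _ 1).
  exact: measurable_indic.
by move=> w; rewrite indicE; case: (_ \in _); rewrite ?normr1 ?normr0.
Qed.

Definition slab (p : 'I_m * (R * R)) : set T := Y p.1 @^-1` `]p.2.1, p.2.2].

Lemma measurable_slab p : measurable (slab p).
Proof. by rewrite -[slab p]setTI; exact: mY. Qed.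

(** The property survives restriction to a slab: the cosine of a combination times W is annihilated
    by the cosines in the direction of [Y p.1], a product of two cosines being a half-sum of cosines
    of combinations; [annihilate_itv] applies in that direction. *)
Lemma cos_orthogonal_slab W p : cos_orthogonal W ->
  cos_orthogonal (fun w => \1_(slab p) w * W w).
Proof.
move=> [Wi H]; split=> [|a c]; first exact: integrable_indicM (measurable_slab p) Wi.
have cW := integrable_cosM c (mlin a) Wi.
apply: (etrans _ (@annihilate_itv _ _ _ P (Y p.1) _ p.2.1 p.2.2 (mY p.1) cW _)).
  by apply: eq_Rintegral => w _; rewrite mulrCA !indicE.
move=> v c'.
pose b1 i := v * (i == p.1)%:R + a i; pose b2 i := v * (i == p.1)%:R - a i.
have delta w : \sum_i v * (i == p.1)%:R * Y i w = v * Y p.1 w.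
  rewrite (bigD1 p.1)//= eqxx mulr1 big1 ?addr0// => i /negbTE ->.
  by rewrite mulr0 mul0r.
have i1 := integrable_cosM (c' + c) (mlin b1) Wi.
have i2 := integrable_cosM (c' - c) (mlin b2) Wi.
transitivity (2^-1 * (\int[P]_w (cos (\sum_j b1 j * Y j w + (c' + c)) * W w) +
                      \int[P]_w (cos (\sum_j b2 j * Y j w + (c' - c)) * W w))); last first.
  by rewrite !H addr0 mulr0.
rewrite -(RintegralD measurableT i1 i2) -(RintegralZl _ measurableT (integrableDr i1 i2)).
apply: eq_Rintegral => w _.
have -> : \sum_j b1 j * Y j w = v * Y p.1 w + \sum_j a j * Y j w.
  by rewrite -delta -big_split/=; apply: eq_bigr => i _; rewrite mulrDl.
have -> : \sum_j b2 j * Y j w = v * Y p.1 w - \sum_j a j * Y j w.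
  by rewrite -delta -sumrB/=; apply: eq_bigr => i _; rewrite mulrBl.
set x := v * Y p.1 w; set y := \sum_j _.
rewrite (_ : x + y + (c' + c) = (x + c') + (y + c)); last by ring.
rewrite (_ : x - y + (c' - c) = (x + c') - (y + c)); last by ring.
by move: (x + c') (y + c) => u z; rewrite cosD cosB; field.
Qed.

(** Finite intersections coded by lists: concatenation then shows that they form a pi-system. *)
Definition slabs (l : seq ('I_m * (R * R))) : set T := foldr (fun p A => slab p `&` A) setT l.

Lemma measurable_slabs l : measurable (slabs l).
Proof. by elim: l => [|p l IH] //=; apply: measurableI => //; exact: measurable_slab. Qed.

Lemma slabs_cat l1 l2 : slabs (l1 ++ l2) = slabs l1 `&` slabs l2.
Proof. by elim: l1 => [|p l1 IH] /=; rewrite ?setTI// IH setIA. Qed.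

Lemma cos_orthogonal_slabs W l : cos_orthogonal W ->
  cos_orthogonal (fun w => \1_(slabs l) w * W w).
Proof.
move=> WH; elim: l => [|p l IH] /=.
  rewrite (_ : (fun w => _) = W)//; apply/funext => w.
  by rewrite indicT mul1r.
have := cos_orthogonal_slab p IH; rewrite (_ : (fun w => _) = (fun w => \1_(slab p `&` slabs l) w * W w))//.
by apply/funext => w; rewrite indicI /= mulrA.
Qed.

Lemma g_sigma_preimage_slabs : g_sigma_preimage Y `<=` <<s range slabs >>.
Proof.
apply: smallest_sub; first exact: smallest_sigma_algebra.
elim/big_ind : _ => [|A B|i _]; first exact: sub0set.
  by move=> ? ?; rewrite subUset.
have sub : preimage_set_system setT (Y i) (@ocitv R) `<=` range slabs.
  move=> _ [_ [[a b] _ <-] <-]; exists [:: (i, (a, b))] => //=.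
  by rewrite setTI setIT.
apply: subset_trans (sub_smallest2r (smallest_sigma_algebra _ _) sub).
by rewrite (g_sigma_preimageE setT (Y i) (@ocitv R)).
Qed.

(** Dynkin's theorem: the events over which W has zero integral form a lambda-system, and it
    contains the generating intersections of slabs. *)
Lemma cos_orthogonal_sigma W A : cos_orthogonal W -> g_sigma_preimage Y A ->
  measurable A /\ (\int[P]_(w in A) (W w)%:E = 0)%E.
Proof.
move=> WH /g_sigma_preimage_slabs; have [Wi _] := WH; have mW := integrable_measurable Wi.
pose H := [set A | measurable A /\ \int[P]_w (\1_A w * W w) = 0].
suff sub : <<s range slabs >> `<=` H.
  move=> /sub[mA A0]; split => //; rewrite integral_mkcond.
  rewrite -[RHS]/((0 : R)%:E) -A0 EFin_Rintegral; last exact: integrable_indicM mA Wi.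
  apply: eq_integral => w _; rewrite /patch indicE; case: ifP => _; last by rewrite mul0r.
  by rewrite mul1r.
apply: lambda_system_subset => //.
- by move=> _ _ [l1 _ <-] [l2 _ <-]; exists (l1 ++ l2) => //; rewrite slabs_cat.
- split => //.
  + split => //; rewrite -(cos_orthogonal_integral0 WH).
    by apply: eq_Rintegral => w _; rewrite indicT mul1r.
  + move=> B C CB [mB B0] [mC C0]; split; first exact: measurableD.
    rewrite -[RHS](subr0 0) -{1}B0 -C0.
    rewrite -(RintegralB measurableT (integrable_indicM mB Wi) (integrable_indicM mC Wi)).
    apply: eq_Rintegral => w _; rewrite -mulrBl; congr (_ * _).
    rewrite !indicE in_setD; have [/set_mem/CB/mem_set ->|_] := boolP (w \in C).
      by rewrite subrr.
    by rewrite andbT subr0.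
  + move=> F Fnd FH; have mF i : measurable (F i) by case: (FH i).
    have mU : measurable (\bigcup_i F i) by exact: bigcup_measurable.
    split => //.
    have [] := @dominated_Rintegral_cvg _ _ _ P (fun k w => \1_(F k) w * W w)
      (fun w => \1_(\bigcup_i F i) w * W w) (fun w => `|W w|).
    * by move=> k; apply: measurable_funM => //; exact: measurable_indic.
    * move=> w; apply: cvgM; last exact: cvg_cst.
      apply: cvg_near_cst; have [/set_mem[i _ Fi]|/negP wU] := boolP (w \in \bigcup_i F i).
        exists i => // k /= ik; rewrite !indicE !mem_set//; first by exists i.
        by move/subsetPset: (Fnd _ _ ik); exact.
      apply: nearW => k; rewrite !indicE (negbTE (introN idP wU)); case: (boolP (w \in F k)) => // /set_mem wF.
      by case: wU; apply: mem_set; exists k.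
    * exact: (integrable_norm Wi).
    * move=> k w; rewrite normrM -[leRHS]mul1r ler_wpM2r// indicE.
      by case: (_ \in _); rewrite ?normr1 ?normr0.
    move=> _ cv; apply: (cvg_unique _ cv) => //.
    by apply: cvg_near_cst; apply: nearW => k; case: (FH k).
- move=> _ [l _ <-]; split; first exact: measurable_slabs.
  exact: cos_orthogonal_integral0 (cos_orthogonal_slabs l WH).
Qed.

End cos_orthogonal.

Section sine_quotient.
Context {R : realType}.
Implicit Type x : R.

Lemma normr_sinB_le x : `|sin x - x| <= x ^+ 2.
Proof.
have pos (y : R) : 0 <= y -> `|sin y - y| <= y ^+ 2.
  rewrite le_eqVlt => /predU1P[<-|y0]; first by rewrite sin0 subr0 normr0 expr0n.
  have [|c cy] := @MVT_segment R sin cos 0 y (ltW y0) (fun x _ => is_derive_sin x).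
    by apply: continuous_subspaceT; exact: continuous_sin.
  move: cy; rewrite in_itv/= => /andP[c0 cy].
  rewrite sin0 !subr0 => ->; rewrite -[X in _ - X]mul1r -mulrBl normrM (gtr0_norm y0) expr2.
  rewrite ler_wpM2r ?(ltW y0)// -cos0 (le_trans (normr_cosB_le _ _))// subr0 ger0_norm//.
have [x0|/ltW x0] := leP 0 x; first exact: pos.
have := pos (- x); rewrite oppr_ge0 sinN -opprB normrN opprK sqrrN addrC => /(_ x0).
by rewrite -normrN opprB addrC.
Qed.

(** A trigonometric approximation of the identity, dominated by |x|: moments of a variable become
    limits of its trigonometric transforms. *)
Definition sin_scaled (k : nat) x : R := k.+1%:R * sin (k.+1%:R^-1 * x).

Lemma sin_scaled_le k x : `|sin_scaled k x| <= `|x|.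
Proof.
have k0 : 0 < k.+1%:R :> R by rewrite ltr0n.
rewrite normrM gtr0_norm// -ler_pdivlMl// (le_trans (normr_sin_le _))//.
by rewrite normrM gtr0_norm ?invr_gt0.
Qed.

Lemma sin_scaled_cvg x : sin_scaled k x @[k --> \oo] --> x.
Proof.
suff : (sin_scaled k x - x) @[k --> \oo] --> (0 : R).
  by move=> /cvg_sub0; apply; exact: cvg_cst.
have inv0 : (k.+1%:R^-1 * x ^+ 2) @[k --> \oo] --> (0 : R).
  by rewrite -(mul0r (x ^+ 2)); apply: cvgM; [exact: cvg_harmonic|exact: cvg_cst].
apply/norm_cvg0P; apply: (@squeeze_cvgr _ _ _ _ (cst 0) (fun k => k.+1%:R^-1 * x ^+ 2)) => //; last exact: cvg_cst.
apply: nearW => k; rewrite normr_ge0/=.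
have k0 : 0 < k.+1%:R :> R by rewrite ltr0n.
have -> : sin_scaled k x - x = k.+1%:R * (sin (k.+1%:R^-1 * x) - k.+1%:R^-1 * x).
  by rewrite mulrBr mulVKf// gt_eqF.
rewrite normrM gtr0_norm// -ler_pdivlMl// (le_trans (normr_sinB_le _))//.
by rewrite le_eqVlt; apply/orP; left; apply/eqP; ring.
Qed.

End sine_quotient.

(** * An uncorrelated residual and its square are orthogonal to generated events *)

Section gaussian_independence.
Context {d : measure_display} {T : measurableType d} {R : realType}.
Variables (P : probability T R) (N : nat) (M : set 'cV[R]_N -> T -> R[i]).
Hypothesis hM : gaussian_random_measure P M.
Variables (m : nat) (f : 'I_m -> 'cV[R]_N -> R[i]) (Y : 'I_m -> T -> R).
Variables (g : 'cV[R]_N -> R[i]) (xi : T -> R).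
Hypotheses (fY : forall j, wiener P M (f j) (Y j)) (gxi : wiener P M g xi).
Hypothesis uncorrelated : forall j, \int[P]_w (xi w * Y j w) = 0.

Let lin (a : 'I_m -> R) w := \sum_j a j * Y j w.
Let mxi : measurable_fun setT xi. Proof. by case: gxi. Qed.
Let mY j : measurable_fun setT (Y j). Proof. by case: (fY j). Qed.
Let mlin a : measurable_fun setT (lin a).
Proof. by apply: measurable_sum => j; exact: measurable_funM. Qed.
Let xi2 := wiener_sqr_integrable hM gxi.
Let var := \int[P]_w (xi w ^+ 2).
Let chi (u : R) := variance_char (u ^+ 2 * var).

Let lin0 w : lin (fun=> 0) w = 0.
Proof. by rewrite /lin big1// => j _; rewrite mul0r. Qed.

(** Every combination is a stochastic integral, so its transform depends on the variance alone; the
    covariances vanish, the variances add, and [variance_char] is multiplicative. *)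
Let char_split a u c :
  \int[P]_w cos (u * xi w + lin a w + c) = chi u * \int[P]_w cos (lin a w + c).
Proof.
have wV : wiener P M _ (lin a) := wiener_sum hM (index_enum 'I_m) a fY.
rewrite (wiener_cos hM c (wiener_axpy hM u gxi wV)) (wiener_cos hM c wV) mulrCA.
have V2 := wiener_sqr_integrable hM wV; rewrite -variance_charD; last 2 first.
- by rewrite mulr_ge0 ?sqr_ge0//; apply: Rintegral_ge0 => w _; exact: sqr_ge0.
- by apply: Rintegral_ge0 => w _; exact: sqr_ge0.
congr (_ * variance_char _).
transitivity (\int[P]_w ((lin a w + u * xi w) ^+ 2)).
  by apply: eq_Rintegral => w _; rewrite addrC.
rewrite (Rintegral_sqrD u (mlin a) mxi V2 xi2).
suff -> : \int[P]_w (lin a w * xi w) = 0 by rewrite mulr0 addr0 addrC.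
have xiY j := integrable_mul_sqr mxi (mY j) xi2 (wiener_sqr_integrable hM (fY j)).
transitivity (\int[P]_w (\sum_j a j * (xi w * Y j w))).
  by apply: eq_Rintegral => w _; rewrite mulr_suml; apply: eq_bigr => j _; ring.
rewrite (Rintegral_sum (index_enum 'I_m) (fun j => integrableZlr (a j) (xiY j))) big1// => j _.
by rewrite (RintegralZl _ measurableT (xiY j)) uncorrelated mulr0.
Qed.

Let chiN u : chi (- u) = chi u.
Proof. by rewrite /chi sqrrN. Qed.

Let mu_xi u a : measurable_fun setT (fun w => u * xi w + lin a w).
Proof. by apply: measurable_funD => //; exact: measurable_funM. Qed.

(** Half the difference of the transforms at - u and u, which agree because [chi] is even. *)
Let sin_sin u a c : \int[P]_w (sin (u * xi w) * sin (lin a w + c)) = 0.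
Proof.
have i1 := integrable_cos_rv P c (mu_xi u a); have i2 := integrable_cos_rv P c (mu_xi (- u) a).
transitivity (2^-1 * (\int[P]_w cos (- u * xi w + lin a w + c) - \int[P]_w cos (u * xi w + lin a w + c))).
  rewrite -(RintegralB measurableT i2 i1) -(RintegralZl _ measurableT (integrableBr i2 i1)).
  apply: eq_Rintegral => w _; rewrite -!addrA mulNr (addrC (- _)).
  by move: (u * xi w) (lin a w + c) => x y; rewrite (addrC x) cosB cosD; field.
by rewrite !char_split chiN subrr mulr0.
Qed.

Let sin_cos u a c : \int[P]_w (sin (u * xi w) * cos (lin a w + c)) = 0.
Proof.
rewrite -(sin_sin u a (c + pi / 2)); apply: eq_Rintegral => w _.
by rewrite addrA sinDpihalf.
Qed.

Let sin2_cos u a c : \int[P]_w (sin (u * xi w) ^+ 2 * cos (lin a w + c)) =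
  (1 - chi (2 * u)) / 2 * \int[P]_w cos (lin a w + c).
Proof.
have i0 := integrable_cos_rv P c (mlin a).
have i1 := integrable_cos_rv P c (mu_xi (2 * u) a).
have i2 := integrable_cos_rv P c (mu_xi (- (2 * u)) a).
transitivity (2^-1 * (\int[P]_w cos (lin a w + c) -
   2^-1 * (\int[P]_w cos (2 * u * xi w + lin a w + c) + \int[P]_w cos (- (2 * u) * xi w + lin a w + c)))).
  have i3 := integrableZlr 2^-1 (integrableDr i1 i2).
  rewrite -(RintegralD measurableT i1 i2) -(RintegralZl _ measurableT (integrableDr i1 i2)).
  rewrite -(RintegralB measurableT i0 i3) -(RintegralZl _ measurableT (integrableBr i0 i3)).
  apply: eq_Rintegral => w _; rewrite -!addrA mulNr (addrC (- _)) -mulrA.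
  move: (u * xi w) (lin a w + c) => x y; rewrite (addrC (2 * x)) cosB cosD.
  have -> : cos (2 * x) = 1 - 2 * sin x ^+ 2 by rewrite mulr_natl mulr2n cosD; have := cos2Dsin2 x; lra.
  by field.
by rewrite !char_split chiN; field.
Qed.

Let cvg_moment (V : T -> R) n : measurable_fun setT V -> (forall w, `|V w| <= 1) ->
  P.-integrable setT (EFin \o (fun w => `|xi w| ^+ n)) ->
  \int[P]_w (sin_scaled k (xi w) ^+ n * V w) @[k --> \oo] --> \int[P]_w (xi w ^+ n * V w).
Proof.
move=> mV V1 xin.
have [] := @dominated_Rintegral_cvg _ _ _ P (fun k w => sin_scaled k (xi w) ^+ n * V w)
  (fun w => xi w ^+ n * V w) (fun w => `|xi w| ^+ n) => //.
- move=> k; apply: measurable_funM => //; apply: measurable_funX.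
  apply: measurable_funM => //; apply: measurableT_comp; first exact: measurable_sin.
  exact: measurable_funM.
- move=> w; apply: cvgM; last exact: cvg_cst.
  have c : continuous (fun x : R => x ^+ n) by exact: exprn_continuous.
  by apply: (continuous_cvg _ (c _)); exact: sin_scaled_cvg.
- move=> k w; rewrite normrM normrX -[leRHS]mulr1; apply: ler_pM => //.
  by apply: lerXn2r; rewrite ?nnegrE// sin_scaled_le.
Qed.

Let xi_abs1 : P.-integrable setT (EFin \o (fun w => `|xi w| ^+ 1)).
Proof.
apply: integrable_le (integrableDr (integrable_cst_rv P 1) xi2).
  by apply: measurable_funX; exact: measurableT_comp.
move=> w; rewrite expr1 normr_id -[xi w ^+ 2]real_normK ?num_real//.
by have := normr_ge0 (xi w); nra.
Qed.

(** The scaled sines of xi are orthogonal to the cosines, and they converge to xi under the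
    integrable bound |xi|. *)
Lemma uncorrelated_cos_orthogonal : cos_orthogonal P Y xi.
Proof.
split => [|a c].
  apply: integrable_le xi_abs1; first exact: mxi.
  by move=> w; rewrite expr1.
have := @cvg_moment (fun w => cos (lin a w + c)) 1 (measurable_cos_rv c (mlin a))
  (fun w => normr_cos_le1 _) xi_abs1.
rewrite (_ : (fun k => _) = cst 0); last first.
  apply/funext => k /=; rewrite -[RHS](mulr0 k.+1%:R) -(sin_cos k.+1%:R^-1 a c).
  have i1 : P.-integrable setT (EFin \o (fun w => sin (k.+1%:R^-1 * xi w) * cos (lin a w + c))).
    apply: (@integrableMbounded _ _ _ P _ _ 1); last exact: integrable_cos_rv.
      apply: measurableT_comp; first exact: measurable_sin.
      exact: measurable_funM.
    by move=> w; exact: normr_sin_le1.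
  rewrite -(RintegralZl _ measurableT i1).
  by apply: eq_Rintegral => w _; rewrite expr1 mulrA.
move=> cv; transitivity (\int[P]_w (xi w ^+ 1 * cos (lin a w + c))); last first.
  by apply: (cvg_unique _ cv (cvg_cst _)).
by apply: eq_Rintegral => w _; rewrite expr1 mulrC.
Qed.

Lemma uncorrelated_sqr_cos_orthogonal : cos_orthogonal P Y (fun w => xi w ^+ 2 - var).
Proof.
have abs2 : P.-integrable setT (EFin \o (fun w => `|xi w| ^+ 2)).
  by apply: eq_integrable xi2 => // w _ /=; rewrite real_normK ?num_real.
split => [|a c]; first exact: (integrableBr xi2 (integrable_cst_rv P var)).
pose q k : R := k.+1%:R ^+ 2 * ((1 - chi (2 * k.+1%:R^-1)) / 2).
have qE a' c' k : \int[P]_w (sin_scaled k (xi w) ^+ 2 * cos (lin a' w + c')) =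
    q k * \int[P]_w cos (lin a' w + c').
  rewrite /q -mulrA -sin2_cos.
  have i1 : P.-integrable setT (EFin \o (fun w => sin (k.+1%:R^-1 * xi w) ^+ 2 * cos (lin a' w + c'))).
    apply: (@integrableMbounded _ _ _ P _ _ 1); last exact: integrable_cos_rv.
      apply: measurable_funX; apply: measurableT_comp; first exact: measurable_sin.
      exact: measurable_funM.
    by move=> w; rewrite normrX expr_le1// normr_sin_le1.
  rewrite -(RintegralZl _ measurableT i1).
  by apply: eq_Rintegral => w _; rewrite exprMn mulrA.
have lim a' c' := @cvg_moment (fun w => cos (lin a' w + c')) 2 (measurable_cos_rv c' (mlin a'))
  (fun w => normr_cos_le1 _) abs2.
(* The limit of the common factor is identified by the zero combination with zero phase, where the
   cosine is 1 and the second moment remains. *)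
have qvar : q k @[k --> \oo] --> var.
  have := lim (fun=> 0) 0; under eq_fun do rewrite qE.
  under eq_Rintegral do rewrite lin0 addr0 cos0.
  have -> : (fun k => q k * \int[P]_(_ in setT) 1) = q.
    by apply/funext => k; rewrite Rintegral_cst_rv mulr1.
  by under eq_Rintegral do rewrite lin0 addr0 cos0 mulr1.
have lim2 : \int[P]_w (xi w ^+ 2 * cos (lin a w + c)) = var * \int[P]_w cos (lin a w + c).
  have := lim a c; under eq_fun do rewrite qE.
  move=> cv; apply: (cvg_unique _ cv) => //.
  by apply: cvgM => //; exact: cvg_cst.
have i1 := integrable_cosM c (mlin a) xi2.
have i2 := integrableZlr var (integrable_cos_rv P c (mlin a)).
transitivity (\int[P]_w (cos (lin a w + c) * xi w ^+ 2) - \int[P]_w (var * cos (lin a w + c))).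
  rewrite -(RintegralB measurableT i1 i2); apply: eq_Rintegral => w _.
  by rewrite mulrBr (mulrC var).
rewrite (RintegralZl _ measurableT (integrable_cos_rv P c (mlin a))) -lim2.
by apply/eqP; rewrite subr_eq0; apply/eqP; apply: eq_Rintegral => w _; rewrite mulrC.
Qed.

End gaussian_independence.

(** * Conditional variance *)

Section projection.
Context {d : measure_display} {T : measurableType d} {R : realType}.
Variable mu : {measure set T -> \bar R}.
Variables (m : nat) (Y : 'I_m -> T -> R) (Z : T -> R).
Hypotheses (mY : forall j, measurable_fun setT (Y j)) (mZ : measurable_fun setT Z).
Hypotheses (Y2 : forall j, mu.-integrable setT (EFin \o (fun x => Y j x ^+ 2)))
  (Z2 : mu.-integrable setT (EFin \o (fun x => Z x ^+ 2))).

Let lin (v : 'I_m -> R) x := \sum_j v j * Y j x.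

Let mlin v : measurable_fun setT (lin v).
Proof. by apply: measurable_sum => j; exact: measurable_funM. Qed.

Let Rintegral_lin (W : T -> R) v : measurable_fun setT W ->
  mu.-integrable setT (EFin \o (fun x => W x ^+ 2)) ->
  \int[mu]_x (W x * lin v x) = \sum_j v j * \int[mu]_x (W x * Y j x).
Proof.
move=> mW W2; have WY j := integrable_mul_sqr mW (mY j) W2 (Y2 j).
transitivity (\int[mu]_x (\sum_j v j * (W x * Y j x))).
  by apply: eq_Rintegral => x _; rewrite mulr_sumr; apply: eq_bigr => j _; rewrite mulrCA.
rewrite (Rintegral_sum (index_enum 'I_m) (fun j => integrableZlr (v j) (WY j))).
by apply: eq_bigr => j _; rewrite (RintegralZl _ measurableT (WY j)).
Qed.

Lemma integrable_sqr_lin v : mu.-integrable setT (EFin \o (fun x => lin v x ^+ 2)).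
Proof.
have H := integrable_sumr (index_enum 'I_m) (fun i => integrable_sumr (index_enum 'I_m)
  (fun j => integrableZlr (v i * v j) (integrable_mul_sqr (mY i) (mY j) (Y2 i) (Y2 j)))).
apply: eq_integrable H => // x _ /=; congr EFin.
rewrite expr2 {1}/lin mulr_suml; apply: eq_bigr => i _.
by rewrite /lin mulr_sumr; apply: eq_bigr => j _; ring.
Qed.

(* The normal equations are solvable: a vector in the kernel of the Gram matrix
   is a combination vanishing in L^2, hence orthogonal to Z. *)
Lemma orthogonal_projection : exists a : 'I_m -> R,
  forall i, \int[mu]_x ((Z x - \sum_j a j * Y j x) * Y i x) = 0.
Proof.
pose G : 'M[R]_m := \matrix_(i, j) \int[mu]_x (Y i x * Y j x).
pose b : 'rV[R]_m := \row_i \int[mu]_x (Z x * Y i x).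
have : (b <= G)%MS.
  rewrite submxE; apply/eqP/rowP => k; rewrite [RHS]mxE.
  pose v i := cokermx G i k.
  have Gv i : \int[mu]_x (Y i x * lin v x) = 0.
    rewrite (Rintegral_lin v (mY i) (Y2 i)).
    have := mulmx_coker G => /matrixP /(_ i k); rewrite !mxE => H; apply: etrans H.
    by apply: eq_bigr => j _; rewrite [G i j]mxE mulrC.
  have v0 : \int[mu]_x (lin v x ^+ 2) = 0.
    transitivity (\int[mu]_x (lin v x * lin v x)); first by apply: eq_Rintegral => x _; rewrite expr2.
    rewrite (Rintegral_lin v (mlin v) (integrable_sqr_lin v)) big1// => j _.
    rewrite (_ : \int[mu]_x _ = 0) ?mulr0//; apply: etrans (Gv j).
    by apply: eq_Rintegral => x _; rewrite mulrC.
  have := Rintegral_cauchy_schwarz mZ (mlin v) Z2 (integrable_sqr_lin v).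
  rewrite v0 mulr0 (Rintegral_lin v mZ Z2) => h.
  rewrite !mxE; apply/eqP; rewrite -sqrf_eq0 eq_le sqr_ge0 andbT.
  apply: le_trans h; rewrite le_eqVlt; apply/orP; left; apply/eqP; congr (_ ^+ 2).
  by apply: eq_bigr => j _; rewrite [b 0 j]mxE mulrC.
case/submxP => D bD; exists (fun j => D 0 j) => i.
have ZY := integrable_mul_sqr mZ (mY i) Z2 (Y2 i).
have LY := integrable_mul_sqr (mlin (fun j => D 0 j)) (mY i) (integrable_sqr_lin _) (Y2 i).
transitivity (\int[mu]_x (Z x * Y i x) - \int[mu]_x (lin (fun j => D 0 j) x * Y i x)).
  by rewrite -(RintegralB measurableT ZY LY); apply: eq_Rintegral => x _; rewrite mulrBl.
have := congr1 (fun B : 'rV[R]_m => B 0 i) bD; rewrite !mxE => ->.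
apply/eqP; rewrite subr_eq0; apply/eqP.
transitivity (\int[mu]_x (Y i x * lin (fun j => D 0 j) x)); last first.
  by apply: eq_Rintegral => x _; rewrite mulrC.
rewrite (Rintegral_lin _ (mY i) (Y2 i)); apply: eq_bigr => j _; rewrite !mxE; congr (_ * _).
by apply: eq_Rintegral => x _; rewrite mulrC.
Qed.

End projection.

(** * Almost sure uniqueness of conditional expectations *)

Section conditional_expectation.
Context {d : measure_display} {T : measurableType d} {R : realType}.
Variable P : probability T R.
Variable U : set (set T).
Hypothesis sU : <<s U >> `<=` (measurable : set (set T)).

Lemma sigma_measurable_fun (Z : T -> R) :
  (forall B : set R, measurable B -> <<s U >> (Z @^-1` B)) ->
  measurable_fun (setT : set (g_sigma_algebraType U)) (Z : g_sigma_algebraType U -> R).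
Proof. by move=> H _ B mB; rewrite setTI; exact: H. Qed.

(** The event Z2 < Z1 lies in the sigma-algebra; there the difference is positive with zero
    integral, so the event is null. *)
Let cond_expectation_le (X Z1 Z2 : T -> R) :
  is_cond_expectation P <<s U >> X Z1 -> is_cond_expectation P <<s U >> X Z2 ->
  {ae P, forall w, Z1 w <= Z2 w}.
Proof.
move=> [m1 i1 e1] [m2 i2 e2].
pose A := [set w | Z2 w < Z1 w].
have UA : <<s U >> A.
  have := measurable_funB (sigma_measurable_fun m1) (sigma_measurable_fun m2).
  move=> /(_ measurableT `]0, +oo[%classic (measurable_itv _)); rewrite setTI.
  congr (<<s U >> _); apply/seteqP; split => w /=; by rewrite in_itv/= andbT subr_gt0.
have mA := sU UA.
have iA (Z : T -> R) : P.-integrable setT (EFin \o Z) -> P.-integrable A (EFin \o Z).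
  by move=> Zi; apply: integrableS Zi.
have mZ (Z : T -> R) : P.-integrable setT (EFin \o Z) -> measurable_fun A (EFin \o Z).
  by move=> /iA /measurable_int.
have : (\int[P]_(w in A) `|(Z1 w)%:E - (Z2 w)%:E| = 0)%E.
  transitivity (\int[P]_(w in A) ((Z1 w)%:E - (Z2 w)%:E))%E.
    apply: eq_integral => w /set_mem Aw; rewrite gee0_abs// -EFinB lee_fin subr_ge0.
    exact: ltW.
  rewrite (integralB mA (iA _ i1) (iA _ i2)) e1// e2// subee//.
  rewrite -e1//; exact: integrable_fin_num (iA _ i1).
move=> /(ae_eq_integral_abs P mA (emeasurable_funB (mZ _ i1) (mZ _ i2))).
apply: filterS => w H; rewrite leNgt; apply/negP => Aw.
by have := H Aw => -[] /eqP; rewrite subr_eq0 => /eqP Z12; move: Aw; rewrite Z12 ltxx.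
Qed.

Lemma cond_expectationE (X Z : T -> R) : is_cond_expectation P <<s U >> X Z ->
  {ae P, forall w, cond_expectation P <<s U >> X w = Z w}.
Proof.
move=> HZ; have HC : is_cond_expectation P <<s U >> X (cond_expectation P <<s U >> X).
  by apply: (@xgetPex _ (cst 0) [set Z | is_cond_expectation P <<s U >> X Z]); exists Z.
have := cond_expectation_le HC HZ; apply: filterS2 (cond_expectation_le HZ HC) => w h1 h2.
by apply/eqP; rewrite eq_le h1 h2.
Qed.

Lemma cond_expectation_measurable (X Z : T -> R) : is_cond_expectation P <<s U >> X Z ->
  measurable_fun setT (cond_expectation P <<s U >> X).
Proof.
move=> HZ; have [HC _ _] : is_cond_expectation P <<s U >> X (cond_expectation P <<s U >> X).
  by apply: (@xgetPex _ (cst 0) [set Z | is_cond_expectation P <<s U >> X Z]); exists Z.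
by move=> _ B mB; rewrite setTI; apply: sU; exact: HC.
Qed.

End conditional_expectation.

Lemma integral_eq_subr0 d (T : measurableType d) (R : realType) (mu : {measure set T -> \bar R})
    (A : set T) (f g : T -> R) : measurable A ->
  mu.-integrable setT (EFin \o f) -> mu.-integrable setT (EFin \o g) ->
  (\int[mu]_(x in A) (f x - g x)%:E = 0)%E ->
  (\int[mu]_(x in A) (f x)%:E = \int[mu]_(x in A) (g x)%:E)%E.
Proof.
move=> mA fi gi H.
have iA (h : T -> R) : mu.-integrable setT (EFin \o h) -> mu.-integrable A (EFin \o h).
  by move=> hi; apply: integrableS hi.
have : (\int[mu]_(x in A) (f x)%:E - \int[mu]_(x in A) (g x)%:E = 0)%E.
  by rewrite -(integralB mA (iA _ fi) (iA _ gi)) -[RHS]H; apply: eq_integral => x _; rewrite EFinB.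
move: (integrable_fin_num mA (iA _ fi)) (integrable_fin_num mA (iA _ gi)).
by move=> /fineK <- /fineK <-; rewrite -EFinB => -[] /eqP; rewrite subr_eq0 => /eqP ->.
Qed.

(** * The conditional variance is a squared distance *)

Section gaussian_conditional_variance.
Context {d : measure_display} {T : measurableType d} {R : realType}.
Variables (P : probability T R) (N : nat) (M : set 'cV[R]_N -> T -> R[i]).
Hypothesis hM : gaussian_random_measure P M.
Variables (m : nat) (f : 'I_m -> 'cV[R]_N -> R[i]) (Y : 'I_m -> T -> R).
Variables (g : 'cV[R]_N -> R[i]) (X : T -> R).
Hypotheses (fY : forall j, wiener P M (f j) (Y j)) (gX : wiener P M g X).

(** Orthogonality of xi to the generated events makes the projection a conditional expectation; that
    of xi^2 minus its mean makes the constant one for the squared residual. *)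
Lemma cond_variance_wiener : exists a : 'I_m -> R,
  {ae P, forall w, cond_variance P (g_sigma_preimage Y) X w =
                   \int[P]_w ((X w - \sum_j a j * Y j w) ^+ 2)}.
Proof.
have mY j : measurable_fun setT (Y j) by case: (fY j).
have mX : measurable_fun setT X by case: gX.
have Y2 j := wiener_sqr_integrable hM (fY j).
have X2 := wiener_sqr_integrable hM gX.
have [a ortho] := orthogonal_projection mY mX Y2 X2.
exists a; pose xi w := X w - \sum_j a j * Y j w.
have wxi := wiener_axpy hM (-1) (wiener_sum hM (index_enum 'I_m) a fY) gX.
have xiE : (fun w => -1 * (\sum_(i <- index_enum 'I_m) a i * Y i w) + X w) = xi.
  by apply/funext => w; rewrite mulN1r addrC.
rewrite xiE in wxi.
have mxi : measurable_fun setT xi by case: wxi.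
have xi2 := wiener_sqr_integrable hM wxi.
have co1 := uncorrelated_cos_orthogonal hM fY wxi ortho.
have co2 := uncorrelated_sqr_cos_orthogonal hM fY wxi ortho.
set U := \big[setU/set0]_(i < m) preimage_set_system setT (Y i) measurable.
have sU : <<s U >> `<=` (measurable : set (set T)).
  by move=> A GA; case: (@cos_orthogonal_sigma _ _ _ P m Y mY xi A co1 GA).
pose Z w := \sum_j a j * Y j w.
have Zi : P.-integrable setT (EFin \o Z).
  have [xi1 _] := co1; have Xi : P.-integrable setT (EFin \o X).
    apply: integrable_le (integrableDr (integrable_cst_rv P 1) X2) => // w.
    by rewrite -[X w ^+ 2]real_normK ?num_real//; have := normr_ge0 (X w); nra.
  have := integrableBr Xi xi1; apply: eq_integrable => // w _ /=.
  by rewrite /xi subKr.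
have Xi : P.-integrable setT (EFin \o X).
  have [xi1 _] := co1; have := integrableDr Zi xi1; apply: eq_integrable => // w _ /=.
  by rewrite /xi subrKC.
have HZ : is_cond_expectation P <<s U >> X Z.
  split => //.
  - have mZ : measurable_fun (setT : set (g_sigma_algebraType U)) (Z : g_sigma_algebraType U -> R).
      apply: measurable_sum => j; apply: measurable_funM => //.
      apply: sigma_measurable_fun => B mB; apply: sub_sigma_algebra.
      by rewrite /U (bigD1 j)//=; left; exists B; rewrite ?setTI.
    by move=> B mB; have := mZ measurableT B mB; rewrite setTI.
  - move=> A GA; have [mA A0] := cos_orthogonal_sigma mY co1 GA.
    by apply/esym; exact: integral_eq_subr0 mA Xi Zi A0.
apply: (cond_expectationE sU); split.
- move=> B mB; rewrite preimage_cst; case: ifP => _.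
    exact: (@measurableT _ (g_sigma_algebraType U)).
  exact: (@measurable0 _ (g_sigma_algebraType U)).
- exact: integrable_cst_rv.
move=> A GA; have [mA A0] := cos_orthogonal_sigma mY co2 GA.
rewrite -(integral_eq_subr0 mA xi2 (integrable_cst_rv P _) A0).
(* The chosen version of the conditional expectation agrees with the projection only almost surely,
   so the squares are compared under the integral. *)
apply: ae_eq_integral => //.
- by apply/measurable_funTS/measurable_EFinP; exact: measurable_funX.
- apply/measurable_funTS/measurable_EFinP; apply: measurable_funX.
  by apply: measurable_funB => //; exact: (cond_expectation_measurable sU HZ).
by move: (cond_expectationE sU HZ); apply: filterS => w -> _.
Qed.

End gaussian_conditional_variance.

(** * From the spectral kernel to cosine combinations *)

Section kernel.
Context {R : realType} (N : nat).
Variables (E : 'M[R]_N) (psi : 'cV[R]_N -> R).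
Hypothesis psi_cont : continuous psi.
Implicit Types t x : 'cV[R]_N.

Let weight x : R := (psi x `^ (1 + \tr E / 2))^-1.

Let Re_kernel t x : complex.Re (spectral_kernel E psi t x) = (cos (inner t x) - 1) * weight x.
Proof. by rewrite /spectral_kernel -fmorphV cReM cReD cReN /= mulr0 subr0. Qed.

Let Im_kernel t x : complex.Im (spectral_kernel E psi t x) = sin (inner t x) * weight x.
Proof. by rewrite /spectral_kernel -fmorphV cImM cImD cImN /= oppr0 addr0 mulr0 add0r. Qed.

Lemma cmeasurable_spectral_kernel t : cmeasurable (spectral_kernel E psi t).
Proof.
have mw : measurable_fun setT weight.
  apply: measurableT_comp; first exact: measurable_invr.
  exact: (measurableT_comp (measurable_powR _) (continuous_measurable_cV psi_cont)).
split.
  under eq_fun do rewrite Re_kernel.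
  apply: measurable_funM => //; apply: measurable_funB => //.
  by apply: measurableT_comp; [exact: measurable_cos|exact: measurable_inner].
under eq_fun do rewrite Im_kernel.
apply: measurable_funM => //.
by apply: measurableT_comp; [exact: measurable_sin|exact: measurable_inner].
Qed.

Lemma innerBl t t' x : inner (t - t') x = inner t x - inner t' x.
Proof. by rewrite /inner linearB/= mulmxBl !mxE. Qed.

(* Multiplying by exp (- i <t, x>), which preserves the modulus, turns the
   coefficient of the kernel at t into 1; the modulus dominates the real part. *)
Lemma normc2_kernel_ge (p : nat) (t : 'cV[R]_N) (s : 'I_p -> 'cV[R]_N) (a : 'I_p -> R) x :
  (1 - ((1 - \sum_j a j) * cos (inner t x) + \sum_j a j * cos (inner (t - s j) x))) ^+ 2
    / (psi x `^ (2 + \tr E)) <=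
  Normc.normc ((-1)%:C%C * (\sum_j (a j)%:C%C * spectral_kernel E psi (s j) x) +
    spectral_kernel E psi t x) ^+ 2.
Proof.
have -> : (psi x `^ (2 + \tr E))^-1 = weight x ^+ 2.
  by rewrite /weight exprVn -powR_mulrn ?powR_ge0// -powRrM; congr (_ `^ _)^-1; field.
set F := (X in Normc.normc X).
have ReF : complex.Re F = (cos (inner t x) - (1 - \sum_j a j) - \sum_j a j * cos (inner (s j) x)) * weight x.
  rewrite /F rmorphN1 mulN1r cReD cReN Re_sum Re_kernel.
  have -> : \sum_j complex.Re ((a j)%:C%C * spectral_kernel E psi (s j) x) =
      (\sum_j a j * cos (inner (s j) x) - \sum_j a j) * weight x.
    rewrite -sumrB mulr_suml; apply: eq_bigr => j _; rewrite cReM Re_kernel /= mul0r subr0.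
    by rewrite mulrA mulrBr mulr1.
  by ring.
have ImF : complex.Im F = (sin (inner t x) - \sum_j a j * sin (inner (s j) x)) * weight x.
  rewrite /F rmorphN1 mulN1r cImD cImN Im_sum Im_kernel.
  have -> : \sum_j complex.Im ((a j)%:C%C * spectral_kernel E psi (s j) x) =
      (\sum_j a j * sin (inner (s j) x)) * weight x.
    by rewrite mulr_suml; apply: eq_bigr => j _; rewrite cImM Im_kernel /= mul0r addr0 mulrA.
  by ring.
have -> : \sum_j a j * cos (inner (t - s j) x) =
    cos (inner t x) * (\sum_j a j * cos (inner (s j) x)) + sin (inner t x) * (\sum_j a j * sin (inner (s j) x)).
  rewrite !mulr_sumr -big_split/=; apply: eq_bigr => j _; rewrite innerBl cosB; ring.
rewrite normc2E ReF ImF; have := cos2Dsin2 (inner t x).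
move: (cos (inner t x)) (sin (inner t x)) (\sum_j a j) (\sum_j a j * cos _) (\sum_j a j * sin _).
move: (weight x) => w C S A S1 S2 CS; rewrite -subr_ge0.
set u := C - (1 - A) - S1; set v := S - S2.
have -> : 1 - ((1 - A) * C + (C * S1 + S * S2)) = C * u + S * v.
  rewrite -[X in X - _]CS /u /v; ring.
(* Lagrange's identity: C u + S v is the real part after the rotation, and S u - C v is, up to sign,
   the imaginary part that is dropped. *)
rewrite (_ : _ - _ = (S * u - C * v) ^+ 2 * w ^+ 2 + (1 - (C ^+ 2 + S ^+ 2)) * (u ^+ 2 + v ^+ 2) * w ^+ 2); last by ring.
by rewrite CS subrr !mul0r addr0 mulr_ge0 ?sqr_ge0.
Qed.

Lemma measurable_cos_combination (p : nat) (s : 'I_p -> 'cV[R]_N) (a : 'I_p -> R) :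
  measurable_fun setT (fun x => (1 - \sum_(i < p) a i * cos (inner (s i) x)) ^+ 2
                                / (psi x `^ (2 + \tr E))).
Proof.
apply: measurable_funM.
  apply: measurable_funX; apply: measurable_funB => //; apply: measurable_sum => i.
  apply: measurable_funM => //.
  by apply: measurableT_comp; [exact: measurable_cos|exact: measurable_inner].
apply: (measurableT_comp measurable_invr).
exact: (measurableT_comp (measurable_powR _) (continuous_measurable_cV psi_cont)).
Qed.

End kernel.

(** The form with squared radii, in all dimensions: in dimension 0 every [tau] is 0, and the
    non-empty family of frequencies contradicts m > 0. *)
Lemma spectral_tau_lower_bound (R : realType) (N : nat) (E : 'M[R]_N) (nE psi : 'cV[R]_N -> R) :
  polar_norm E nE -> (forall x, 0 <= psi x) -> continuous psi -> homogeneous E^T psi ->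
  exists2 c : R, 0 < c &
    forall p (s : 'I_p.+1 -> 'cV[R]_N) (a : 'I_p.+1 -> R) (m : R),
    0 < m -> (forall i, m <= tau E nE (s i) ^+ 2) ->
    ((c * m)%:E <= \int[lebesgue_cV N]_y ((1 - \sum_(i < p.+1) a i * cos (inner (s i) y)) ^+ 2
                                   / (psi y `^ (2 + \tr E)))%:E)%E.
Proof.
case: N E nE psi => [|n] E nE psi hnE p0 pc ph.
  exists 1 => // p s a m m0 /(_ ord0); rewrite /tau flatmx0 eqxx expr0n /= => m0'.
  by move: m0; rewrite ltNge m0'.
have [c c0 H] := spectral_lower_bound hnE p0 pc ph; exists c => // p s a m m0 ms.
rewrite -[m]sqr_sqrtr ?(ltW m0)//; apply: H; first by rewrite sqrtr_gt0.
move=> i; rewrite -(ler_pXn2r (ltn0Sn 1)) ?nnegrE ?sqrtr_ge0 ?(tau_ge0 hnE)//.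
by rewrite sqr_sqrtr ?(ltW m0).
Qed.

Local Open Scope complex_scope.
Local Open Scope ring_scope.

Theorem theorem3p2 (R : realType) (N : nat)
    (E : 'M[R]_N) (hE : eigenvalues_Re_gt1 E)
    (nE : 'cV[R]_N -> R) (hnE : polar_norm E nE)
    (psi : 'cV[R]_N -> R)
    (psi_ge0 : forall x, 0 <= psi x)
    (psi_cont : continuous psi)
    (psi_sym : forall x, psi x = psi (- x))
    (psi_hom : homogeneous E^T psi)
    (d : measure_display) (Omega : measurableType d) (P : probability Omega R)
    (M : set 'cV[R]_N -> Omega -> R[i]) (hM : gaussian_random_measure P M)
    (X : 'cV[R]_N -> {RV P >-> R})
    (hX : forall t, is_stochastic_integral P M (spectral_kernel E psi t)
                      (fun w => (X t w)%:C)) :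
  exists2 C5 : R, 0 < C5 &
    forall (n : nat) (t : nat -> 'cV[R]_N), (2 <= n)%N -> t 0%N = 0 ->
      {ae P, forall w,
        C5 * \big[Num.min/tau E nE (t n - t 0%N) ^+ 2]_(0 <= k < n)
               tau E nE (t n - t k) ^+ 2
        <= cond_variance P (g_sigma_preimage (fun k : 'I_n.-1 => X (t k.+1)))
             (X (t n)) w}.
Proof.
have wX t : wiener P M (spectral_kernel E psi t) (X t).
  by split; [exact: cmeasurable_spectral_kernel|exact: measurable_funPT|exact: hX].
(* The division by 4 pays for the factor in [wiener_lower]. *)
have [c c0 Hc] := spectral_tau_lower_bound hnE psi_ge0 psi_cont psi_hom; exists (c / 4); first by rewrite divr_gt0.
move=> [//|p] t _ t0 /=.
have [a Ha] := cond_variance_wiener hM (fun j : 'I_p => wX (t j.+1)) (wX (t p.+1)).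
apply: filterS Ha => w ->.
set m := \big[Num.min/_]_(_ <= _ < _) _.
set s2 := \int[P]_w _.
have s20 : 0 <= s2 by apply: Rintegral_ge0 => x _; exact: sqr_ge0.
have [m0|m0] := leP m 0.
  by apply: le_trans s20; rewrite pmulr_rle0// divr_gt0.
have ms (i : 'I_p.+1) : m <= tau E nE (t p.+1 - t i) ^+ 2.
  by rewrite /m big_mkord; exact: bigmin_le.
(* The constants - 1 of the kernels add up to - (1 - sum a_j), which makes 1 - sum a_j the
   coefficient at t^0 = 0; the other points keep the coefficients of the projection. *)
pose b (i : 'I_p.+1) := oapp a (1 - \sum_j a j) (unlift ord0 i).
have := Hc p (fun i => t p.+1 - t i) b m m0 ms.
have wF := wiener_axpy hM (-1) (wiener_sum hM (index_enum 'I_p) a (fun j : 'I_p => wX (t j.+1))) (wX (t p.+1)).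
have low := wiener_lower hM wF.
have e : \int[P]_w0 ((-1 * (\sum_(i <- index_enum 'I_p) a i * X (t i.+1) w0) + X (t p.+1) w0) ^+ 2) = s2.
  by apply: eq_Rintegral => x _; rewrite mulN1r addrC.
rewrite e in low => H.
have := le_trans H (le_trans _ low); rewrite lee_fin => H'.
suff : c * m <= 4 * s2 by lra.
apply: H'; apply: ge0_le_integral => //.
- by move=> x _; rewrite lee_fin divr_ge0 ?sqr_ge0 ?powR_ge0.
- by apply/measurable_EFinP; exact: measurable_cos_combination.
- by apply/measurable_EFinP/measurable_normc2; case: wF.
- move=> x _; rewrite lee_fin.
  have := normc2_kernel_ge E psi (t p.+1) (fun j : 'I_p => t j.+1) a x.
  rewrite big_ord_recl /b unlift_none t0 subr0 /=.
  congr (_ <= _); congr ((1 - (_ + _)) ^+ 2 / _); apply: eq_bigr => j _.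
  by rewrite liftK.
Qed.
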